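(* Let $c,q\in C^\infty(\mathbb{T}^1)$ be complex-valued smooth functions and let $L$ be the differential operator on $\mathbb{T}^1\times\mathbb{R}$ given by $$L=\partial_t+c(t)\partial_x+q(t).$$ Set $c_0=\frac{1}{2\pi}\int_0^{2\pi}c(t)\,dt$, $q_0=\frac{1}{2\pi}\int_0^{2\pi}q(t)\,dt$ and $b=\operatorname{Im}(c)$. Then $L$ is Schwartz globally hypoelliptic if and only if the set $$Z_{L_0}=\{(k,\xi)\in\mathbb{Z}\times\mathbb{R} : k+c_0\xi-iq_0=0\}$$ is empty and $b$ does not change sign on $\mathbb{T}^1$.
   Context: $\mathbb{T}^1=\mathbb{R}/2\pi\mathbb{Z}$; functions on $\mathbb{T}^1$ are identified with $2\pi$-periodic functions on $\mathbb{R}$. The Schwartz space $\mathcal{S}(\mathbb{T}^1\times\mathbb{R})$ is the space of $f\in C^\infty(\mathbb{T}^1\times\mathbb{R})$ with $\sup_{t,x}|x^\gamma\partial_t^\alpha\partial_x^\beta f(t,x)|<\infty$ for all $\alpha,\beta,\gamma\in\mathbb{N}_0$, with the Fréchet topology given by these seminorms; $\mathcal{S}'(\mathbb{T}^1\times\mathbb{R})$ is its topological dual, on which $L$ acts in the distributional sense. $L$ is called Schwartz globally hypoelliptic if whenever $u\in\mathcal{S}'(\mathbb{T}^1\times\mathbb{R})$ satisfies $Lu\in\mathcal{S}(\mathbb{T}^1\times\mathbb{R})$, then $u\in\mathcal{S}(\mathbb{T}^1\times\mathbb{R})$. *)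

(* Defs.v *)
From Stdlib Require Import Reals List.
From Coquelicot Require Import Coquelicot.
Open Scope R_scope.

Definition pdt (g : R -> R -> R) : R -> R -> R :=
  fun t x => Derive (fun s => g s x) t.
Definition pdx (g : R -> R -> R) : R -> R -> R :=
  fun t x => Derive (fun y => g t y) x.

Fixpoint pdw (w : list bool) (g : R -> R -> R) : R -> R -> R :=
  match w with
  | nil => g
  | b :: w' => pdw w' (if b then pdt g else pdx g)
  end.

Definition smooth2 (g : R -> R -> R) : Prop :=
  forall (w : list bool) (t x : R),
    continuous (fun p : R * R => pdw w g (fst p) (snd p)) (t, x) /\
    ex_derive (fun s => pdw w g s x) t /\
    ex_derive (fun y => pdw w g t y) x.

(** Complex-valued functions on T^1 x R, identified with functions on R x R
    that are 2pi-periodic in t.  Derivatives are taken componentwise. *)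
Definition cre (f : R -> R -> C) : R -> R -> R := fun t x => Re (f t x).
Definition cim (f : R -> R -> C) : R -> R -> R := fun t x => Im (f t x).

Definition cdt (f : R -> R -> C) : R -> R -> C :=
  fun t x => (pdt (cre f) t x, pdt (cim f) t x).
Definition cdx (f : R -> R -> C) : R -> R -> C :=
  fun t x => (pdx (cre f) t x, pdx (cim f) t x).

Definition cdtn (n : nat) (f : R -> R -> C) : R -> R -> C := Nat.iter n cdt f.
Definition cdxn (n : nat) (f : R -> R -> C) : R -> R -> C := Nat.iter n cdx f.

Definition periodic2 (f : R -> R -> C) : Prop :=
  forall t x, f (t + 2 * PI) x = f t x.

Definition csmooth2 (f : R -> R -> C) : Prop :=
  smooth2 (cre f) /\ smooth2 (cim f).

Definition Schwartz (f : R -> R -> C) : Prop :=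
  periodic2 f /\ csmooth2 f /\
  forall alpha beta gamma : nat, exists M : R, forall t x : R,
    Cmod (Cmult (RtoC (x ^ gamma)) (cdtn alpha (cdxn beta f) t x)) <= M.

(** Linear continuous functionals on S(T^1 x R) (tempered distributions).
    Continuity for the Frechet topology given by the seminorms
    p_{a,b,g}(f) = sup |x^g d_t^a d_x^b f| means: there are N and C such
    that |u f| <= C * max_{a+b+g<=N} p_{a,b,g}(f); we write this without sup. *)
Definition tempered (u : (R -> R -> C) -> C) : Prop :=
  (forall f g, Schwartz f -> Schwartz g ->
     u (fun t x => Cplus (f t x) (g t x)) = Cplus (u f) (u g)) /\
  (forall (a : C) f, Schwartz f ->
     u (fun t x => Cmult a (f t x)) = Cmult a (u f)) /\
  (exists (N : nat) (K : R), forall f (M : R), Schwartz f ->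
     (forall alpha beta gamma : nat, (alpha + beta + gamma <= N)%nat ->
        forall t x : R,
        Cmod (Cmult (RtoC (x ^ gamma)) (cdtn alpha (cdxn beta f) t x)) <= M) ->
     Cmod (u f) <= K * M).

Definition int2 (h : R -> R -> R) : R :=
  RInt (fun t => RInt_gen (fun x => h t x)
                   (Rbar_locally m_infty) (Rbar_locally p_infty)) 0 (2 * PI).

Definition cpair (f phi : R -> R -> C) : C :=
  (int2 (fun t x => Re (Cmult (f t x) (phi t x))),
   int2 (fun t x => Im (Cmult (f t x) (phi t x)))).

Definition in_S (u : (R -> R -> C) -> C) : Prop :=
  exists f, Schwartz f /\ forall phi, Schwartz phi -> u phi = cpair f phi.

Definition smooth1 (g : R -> R) : Prop :=
  forall (n : nat) (t : R), ex_derive (Derive_n g n) t.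

Definition smooth_T1 (c : R -> C) : Prop :=
  (forall t, c (t + 2 * PI) = c t) /\
  smooth1 (fun t => Re (c t)) /\ smooth1 (fun t => Im (c t)).

(** Transpose of L = d_t + c(t) d_x + q(t):  tL phi = - d_t phi - c d_x phi + q phi. *)
Definition Lt (c q : R -> C) (phi : R -> R -> C) : R -> R -> C :=
  fun t x => Cplus (Copp (Cplus (cdt phi t x) (Cmult (c t) (cdx phi t x))))
                   (Cmult (q t) (phi t x)).

Definition Lop (c q : R -> C) (u : (R -> R -> C) -> C) : (R -> R -> C) -> C :=
  fun phi => u (Lt c q phi).

Definition Schwartz_GH (c q : R -> C) : Prop :=
  forall u, tempered u -> in_S (Lop c q u) -> in_S u.

Definition mean (c : R -> C) : C :=
  (RInt (fun t => Re (c t)) 0 (2 * PI) / (2 * PI),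
   RInt (fun t => Im (c t)) 0 (2 * PI) / (2 * PI)).

Definition Z_L0 (c q : R -> C) : (Z * R) -> Prop :=
  fun p => Cminus (Cplus (RtoC (IZR (fst p))) (Cmult (mean c) (RtoC (snd p))))
                  (Cmult Ci (mean q)) = RtoC 0.

(* Main.v *)
(**
  Sufficiency.  If every Schwartz right-hand side is solvable in the Schwartz space for both [L] and its
  transpose, then [u(tL phi) = (Lu)(phi)] identifies [u] with the Schwartz solution of [Lv = Lu].  Under the
  partial Fourier transform in [x] the equation becomes the periodic problem [w' + (i c(t) xi + q(t)) w = g],
  which is uniquely solvable for every [xi] exactly when [Z_{L_0}] is empty.  When [Im c] has constant sign one
  may integrate in the direction of time in which the exponential factor stays bounded, so
  [sup |w(., xi)| <= K sup |g(., xi)|] with [K] independent of [xi].  This one bound, applied to difference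
  quotients in [xi], yields all derivatives of [w].

  Necessity.  A point [(k, xi)] of [Z_{L_0}] gives a bounded periodic solution [v(t) e^{i xi x}] of [Lu = 0].
  If [Im c] changes sign, a primitive [B] of [Im c] rises, peaks at some [t0] and falls.  With [C] a primitive
  of [c] vanishing at [t0], the point [z = x - C(t)] stays in the closed upper half plane near the peak, where
  the function [G(z) = z^8 exp(-z^2 - i/z)] is bounded and, on the real line, not smooth at 0.  Then
  [u = chi(t) exp(-int q) G(z)] is not smooth at [(t0, 0)], while [Lu] only involves [chi'], which lives
  where [Im z] is bounded below and [G] is analytic.
*)

Require Import Defs.
From Stdlib Require Import Reals ZArith Lra Lia FunctionalExtensionality Classical.
From Coquelicot Require Import Coquelicot.
Open Scope R_scope.

(** * Componentwise complex calculus *)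

(** Only Schwartz functions are ever Fourier transformed: [u] enters through its values on test
    functions, which is why the transposed equation has to be solvable too. The bounds on periodic
    solutions hold for every periodic solution and not for an explicit formula, so they may be
    applied to differences of solutions at two frequencies. For [K] not to depend on [xi], the
    multiplier [exp(2 pi (i c_0 xi + q_0))] must keep a positive distance from 1; that it differs
    from 1 at every [xi] is enough, because its exponent runs along a line. Derivatives of integrals
    and of solutions come from explicit quadratic error bounds. In [G], the factor [exp(-i/z)] has
    modulus at most 1 on the closed upper half plane and oscillates along the real line, [exp(-z^2)]
    gives decay in [x], and the exponent 8 pays for four derivatives, since one derivative of
    [exp(-i/z)] costs two powers of [z]. Four is the order that the integration by parts against
    test functions uses. *)

Lemma is_derive_val (f : R -> R) (x l l' : R) :
  is_derive f x l -> l = l' -> is_derive f x l'.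
Proof. now intros H <-. Qed.

Lemma is_derive_Rplus (f g : R -> R) (x l m : R) :
  is_derive f x l -> is_derive g x m -> is_derive (fun y => f y + g y) x (l + m).
Proof. intros Hf Hg; exact (is_derive_plus f g x l m Hf Hg). Qed.

Lemma is_derive_Ropp (f : R -> R) (x l : R) :
  is_derive f x l -> is_derive (fun y => - f y) x (- l).
Proof. intros Hf; exact (is_derive_opp f x l Hf). Qed.

Lemma is_derive_Rminus (f g : R -> R) (x l m : R) :
  is_derive f x l -> is_derive g x m -> is_derive (fun y => f y - g y) x (l - m).
Proof. intros Hf Hg; exact (is_derive_minus f g x l m Hf Hg). Qed.

Lemma is_derive_Rmult (f g : R -> R) (x l m : R) :
  is_derive f x l -> is_derive g x m ->
  is_derive (fun y => f y * g y) x (l * g x + f x * m).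
Proof.
  intros Hf Hg; apply (is_derive_mult f g x l m Hf Hg); intros; apply Rmult_comm.
Qed.

Lemma is_derive_Rcomp (f g : R -> R) (x l m : R) :
  is_derive f (g x) l -> is_derive g x m -> is_derive (fun y => f (g y)) x (m * l).
Proof. intros Hf Hg; exact (is_derive_comp f g x l m Hf Hg). Qed.

Lemma is_derive_continuous (f : R -> R) (x l : R) : is_derive f x l -> continuous f x.
Proof. intros H; apply (ex_derive_continuous f); now exists l. Qed.

Lemma derive_Lipschitz (f df : R -> R) (a b M : R) :
  (forall x, Rmin a b <= x <= Rmax a b -> is_derive f x (df x)) ->
  (forall x, Rmin a b <= x <= Rmax a b -> Rabs (df x) <= M) ->
  Rabs (f b - f a) <= M * Rabs (b - a).
Proof.
  intros Hd HM.
  destruct (MVT_gen f a b df) as [c [Hc ->]].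
  - intros x Hx; apply Hd; lra.
  - intros x Hx; apply continuity_pt_filterlim.
    exact (is_derive_continuous _ _ _ (Hd x Hx)).
  - rewrite Rabs_mult; apply Rmult_le_compat_r; [apply Rabs_pos | now apply HM].
Qed.

Lemma im_le_Cmod (z : C) : Rabs (Im z) <= Cmod z.
Proof. eapply Rle_trans; [apply Rmax_r | apply (Rmax_Cmod z)]. Qed.

Lemma Cmod_le_Re_Im (z : C) : Cmod z <= Rabs (Re z) + Rabs (Im z).
Proof.
  unfold Cmod; rewrite <- (sqrt_Rsqr (Rabs (Re z) + Rabs (Im z))).
  - apply sqrt_le_1_alt; unfold Rsqr.
    generalize (Rabs_pos (Re z)) (Rabs_pos (Im z)); intros.
    replace (fst z ^ 2) with (Rabs (Re z) ^ 2) by (unfold Re; rewrite <- Rsqr_pow2, <- Rsqr_abs, Rsqr_pow2; reflexivity).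
    replace (snd z ^ 2) with (Rabs (Im z) ^ 2) by (unfold Im; rewrite <- Rsqr_pow2, <- Rsqr_abs, Rsqr_pow2; reflexivity).
    nra.
  - generalize (Rabs_pos (Re z)) (Rabs_pos (Im z)); lra.
Qed.

Lemma C_ext (z w : C) : Re z = Re w -> Im z = Im w -> z = w.
Proof. destruct z, w; simpl; intros; now subst. Qed.

(** Derivative of a complex-valued function of a real variable, taken componentwise to agree with
    [cdt] and [cdx]. *)
Definition isD (f : R -> C) (t : R) (l : C) : Prop :=
  is_derive (fun s => Re (f s)) t (Re l) /\ is_derive (fun s => Im (f s)) t (Im l).

Lemma isD_val (f : R -> C) (t : R) (l m : C) : isD f t l -> l = m -> isD f t m.
Proof. now intros H <-. Qed.

Lemma isD_ext (f g : R -> C) (t : R) (l : C) :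
  (forall s, f s = g s) -> isD f t l -> isD g t l.
Proof.
  intros E; assert (f = g) as -> by now apply functional_extensionality. easy.
Qed.

Lemma isD_unique (f : R -> C) (t : R) (l m : C) : isD f t l -> isD f t m -> l = m.
Proof.
  intros [H1 H2] [H3 H4].
  apply C_ext; [ rewrite <- (is_derive_unique _ _ _ H1) | rewrite <- (is_derive_unique _ _ _ H2)];
  now apply is_derive_unique.
Qed.

Lemma isD_const (z : C) (t : R) : isD (fun _ => z) t 0.
Proof. split; exact (is_derive_const _ _). Qed.

Lemma isD_RtoC (f : R -> R) (t l : R) : is_derive f t l -> isD (fun s => RtoC (f s)) t l.
Proof. intros H; split; simpl; [exact H | exact (is_derive_const _ _)]. Qed.

Lemma isD_id (t : R) : isD RtoC t 1.
Proof. apply isD_RtoC; exact (is_derive_id t). Qed.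

Lemma isD_plus (f g : R -> C) (t : R) (l m : C) :
  isD f t l -> isD g t m -> isD (fun s => f s + g s)%C t (l + m)%C.
Proof. intros [H1 H2] [H3 H4]; split; simpl; now apply is_derive_Rplus. Qed.

Lemma isD_opp (f : R -> C) (t : R) (l : C) : isD f t l -> isD (fun s => - f s)%C t (- l)%C.
Proof. intros [H1 H2]; split; simpl; now apply is_derive_Ropp. Qed.

Lemma isD_minus (f g : R -> C) (t : R) (l m : C) :
  isD f t l -> isD g t m -> isD (fun s => f s - g s)%C t (l - m)%C.
Proof. intros; apply isD_plus; [easy | now apply isD_opp]. Qed.

Lemma isD_mult (f g : R -> C) (t : R) (l m : C) :
  isD f t l -> isD g t m -> isD (fun s => f s * g s)%C t (l * g t + f t * m)%C.
Proof.
  intros [H1 H2] [H3 H4]; split; simpl.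
  - eapply is_derive_val.
    { apply is_derive_Rminus; apply is_derive_Rmult; [exact H1 | exact H3 | exact H2 | exact H4]. }
    unfold Re, Im; simpl; ring.
  - eapply is_derive_val.
    { apply is_derive_Rplus; apply is_derive_Rmult; [exact H1 | exact H4 | exact H2 | exact H3]. }
    unfold Re, Im; simpl; ring.
Qed.

Lemma isD_scal (z : C) (f : R -> C) (t : R) (l : C) :
  isD f t l -> isD (fun s => z * f s)%C t (z * l)%C.
Proof.
  intros H; eapply isD_val; [apply isD_mult; [apply isD_const | exact H] | simpl; ring].
Qed.

Lemma isD_comp (f : R -> C) (g : R -> R) (t m : R) (l : C) :
  isD f (g t) l -> is_derive g t m -> isD (fun s => f (g s)) t (m * l)%C.
Proof.
  intros [H1 H2] H; split.
  - eapply is_derive_val; [apply (is_derive_Rcomp (fun s => Re (f s)) g t (Re l) m H1 H) | unfold Re; simpl; ring].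
  - eapply is_derive_val; [apply (is_derive_Rcomp (fun s => Im (f s)) g t (Im l) m H2 H) | unfold Im; simpl; ring].
Qed.

Lemma isD_inv (f : R -> C) (t : R) (l : C) :
  isD f t l -> f t <> 0 -> isD (fun s => / f s)%C t (- (l * (/ f t * / f t)))%C.
Proof.
  intros [H1 H2] H0.
  assert (Hn : Re (f t) ^ 2 + Im (f t) ^ 2 <> 0).
  { intros E; apply H0; apply C_ext; simpl; unfold Re, Im in *; nra. }
  set (n := fun s => Re (f s) * Re (f s) + Im (f s) * Im (f s)).
  assert (En : forall s, n s = fst (f s) * (fst (f s) * 1) + snd (f s) * (snd (f s) * 1))
    by (intros s; unfold n, Re, Im; ring).
  assert (Hn' : is_derive (fun s => / n s) t
      (- (2 * Re (f t) * Re l + 2 * Im (f t) * Im l) / (n t) ^ 2)).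
  { apply is_derive_inv; [ | unfold n; intros E; apply Hn; rewrite <- E; ring].
    eapply is_derive_val; [exact (is_derive_Rplus _ _ _ _ _ (is_derive_Rmult _ _ _ _ _ H1 H1) (is_derive_Rmult _ _ _ _ _ H2 H2)) | simpl; unfold Re, Im; ring]. }
  split.
  - apply (is_derive_ext (fun s => Re (f s) * / n s)).
    { intros s; simpl; unfold Rdiv; rewrite (En s); reflexivity. }
    eapply is_derive_val; [exact (is_derive_Rmult _ _ _ _ _ H1 Hn') | ].
    unfold n, Re, Im in *; simpl in *; field; intros E; apply Hn; rewrite <- E; ring.
  - apply (is_derive_ext (fun s => (- Im (f s)) * / n s)).
    { intros s; simpl; unfold Rdiv; rewrite (En s); reflexivity. }
    eapply is_derive_val; [exact (is_derive_Rmult _ _ _ _ _ (is_derive_Ropp _ _ _ H2) Hn') | ].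
    unfold n, Re, Im in *; simpl in *; field; intros E; apply Hn; rewrite <- E; ring.
Qed.

Definition cexp (z : C) : C := (exp (Re z) * cos (Im z), exp (Re z) * sin (Im z)).

Lemma isD_cexp (f : R -> C) (t : R) (l : C) :
  isD f t l -> isD (fun s => cexp (f s)) t (l * cexp (f t))%C.
Proof.
  intros [H1 H2].
  assert (He : is_derive (fun s => exp (Re (f s))) t (Re l * exp (Re (f t)))).
  { apply (is_derive_Rcomp exp _ t _ _ (is_derive_exp _) H1). }
  assert (Hc : is_derive (fun s => cos (Im (f s))) t (Im l * - sin (Im (f t)))).
  { apply (is_derive_Rcomp cos _ t _ _ (is_derive_cos _) H2). }
  assert (Hs : is_derive (fun s => sin (Im (f s))) t (Im l * cos (Im (f t)))).
  { apply (is_derive_Rcomp sin _ t _ _ (is_derive_sin _) H2). }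
  split; eapply is_derive_val;
    [apply (is_derive_Rmult _ _ _ _ _ He Hc) | | apply (is_derive_Rmult _ _ _ _ _ He Hs) |];
    unfold cexp; simpl; unfold Re, Im; ring.
Qed.

Lemma cexp_plus (z w : C) : cexp (z + w) = (cexp z * cexp w)%C.
Proof.
  apply C_ext; unfold cexp, Re, Im; simpl; rewrite exp_plus; [rewrite cos_plus | rewrite sin_plus]; ring.
Qed.

Lemma cexp_0 : cexp 0 = 1.
Proof. apply C_ext; unfold cexp; simpl; rewrite exp_0, ?cos_0, ?sin_0; ring. Qed.

Lemma Cmod_cexp (z : C) : Cmod (cexp z) = exp (Re z).
Proof.
  unfold Cmod, cexp, Re, Im; simpl.
  rewrite <- (sqrt_Rsqr (exp (fst z))) by (left; apply exp_pos).
  f_equal; rewrite sqrt_Rsqr by (left; apply exp_pos).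
  generalize (sin2_cos2 (snd z)); unfold Rsqr; intros E.
  transitivity (exp (fst z) * exp (fst z) * (sin (snd z) * sin (snd z) + cos (snd z) * cos (snd z))); [ring |].
  rewrite E; ring.
Qed.

Lemma cexp_opp (z : C) : (cexp z * cexp (- z))%C = 1.
Proof. rewrite <- cexp_plus, <- cexp_0; f_equal; ring. Qed.

(** The mean value theorem fails for complex values; applied to the real and imaginary parts
    separately it costs the factor 2, which reappears in later constants. *)
Lemma isD_Lipschitz (f df : R -> C) (a b M : R) :
  (forall x, Rmin a b <= x <= Rmax a b -> isD f x (df x)) ->
  (forall x, Rmin a b <= x <= Rmax a b -> Cmod (df x) <= M) ->
  Cmod (f b - f a) <= 2 * M * Rabs (b - a).
Proof.
  intros Hd HM; eapply Rle_trans; [apply Cmod_le_Re_Im |].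
  assert (Rabs (Re (f b) - Re (f a)) <= M * Rabs (b - a)).
  { apply (derive_Lipschitz (fun x => Re (f x)) (fun x => Re (df x))).
    - intros x Hx; apply Hd, Hx.
    - intros x Hx; eapply Rle_trans; [apply re_le_Cmod | now apply HM]. }
  assert (Rabs (Im (f b) - Im (f a)) <= M * Rabs (b - a)).
  { apply (derive_Lipschitz (fun x => Im (f x)) (fun x => Im (df x))).
    - intros x Hx; apply Hd, Hx.
    - intros x Hx; eapply Rle_trans; [apply im_le_Cmod | now apply HM]. }
  replace (Re (f b - f a)%C) with (Re (f b) - Re (f a)) by (unfold Re; simpl; ring).
  replace (Im (f b - f a)%C) with (Im (f b) - Im (f a)) by (unfold Im; simpl; ring).
  lra.
Qed.

Lemma isD_const_of_zero (f : R -> C) :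
  (forall x, isD f x 0) -> forall a b, f a = f b.
Proof.
  intros H a b.
  assert (Cmod (f b - f a) <= 2 * 0 * Rabs (b - a)).
  { apply (isD_Lipschitz f (fun _ => 0)); intros; [apply H | rewrite Cmod_0; lra]. }
  assert (E : (f b - f a)%C = 0) by (apply Cmod_eq_0; generalize (Cmod_ge_0 (f b - f a)); lra).
  replace (f b) with ((f b - f a) + f a)%C by ring; rewrite E; ring.
Qed.

(** The remainder [r u = f u - (u - t) f'(t)] has derivative [df u - df t], of size at most
    [M |s - t|] between [t] and [s]. *)
Lemma isD_Taylor (f df : R -> C) (t M : R) :
  (forall s, isD f s (df s)) ->
  (forall s, Cmod (df s - df t) <= M * Rabs (s - t)) ->
  forall s, Cmod (f s - f t - (s - t)%R * df t) <= 2 * M * (s - t) ^ 2.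
Proof.
  intros Hd HL s.
  set (r := fun u => (f u - (u - t)%R * df t)%C).
  replace (f s - f t - (s - t)%R * df t)%C with (r s - r t)%C
    by (unfold r; rewrite Rminus_diag; ring).
  replace (2 * M * (s - t) ^ 2) with (2 * (M * Rabs (s - t)) * Rabs (s - t)).
  2: { rewrite <- (pow2_abs (s - t)); ring. }
  apply (isD_Lipschitz r (fun u => df u - df t)%C).
  - intros x _; unfold r; apply isD_minus; [apply Hd |].
    eapply isD_val; [apply isD_mult; [apply isD_RtoC with (l := 1) | apply isD_const] |].
    + auto_derive; [easy | ring].
    + cbv beta; ring.
  - intros x Hx; eapply Rle_trans; [apply HL |].
    (* The sign of [M] is forced by the Lipschitz bound unless [s = t]. *)
    assert (HM : 0 <= M \/ s = t).
    { destruct (Req_dec s t) as [| Hn]; [now right | left].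
      assert (0 < Rabs (s - t)) by (apply Rabs_pos_lt; lra).
      generalize (Cmod_ge_0 (df s - df t)) (HL s); nra. }
    destruct HM as [HM | ->].
    + apply Rmult_le_compat_l; [easy |].
      destruct (Rle_dec t s) as [h | h];
        [rewrite Rmin_left, Rmax_right in Hx by lra | rewrite Rmin_right, Rmax_left in Hx by lra].
      * rewrite !Rabs_pos_eq; lra.
      * rewrite !Rabs_left1; lra.
    + rewrite Rmin_left, Rmax_left in Hx by lra; replace x with t by lra; lra.
Qed.

(** An explicit quadratic error replaces the passage to the limit; integrals and solution operators
    are differentiated this way. The error is controlled only for [|s - t| <= 1], so that a bound by
    a higher power of [|s - t|] also qualifies. *)
Lemma is_derive_of_quad (f : R -> R) (t l M : R) :
  (forall s, Rabs (s - t) <= 1 -> Rabs (f s - f t - (s - t) * l) <= M * (s - t) ^ 2) -> is_derive f t l.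
Proof.
  intros H; apply is_derive_Reals; intros eps He.
  assert (HM : 0 <= Rabs M) by apply Rabs_pos.
  assert (Hd : 0 < Rmin 1 (eps / (Rabs M + 1))).
  { apply Rmin_pos; [lra |]. apply Rdiv_lt_0_compat; lra. }
  exists (mkposreal _ Hd); intros h Hh Hy; simpl in Hy.
  assert (Hp : 0 < Rabs h) by now apply Rabs_pos_lt.
  specialize (H (t + h)); replace (t + h - t) with h in H by ring.
  replace ((f (t + h) - f t) / h - l) with ((f (t + h) - f t - h * l) / h) by (field; easy).
  unfold Rdiv; rewrite Rabs_mult, Rabs_inv; apply Rmult_lt_reg_r with (Rabs h); [easy |].
  rewrite Rmult_assoc, Rinv_l, Rmult_1_r by lra.
  eapply Rle_lt_trans; [apply H; eapply Rlt_le, Rlt_le_trans; [exact Hy | apply Rmin_l] |].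
  assert (Rabs h * (Rabs M + 1) < eps).
  { apply Rlt_div_r; [lra |]. eapply Rlt_le_trans; [exact Hy | apply Rmin_r]. }
  rewrite <- (pow2_abs h); generalize (RRle_abs M); nra.
Qed.

Lemma isD_of_quad (f : R -> C) (t M : R) (l : C) :
  (forall s, Rabs (s - t) <= 1 -> Cmod (f s - f t - (s - t)%R * l) <= M * (s - t) ^ 2) -> isD f t l.
Proof.
  intros H; split; apply is_derive_of_quad with M; intros s Hs.
  - eapply Rle_trans; [| apply (H s Hs)]. eapply Rle_trans; [| apply re_le_Cmod].
    right; f_equal; unfold Re; simpl; ring.
  - eapply Rle_trans; [| apply (H s Hs)]. eapply Rle_trans; [| apply im_le_Cmod].
    right; f_equal; unfold Im; simpl; ring.
Qed.

Lemma isD_translate (f df : R -> C) (c : R) :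
  (forall s, isD f s (df s)) -> forall s, isD (fun u => f (u + c)) s (df (s + c)).
Proof.
  intros HD s; eapply isD_val; [apply (isD_comp f (fun u => u + c) s 1); [apply HD |] | ring].
  auto_derive; [easy | ring].
Qed.

(** * Improper integrals *)

(* Coquelicot types real integrals in [CompleteSpace.sort _], where [ring] finds no structure. *)
Ltac gen_RInt :=
  repeat match goal with |- context [RInt ?f ?a ?b] =>
    let v := fresh "v" in pose (v := RInt f a b : R); change (RInt f a b) with v; clearbody v end;
  match goal with |- @eq _ ?a ?b => change (@eq R a b) end.
Ltac Rring := gen_RInt; ring.

(** The inner integral of [int2], which makes [cpair_I2] hold by conversion. *)
Definition IR (f : R -> R) : R :=
  RInt_gen f (Rbar_locally m_infty) (Rbar_locally p_infty).

(** [1 / (1 + x^2)] has the primitive [atan], of total variation [PI]: tails and bounds uniform in a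
    parameter become explicit. *)
Definition dominated (f : R -> R) (M : R) : Prop :=
  (forall x, continuous f x) /\ (forall x, Rabs (f x) <= M / (1 + x ^ 2)).

Lemma one_plus_sq_pos (x : R) : 0 < 1 + x ^ 2.
Proof. nra. Qed.

Lemma dominated_nonneg (f : R -> R) (M : R) : dominated f M -> 0 <= M.
Proof.
  intros [_ H]; specialize (H 0); generalize (Rabs_pos (f 0)).
  replace (M / (1 + 0 ^ 2)) with M in H by field; lra.
Qed.

Lemma ex_RInt_continuous_all (f : R -> R) (a b : R) : (forall x, continuous f x) -> ex_RInt f a b.
Proof. intros H; apply (ex_RInt_continuous f); intros; apply H. Qed.

Lemma is_derive_RInt_upper (f : R -> R) (a x : R) :
  (forall x, continuous f x) -> is_derive (fun y => RInt f a y) x (f x).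
Proof.
  intros H; apply is_derive_RInt with a; [| apply H].
  apply filter_forall; intros y; apply (RInt_correct f), ex_RInt_continuous_all, H.
Qed.

Lemma RInt_split (f : R -> R) (a b c : R) :
  (forall x, continuous f x) -> RInt f a c = RInt f a b + RInt f b c.
Proof.
  intros H; symmetry; exact (RInt_Chasles f a b c (ex_RInt_continuous_all f a b H) (ex_RInt_continuous_all f b c H)).
Qed.

Lemma RInt_FTC (F f : R -> R) (a b : R) :
  (forall x, is_derive F x (f x)) -> (forall x, continuous f x) -> RInt f a b = F b - F a.
Proof.
  intros HF Hf; apply (is_RInt_unique f); apply (is_RInt_derive F f); intros; [apply HF | apply Hf].
Qed.

Lemma dominated_RInt_atan (f : R -> R) (M a b : R) :
  dominated f M -> a <= b -> Rabs (RInt f a b) <= M * (atan b - atan a).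
Proof.
  intros [Hc Hb] Hab.
  assert (Hk : forall x, continuous (fun y => M / (1 + y ^ 2)) x).
  { intros x; apply (is_derive_continuous _ x (M * - (2 * x) / (1 + x ^ 2) ^ 2)).
    auto_derive; [generalize (one_plus_sq_pos x); simpl; lra |].
    field; generalize (one_plus_sq_pos x); simpl; lra. }
  assert (E : RInt (fun y => M / (1 + y ^ 2)) a b = M * atan b - M * atan a :> R).
  2: rewrite <- Rmult_minus_distr_l in E; rewrite <- E.
  - apply (RInt_FTC (fun y => M * atan y)); [| easy].
    intros x; eapply is_derive_val; [apply is_derive_scal, is_derive_atan |].
    unfold Rsqr; field; generalize (one_plus_sq_pos x); simpl; lra.
  - eapply Rle_trans; [apply abs_RInt_le; [easy | now apply ex_RInt_continuous_all] |].
    apply RInt_le; [easy | | now apply ex_RInt_continuous_all | intros; apply Hb].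
    apply ex_RInt_continuous_all; intros x; apply (continuous_comp f Rabs); [apply Hc |].
    apply continuous_Rabs.
Qed.

(** Cauchy criterion: the integral between two points is at most [M] times the increment of [atan],
    which is small near either end of the line. The boolean selects the end. *)
Lemma dominated_lim (f : R -> R) (M : R) (s : bool) :
  dominated f M ->
  exists l, filterlim (fun x => RInt f 0 x) (Rbar_locally (if s then p_infty else m_infty)) (locally l).
Proof.
  intros H.
  apply (filterlim_locally_cauchy (F := Rbar_locally (if s then p_infty else m_infty)) (fun x => RInt f 0 x)).
  intros eps.
  assert (HM : 0 <= M) by (eapply dominated_nonneg; exact H).
  (* [M + 1] avoids dividing by zero; [PI / 4] keeps [PI / 2 - d] in the range where [atan] inverts
     [tan]. *)
  set (d := Rmin (PI / 4) (eps / (M + 1))).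
  assert (He : 0 < eps / (M + 1)) by (apply Rdiv_lt_0_compat; [apply cond_pos | lra]).
  assert (Hd : 0 < d) by (apply Rmin_pos; [generalize PI_RGT_0; lra | easy]).
  assert (Hd1 : d <= PI / 4) by apply Rmin_l.
  assert (Hd2 : M * d < eps).
  { apply Rle_lt_trans with (M * (eps / (M + 1))).
    - apply Rmult_le_compat_l; [easy | apply Rmin_r].
    - assert (eps / (M + 1) * (M + 1) = eps) by (field; lra); nra. }
  assert (Key : forall u v, Rabs (atan u - atan v) <= d -> ball (RInt f 0 u) eps (RInt f 0 v)).
  { intros u v Huv.
    assert (Hw : forall a b, a <= b -> Rabs (atan a - atan b) <= d -> Rabs (RInt f 0 b - RInt f 0 a) < eps).
    { intros a b Hab Hle.
      rewrite (RInt_split f 0 a b) by apply H.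
      replace (RInt f 0 a + RInt f a b - RInt f 0 a) with (RInt f a b) by Rring.
      eapply Rle_lt_trans; [now apply (dominated_RInt_atan f M) |].
      eapply Rle_lt_trans; [| exact Hd2]. apply Rmult_le_compat_l; [easy |].
      rewrite Rabs_minus_sym in Hle; eapply Rle_trans; [apply RRle_abs | exact Hle]. }
    change (Rabs (RInt f 0 v - RInt f 0 u) < eps).
    destruct (Rle_dec u v) as [h | h]; [now apply Hw |].
    rewrite Rabs_minus_sym; apply Hw; [lra | now rewrite Rabs_minus_sym]. }
  set (A := tan (PI / 2 - d)).
  assert (HA : atan A = PI / 2 - d) by (apply atan_tan; lra).
  destruct s.
  - exists (fun x => A < x); split; [now exists A |].
    intros u v Hu Hv; apply Key.
    apply atan_increasing in Hu; apply atan_increasing in Hv.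
    generalize (atan_bound u) (atan_bound v); intros; apply Rabs_le; lra.
  - exists (fun x => x < - A); split; [now exists (- A) |].
    intros u v Hu Hv; apply Key.
    apply atan_increasing in Hu; apply atan_increasing in Hv; rewrite atan_opp in *.
    generalize (atan_bound u) (atan_bound v); intros; apply Rabs_le; lra.
Qed.

(** The two endpoints run to infinity independently, since a translation moves the symmetric
    intervals off centre. *)
Lemma dominated_IR_lim_gen (f : R -> R) (M : R) (u v : nat -> R) :
  dominated f M -> is_lim_seq u p_infty -> is_lim_seq v m_infty ->
  is_lim_seq (fun n => RInt f (v n) (u n)) (IR f).
Proof.
  intros H Hu Hv; destruct (dominated_lim f M true H) as [lp Hp], (dominated_lim f M false H) as [lm Hm].
  assert (HF : forall x, is_derive (fun x => RInt f 0 x) x (f x)).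
  { intros x; apply is_derive_RInt_upper, H. }
  assert (HD : Derive (fun x => RInt f 0 x) = f).
  { apply functional_extensionality; intros x; apply is_derive_unique, HF. }
  assert (HI : IR f = lp - lm).
  { generalize (@is_RInt_gen_Derive (Rbar_locally m_infty) (Rbar_locally p_infty) _ _ (fun x => RInt f 0 x) lm lp); rewrite HD.
    intros HG; refine (@is_RInt_gen_unique R_CompleteNormedModule _ _ _ _ f (lp - lm) (HG _ _ Hm Hp)).
    - apply filter_forall; intros ab x _; now exists (f x).
    - apply filter_forall; intros ab x _; apply H. }
  rewrite HI.
  apply is_lim_seq_ext with (fun n => RInt f 0 (u n) - RInt f 0 (v n)).
  { intros n; rewrite (RInt_split f 0 (v n) (u n)) by apply H; Rring. }
  apply is_lim_seq_minus'.
  - exact (filterlim_comp _ _ _ u (fun x => RInt f 0 x) _ (Rbar_locally p_infty) _ Hu Hp).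
  - exact (filterlim_comp _ _ _ v (fun x => RInt f 0 x) _ (Rbar_locally m_infty) _ Hv Hm).
Qed.

Lemma dominated_IR_lim (f : R -> R) (M : R) :
  dominated f M -> is_lim_seq (fun n => RInt f (- INR n) (INR n)) (IR f).
Proof.
  intros H; apply dominated_IR_lim_gen with M; [easy | exact is_lim_seq_INR |].
  exact (proj1 (is_lim_seq_opp _ _) is_lim_seq_INR).
Qed.

Lemma IR_of_lim (f : R -> R) (M l : R) :
  dominated f M -> is_lim_seq (fun n => RInt f (- INR n) (INR n)) l -> IR f = l.
Proof.
  intros H Hl; apply is_lim_seq_unique in Hl.
  rewrite (is_lim_seq_unique _ _ (dominated_IR_lim f M H)) in Hl; now injection Hl.
Qed.

Lemma IR_shift (f : R -> R) (M N c : R) :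
  dominated f M -> dominated (fun x => f (x + c)) N -> IR (fun x => f (x + c)) = IR f.
Proof.
  intros Hf Hc; apply IR_of_lim with N; [easy |].
  apply is_lim_seq_ext with (fun n => RInt f (- INR n + c) (INR n + c)).
  { intros n; generalize (RInt_comp_lin f 1 c (- INR n) (INR n)); rewrite !Rmult_1_l; intros E.
    rewrite <- E by (apply ex_RInt_continuous_all, Hf).
    apply RInt_ext; intros x _; unfold scal; simpl; unfold mult; simpl; now rewrite !Rmult_1_l. }
  apply dominated_IR_lim_gen with M; [easy | |].
  - apply is_lim_seq_plus with p_infty c; [exact is_lim_seq_INR | apply is_lim_seq_const | easy].
  - apply is_lim_seq_plus with m_infty c; [| apply is_lim_seq_const | easy].
    exact (proj1 (is_lim_seq_opp _ _) is_lim_seq_INR).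
Qed.

Lemma dominated_plus (f g : R -> R) (M N : R) :
  dominated f M -> dominated g N -> dominated (fun x => f x + g x) (M + N).
Proof.
  intros [Hf1 Hf2] [Hg1 Hg2]; split.
  - intros x; apply (continuous_plus f g); auto.
  - intros x; eapply Rle_trans; [apply Rabs_triang |].
    rewrite Rdiv_plus_distr; now apply Rplus_le_compat.
Qed.

Lemma dominated_scal (f : R -> R) (M c : R) :
  dominated f M -> dominated (fun x => c * f x) (Rabs c * M).
Proof.
  intros [Hf1 Hf2]; split.
  - intros x; apply (continuous_scal_r c f); auto.
  - intros x; rewrite Rabs_mult; unfold Rdiv; rewrite Rmult_assoc.
    apply Rmult_le_compat_l; [apply Rabs_pos | apply Hf2].
Qed.

Lemma IR_plus (f g : R -> R) (M N : R) :
  dominated f M -> dominated g N -> IR (fun x => f x + g x) = IR f + IR g.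
Proof.
  intros Hf Hg; apply IR_of_lim with (M + N); [now apply dominated_plus |].
  apply is_lim_seq_ext with (fun n => RInt f (- INR n) (INR n) + RInt g (- INR n) (INR n)).
  { intros n; symmetry; apply (RInt_plus f g); apply ex_RInt_continuous_all; [apply Hf | apply Hg]. }
  apply is_lim_seq_plus'; eapply dominated_IR_lim; eassumption.
Qed.

Lemma IR_scal (f : R -> R) (M c : R) :
  dominated f M -> IR (fun x => c * f x) = c * IR f.
Proof.
  intros Hf; apply IR_of_lim with (Rabs c * M); [now apply dominated_scal |].
  apply is_lim_seq_ext with (fun n => c * RInt f (- INR n) (INR n)).
  { intros n; symmetry; apply (RInt_scal f); apply ex_RInt_continuous_all; apply Hf. }
  apply (is_lim_seq_scal_l _ c (Finite (IR f))); eapply dominated_IR_lim; eassumption.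
Qed.

Lemma IR_bound (f : R -> R) (M : R) : dominated f M -> Rabs (IR f) <= M * PI.
Proof.
  intros H; generalize (is_lim_seq_abs _ _ (dominated_IR_lim f M H)); intros Hl.
  refine (is_lim_seq_le _ _ _ (Finite (M * PI)) _ Hl (is_lim_seq_const _)).
  intros n; eapply Rle_trans; [apply (dominated_RInt_atan f M); [easy | generalize (pos_INR n); lra] |].
  apply Rmult_le_compat_l; [eapply dominated_nonneg, H |].
  generalize (atan_bound (INR n)) (atan_bound (- INR n)); lra.
Qed.

Lemma IR_nonneg (f : R -> R) (M : R) : dominated f M -> (forall x, 0 <= f x) -> 0 <= IR f.
Proof.
  intros H Hp.
  refine (is_lim_seq_le _ _ (Finite 0) _ _ (is_lim_seq_const _) (dominated_IR_lim f M H)).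
  intros n; apply RInt_ge_0; [generalize (pos_INR n); lra | apply ex_RInt_continuous_all, H | auto].
Qed.

(** The half-open condition on [x0] lets the left end of a period count as a point of positivity. *)
Lemma RInt_pos_of_point (f : R -> R) (a b x0 : R) :
  (forall x, continuous f x) -> (forall x, 0 <= f x) -> a <= x0 < b -> 0 < f x0 -> 0 < RInt f a b.
Proof.
  intros Hc Hp Hx H0.
  assert (Hloc : locally x0 (fun x => 0 < f x)).
  { apply (Hc x0 (fun y => 0 < y)), (open_gt 0), H0. }
  destruct Hloc as [d Hd].
  set (a' := Rmax a (x0 - d / 2)); set (b' := Rmin b (x0 + d / 2)).
  generalize (cond_pos d); intros Hd0.
  assert (a <= a') by apply Rmax_l; assert (x0 - d / 2 <= a') by apply Rmax_r.
  assert (b' <= b) by apply Rmin_l; assert (b' <= x0 + d / 2) by apply Rmin_r.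
  assert (a' <= x0) by (apply Rmax_lub; lra).
  assert (x0 < b') by (apply Rmin_glb_lt; lra).
  rewrite (RInt_split f a a' b), (RInt_split f a' b' b) by easy.
  assert (0 <= RInt f a a') by (apply RInt_ge_0; [easy | now apply ex_RInt_continuous_all | auto]).
  assert (0 <= RInt f b' b) by (apply RInt_ge_0; [easy | now apply ex_RInt_continuous_all | auto]).
  assert (0 < RInt f a' b').
  { apply RInt_gt_0; [lra | | auto].
    intros x Hx'; apply Hd; unfold ball; simpl; unfold AbsRing_ball, abs, minus, plus, opp; simpl.
    apply Rabs_def1; lra. }
  lra.
Qed.

Lemma IR_pos_of_point (f : R -> R) (M x0 : R) :
  dominated f M -> (forall x, 0 <= f x) -> 0 < f x0 -> 0 < IR f.
Proof.
  intros H Hp H0.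
  destruct (INR_unbounded (Rabs x0)) as [N HN].
  assert (Hx : - INR N <= x0 < INR N) by (apply Rabs_def2 in HN; lra).
  apply Rlt_le_trans with (RInt f (- INR N) (INR N)).
  { apply RInt_pos_of_point with x0; auto; apply H. }
  refine (is_lim_seq_le_loc _ _ (Finite _) (Finite _) _ (is_lim_seq_const _) (dominated_IR_lim f M H)).
  exists N; intros n Hn; apply le_INR in Hn.
  rewrite (RInt_split f (- INR n) (- INR N) (INR n)), (RInt_split f (- INR N) (INR N) (INR n)) by apply H.
  assert (0 <= RInt f (- INR n) (- INR N)) by (apply RInt_ge_0; [lra | apply ex_RInt_continuous_all, H | auto]).
  assert (0 <= RInt f (INR N) (INR n)) by (apply RInt_ge_0; [lra | apply ex_RInt_continuous_all, H | auto]).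
  lra.
Qed.

(** The boundary terms [F n] and [F (- n)] are [O(1 / n)] because [x F x] is bounded. *)
Lemma IR_derive (F f : R -> R) (M N : R) :
  dominated f M -> (forall x, Rabs (x * F x) <= N) -> (forall x, is_derive F x (f x)) -> IR f = 0.
Proof.
  intros Hf HF HD; apply IR_of_lim with M; [easy |].
  apply is_lim_seq_ext with (fun n => F (INR n) - F (- INR n)).
  { intros n; symmetry; apply RInt_FTC; [easy | apply Hf]. }
  apply is_lim_seq_abs_0.
  apply is_lim_seq_le_le_loc with (u := fun _ => 0) (w := fun n => 2 * N * / INR n).
  - exists 1%nat; intros n Hn; split; [apply Rabs_pos |].
    assert (H1 : 1 <= INR n) by (apply (le_INR 1); easy).
    assert (Hb : forall x, Rabs x = INR n -> Rabs (F x) <= N * / INR n).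
    { intros x Hx; apply (Rle_div_r _ N); [lra |].
      rewrite Rmult_comm, <- Hx, <- Rabs_mult; apply HF. }
    eapply Rle_trans; [apply Rabs_triang |]. rewrite Rabs_Ropp.
    assert (Rabs (F (INR n)) <= N * / INR n) by (apply Hb, Rabs_pos_eq; lra).
    assert (Rabs (F (- INR n)) <= N * / INR n) by (apply Hb; rewrite Rabs_Ropp; apply Rabs_pos_eq; lra).
    lra.
  - apply is_lim_seq_const.
  - replace (Finite 0) with (Rbar_mult (2 * N) (Rbar_inv p_infty)) by (simpl; f_equal; ring).
    apply is_lim_seq_scal_l, is_lim_seq_inv; [apply is_lim_seq_INR | easy].
Qed.

(** * Complex-valued integrals over the line *)

Definition CI (f : R -> C) : C := (IR (fun x => Re (f x)), IR (fun x => Im (f x))).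

Definition Ccontinuous (f : R -> C) : Prop :=
  forall x, continuous (fun y => Re (f y)) x /\ continuous (fun y => Im (f y)) x.

Definition Cdominated (f : R -> C) (M : R) : Prop :=
  Ccontinuous f /\ (forall x, Cmod (f x) <= M / (1 + x ^ 2)).

Lemma Cdominated_Re (f : R -> C) (M : R) : Cdominated f M -> dominated (fun x => Re (f x)) M.
Proof.
  intros [H1 H2]; split; [exact (fun x => proj1 (H1 x)) |].
  intros; eapply Rle_trans; [apply re_le_Cmod | apply H2].
Qed.

Lemma Cdominated_Im (f : R -> C) (M : R) : Cdominated f M -> dominated (fun x => Im (f x)) M.
Proof.
  intros [H1 H2]; split; [exact (fun x => proj2 (H1 x)) |].
  intros; eapply Rle_trans; [apply im_le_Cmod | apply H2].
Qed.

Lemma isD_Ccontinuous (f df : R -> C) : (forall x, isD f x (df x)) -> Ccontinuous f.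
Proof. intros H x; split; [exact (is_derive_continuous _ _ _ (proj1 (H x))) | exact (is_derive_continuous _ _ _ (proj2 (H x)))]. Qed.

Lemma Ccontinuous_plus (f g : R -> C) :
  Ccontinuous f -> Ccontinuous g -> Ccontinuous (fun x => f x + g x)%C.
Proof.
  intros Hf Hg x; destruct (Hf x), (Hg x); split; simpl.
  - now apply (continuous_plus (fun y => fst (f y)) (fun y => fst (g y))).
  - now apply (continuous_plus (fun y => snd (f y)) (fun y => snd (g y))).
Qed.

Lemma Ccontinuous_mult (f g : R -> C) :
  Ccontinuous f -> Ccontinuous g -> Ccontinuous (fun x => f x * g x)%C.
Proof.
  intros Hf Hg x; destruct (Hf x), (Hg x); split; simpl.
  - apply (continuous_minus (fun y => fst (f y) * fst (g y)) (fun y => snd (f y) * snd (g y)));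
      [apply (continuous_mult (fun y => fst (f y)) (fun y => fst (g y))) | apply (continuous_mult (fun y => snd (f y)) (fun y => snd (g y)))]; easy.
  - apply (continuous_plus (fun y => fst (f y) * snd (g y)) (fun y => snd (f y) * fst (g y)));
      [apply (continuous_mult (fun y => fst (f y)) (fun y => snd (g y))) | apply (continuous_mult (fun y => snd (f y)) (fun y => fst (g y)))]; easy.
Qed.

Lemma Ccontinuous_const (z : C) : Ccontinuous (fun _ => z).
Proof. intros x; split; apply continuous_const. Qed.

Lemma Cdominated_le (f : R -> C) (M N : R) : M <= N -> Cdominated f M -> Cdominated f N.
Proof.
  intros HMN [H1 H2]; split; [easy |]; intros x; eapply Rle_trans; [apply H2 |].
  apply Rmult_le_compat_r; [left; apply Rinv_0_lt_compat, one_plus_sq_pos | easy].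
Qed.

Lemma Cdominated_plus (f g : R -> C) (M N : R) :
  Cdominated f M -> Cdominated g N -> Cdominated (fun x => f x + g x)%C (M + N).
Proof.
  intros [Hf1 Hf2] [Hg1 Hg2]; split; [now apply Ccontinuous_plus |].
  intros x; eapply Rle_trans; [apply Cmod_triangle |].
  rewrite Rdiv_plus_distr; now apply Rplus_le_compat.
Qed.

Lemma Cdominated_scal (f : R -> C) (M : R) (z : C) :
  Cdominated f M -> Cdominated (fun x => z * f x)%C (Cmod z * M).
Proof.
  intros [Hf1 Hf2]; split.
  - apply Ccontinuous_mult; [apply Ccontinuous_const | easy].
  - intros x; rewrite Cmod_mult; unfold Rdiv; rewrite Rmult_assoc.
    apply Rmult_le_compat_l; [apply Cmod_ge_0 | apply Hf2].
Qed.

Lemma CI_plus (f g : R -> C) (M N : R) :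
  Cdominated f M -> Cdominated g N -> CI (fun x => f x + g x)%C = (CI f + CI g)%C.
Proof.
  intros Hf Hg; apply C_ext; unfold CI; simpl.
  - exact (IR_plus _ _ _ _ (Cdominated_Re f M Hf) (Cdominated_Re g N Hg)).
  - exact (IR_plus _ _ _ _ (Cdominated_Im f M Hf) (Cdominated_Im g N Hg)).
Qed.

Lemma CI_scal (f : R -> C) (M : R) (z : C) :
  Cdominated f M -> CI (fun x => z * f x)%C = (z * CI f)%C.
Proof.
  intros Hf; generalize (Cdominated_Re f M Hf) (Cdominated_Im f M Hf); intros H1 H2.
  apply C_ext; unfold CI; simpl.
  - rewrite <- (IR_scal _ _ (fst z) H1).
    replace (snd z * _) with (- (- snd z * IR (fun x => Im (f x)))) by ring.
    rewrite <- (IR_scal _ _ (- snd z) H2); unfold Rminus; rewrite Ropp_involutive.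
    rewrite <- (IR_plus _ _ _ _ (dominated_scal _ _ (fst z) H1) (dominated_scal _ _ (- snd z) H2)).
    f_equal; apply functional_extensionality; intros x; unfold Re, Im; ring.
  - rewrite <- (IR_scal _ _ (snd z) H1), <- (IR_scal _ _ (fst z) H2).
    rewrite <- (IR_plus _ _ _ _ (dominated_scal _ _ (fst z) H2) (dominated_scal _ _ (snd z) H1)).
    f_equal; apply functional_extensionality; intros x; unfold Re, Im; ring.
Qed.

Lemma minus_scal (f g : R -> C) : (fun x => f x - g x)%C = (fun x => f x + (- (1)) * g x)%C.
Proof. apply functional_extensionality; intros; ring. Qed.

Lemma Cdominated_minus (f g : R -> C) (M N : R) :
  Cdominated f M -> Cdominated g N -> Cdominated (fun x => f x - g x)%C (M + Cmod (- (1)) * N).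
Proof. intros Hf Hg; rewrite minus_scal; apply Cdominated_plus; [easy | now apply Cdominated_scal]. Qed.

Lemma CI_minus (f g : R -> C) (M N : R) :
  Cdominated f M -> Cdominated g N -> CI (fun x => f x - g x)%C = (CI f - CI g)%C.
Proof.
  intros Hf Hg; rewrite minus_scal, (CI_plus _ _ _ _ Hf (Cdominated_scal _ _ _ Hg)), (CI_scal _ _ _ Hg); ring.
Qed.

Lemma CI_bound (f : R -> C) (M : R) : Cdominated f M -> Cmod (CI f) <= 2 * PI * M.
Proof.
  intros H; eapply Rle_trans; [apply Cmod_le_Re_Im |].
  generalize (IR_bound _ _ (Cdominated_Re f M H)) (IR_bound _ _ (Cdominated_Im f M H)).
  unfold CI; simpl; lra.
Qed.

Lemma CI_derive (F f : R -> C) (M N : R) :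
  Cdominated f M -> (forall x : R, Cmod (x * F x) <= N) -> (forall x, isD F x (f x)) -> CI f = 0.
Proof.
  intros Hf HF HD; apply C_ext; unfold CI; simpl.
  - refine (IR_derive _ _ _ N (Cdominated_Re f M Hf) _ (fun x => proj1 (HD x))).
    intros x; eapply Rle_trans; [| apply (HF x)]. eapply Rle_trans; [| apply re_le_Cmod].
    right; f_equal; unfold Re, Im; simpl; ring.
  - refine (IR_derive _ _ _ N (Cdominated_Im f M Hf) _ (fun x => proj2 (HD x))).
    intros x; eapply Rle_trans; [| apply (HF x)]. eapply Rle_trans; [| apply im_le_Cmod].
    right; f_equal; unfold Re, Im; simpl; ring.
Qed.

Lemma Cdominated_x (f : R -> C) (M : R) : Cdominated f M -> forall x : R, Cmod (x * f x) <= M.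
Proof.
  intros [_ H] x; rewrite Cmod_mult, Cmod_R.
  specialize (H x); apply Rle_div_r in H; [| apply one_plus_sq_pos].
  eapply Rle_trans; [| exact H]; rewrite Rmult_comm.
  apply Rmult_le_compat_l; [apply Cmod_ge_0 |].
  rewrite <- pow2_abs; generalize (pow2_ge_0 (Rabs x - 1 / 2)); nra.
Qed.

Lemma Cdominated_of_bounds (f : R -> C) (A B : R) :
  Ccontinuous f -> (forall x, Cmod (f x) <= A) -> (forall x : R, Cmod (x * (x * f x)) <= B) ->
  Cdominated f (A + B).
Proof.
  intros Hc HA HB; split; [easy |]; intros x; apply Rle_div_r; [apply one_plus_sq_pos |].
  specialize (HA x); specialize (HB x); rewrite !Cmod_mult, !Cmod_R in HB.
  rewrite <- (pow2_abs x); nra.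
Qed.

Lemma CI_shift (f : R -> C) (M N c : R) :
  Cdominated f M -> Cdominated (fun x => f (x + c)) N -> CI (fun x => f (x + c)) = CI f.
Proof.
  intros Hf Hc; apply C_ext; unfold CI; simpl.
  - exact (IR_shift _ _ _ c (Cdominated_Re f M Hf) (Cdominated_Re _ N Hc)).
  - exact (IR_shift _ _ _ c (Cdominated_Im f M Hf) (Cdominated_Im _ N Hc)).
Qed.

(** The Taylor remainder in the parameter is, at each [x], at most [2 M / (1 + x^2)] times
    [(s - p)^2]. This weight is integrable, so the integral differs from its linearisation by
    [O((s - p)^2)]. *)
Lemma isD_CI (f f' : R -> R -> C) (M K : R) :
  (forall p, Cdominated (f p) K) -> (forall p, Cdominated (f' p) K) ->
  (forall p x, isD (fun s => f s x) p (f' p x)) ->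
  (forall p p' x, Cmod (f' p' x - f' p x) <= M / (1 + x ^ 2) * Rabs (p' - p)) ->
  forall p, isD (fun s => CI (f s)) p (CI (f' p)).
Proof.
  intros Hf Hf' HD HL p.
  apply isD_of_quad with (2 * PI * (2 * M)); intros s _.
  rewrite <- (CI_scal _ _ (s - p)%R (Hf' p)), <- (CI_minus _ _ _ _ (Hf s) (Hf p)).
  assert (HL1 := Cdominated_minus _ _ _ _ (Hf s) (Hf p)).
  generalize (Cdominated_scal _ _ (s - p)%R (Hf' p)); intros HL2.
  rewrite <- (CI_minus _ _ _ _ HL1 HL2).
  eapply Rle_trans; [apply (CI_bound _ (2 * M * (s - p) ^ 2)) |]; [split | lra].
  - apply (Cdominated_minus _ _ _ _ HL1 HL2).
  - intros x; eapply Rle_trans; [apply (isD_Taylor (fun u => f u x) (fun u => f' u x) p (M / (1 + x ^ 2))) |].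
    + intros u; apply HD.
    + intros u; apply HL.
    + right; field; generalize (one_plus_sq_pos x); simpl; lra.
Qed.

(** * Schwartz functions *)

(** A relation, because [cdt] and [cdx] rest on the total function [Derive] and have a value even
    where nothing is differentiable. *)
Definition is_dt (g g1 : R -> R -> C) : Prop := forall t x, isD (fun s => g s x) t (g1 t x).
Definition is_dx (g g1 : R -> R -> C) : Prop := forall t x, isD (fun y => g t y) x (g1 t x).

Lemma funext2 (f g : R -> R -> C) : (forall t x, f t x = g t x) -> f = g.
Proof. intros H; apply functional_extensionality; intros t; apply functional_extensionality, H. Qed.

Lemma is_dt_cdt (g g1 : R -> R -> C) : is_dt g g1 -> cdt g = g1.
Proof.
  intros H; apply funext2; intros t x; apply C_ext;
    unfold cdt, pdt, cre, cim, Re at 1, Im at 1; simpl; apply is_derive_unique, H.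
Qed.

Lemma is_dx_cdx (g g1 : R -> R -> C) : is_dx g g1 -> cdx g = g1.
Proof.
  intros H; apply funext2; intros t x; apply C_ext;
    unfold cdx, pdx, cre, cim, Re at 1, Im at 1; simpl; apply is_derive_unique, H.
Qed.

(* Indexing by the number of derivatives turns closure under products, multiplication by [x] and solution
   operators into inductions on [n], with no commutation of derivatives and no Leibniz formula. *)
Fixpoint Reg (B : (R -> R -> C) -> Prop) (n : nat) (g : R -> R -> C) : Prop :=
  match n with
  | O => B g
  | S m => B g /\ (exists g1, is_dt g g1 /\ Reg B m g1) /\ (exists g1, is_dx g g1 /\ Reg B m g1)
  end.

Definition bounded2 (g : R -> R -> C) : Prop :=
  periodic2 g /\ exists M, forall t x, Cmod (g t x) <= M.

Definition decaying2 (g : R -> R -> C) : Prop :=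
  periodic2 g /\ forall k : nat, exists M, forall t x, Cmod (RtoC (x ^ k) * g t x) <= M.

(** [Sch] is the space [Schwartz] in another form; [Mul] consists of the smooth functions with all
    derivatives bounded, which multiply [Sch] into itself. *)
Definition Sch (g : R -> R -> C) : Prop := forall n, Reg decaying2 n g.
Definition Mul (g : R -> R -> C) : Prop := forall n, Reg bounded2 n g.

Lemma Reg_base B n g : Reg B n g -> B g.
Proof. destruct n; [easy | now intros [H _]]. Qed.

Lemma Reg_S B n g : Reg B (S n) g -> Reg B n g.
Proof.
  revert g; induction n; intros g H; [exact (proj1 H) |].
  destruct H as [H0 [[g1 [H1 H2]] [g2 [H3 H4]]]].
  split; [easy |]; split; [exists g1 | exists g2]; auto.
Qed.

Lemma Reg_dt B n g g1 : Reg B (S n) g -> is_dt g g1 -> Reg B n g1.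
Proof.
  intros [_ [[h [H1 H2]] _]] H; now rewrite <- (is_dt_cdt _ _ H), (is_dt_cdt _ _ H1).
Qed.

Lemma Reg_dx B n g g1 : Reg B (S n) g -> is_dx g g1 -> Reg B n g1.
Proof.
  intros [_ [_ [h [H1 H2]]]] H; now rewrite <- (is_dx_cdx _ _ H), (is_dx_cdx _ _ H1).
Qed.

Lemma Reg_is_dt B n g : Reg B (S n) g -> is_dt g (cdt g).
Proof. intros [_ [[h [H1 H2]] _]]; now rewrite (is_dt_cdt _ _ H1). Qed.

Lemma Reg_is_dx B n g : Reg B (S n) g -> is_dx g (cdx g).
Proof. intros [_ [_ [h [H1 H2]]]]; now rewrite (is_dx_cdx _ _ H1). Qed.

Lemma Reg_cdt B n g : Reg B (S n) g -> Reg B n (cdt g).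
Proof. intros H; eapply Reg_dt; [exact H | eapply Reg_is_dt, H]. Qed.

Lemma Reg_cdx B n g : Reg B (S n) g -> Reg B n (cdx g).
Proof. intros H; eapply Reg_dx; [exact H | eapply Reg_is_dx, H]. Qed.

Lemma Reg_intro B n g g1 g2 :
  B g -> is_dt g g1 -> is_dx g g2 -> Reg B n g1 -> Reg B n g2 -> Reg B (S n) g.
Proof. intros; split; [easy |]; split; [exists g1 | exists g2]; auto. Qed.

Lemma Reg_impl (B B' : (R -> R -> C) -> Prop) n g : (forall h, B h -> B' h) -> Reg B n g -> Reg B' n g.
Proof.
  intros HB; revert g; induction n; intros g H; [now apply HB |].
  destruct H as [H0 [[g1 [H1 H2]] [g2 [H3 H4]]]].
  apply Reg_intro with g1 g2; auto.
Qed.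

Lemma is_dt_plus f g f1 g1 :
  is_dt f f1 -> is_dt g g1 -> is_dt (fun t x => f t x + g t x)%C (fun t x => f1 t x + g1 t x)%C.
Proof. intros Hf Hg t x; exact (isD_plus _ _ _ _ _ (Hf t x) (Hg t x)). Qed.

Lemma is_dx_plus f g f1 g1 :
  is_dx f f1 -> is_dx g g1 -> is_dx (fun t x => f t x + g t x)%C (fun t x => f1 t x + g1 t x)%C.
Proof. intros Hf Hg t x; exact (isD_plus _ _ _ _ _ (Hf t x) (Hg t x)). Qed.

Lemma is_dt_mult f g f1 g1 :
  is_dt f f1 -> is_dt g g1 ->
  is_dt (fun t x => f t x * g t x)%C (fun t x => f1 t x * g t x + f t x * g1 t x)%C.
Proof. intros Hf Hg t x; exact (isD_mult _ _ _ _ _ (Hf t x) (Hg t x)). Qed.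

Lemma is_dx_mult f g f1 g1 :
  is_dx f f1 -> is_dx g g1 ->
  is_dx (fun t x => f t x * g t x)%C (fun t x => f1 t x * g t x + f t x * g1 t x)%C.
Proof. intros Hf Hg t x; exact (isD_mult _ _ _ _ _ (Hf t x) (Hg t x)). Qed.

Lemma Reg_plus (B : (R -> R -> C) -> Prop) :
  (forall f g, B f -> B g -> B (fun t x => f t x + g t x)%C) ->
  forall n f g, Reg B n f -> Reg B n g -> Reg B n (fun t x => f t x + g t x)%C.
Proof.
  intros HB n; induction n; intros f g Hf Hg; [now apply HB |].
  eapply Reg_intro; [apply HB; eapply Reg_base; eassumption | | | |].
  - apply is_dt_plus; eapply Reg_is_dt; eassumption.
  - apply is_dx_plus; eapply Reg_is_dx; eassumption.
  - apply IHn; now apply Reg_cdt.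
  - apply IHn; now apply Reg_cdx.
Qed.

Lemma Reg_mult (B B' : (R -> R -> C) -> Prop) :
  (forall f g, B' f -> B' g -> B' (fun t x => f t x + g t x)%C) ->
  (forall f g, B f -> B' g -> B' (fun t x => f t x * g t x)%C) ->
  forall n f g, Reg B n f -> Reg B' n g -> Reg B' n (fun t x => f t x * g t x)%C.
Proof.
  intros HP HB n; induction n; intros f g Hf Hg; [now apply HB |].
  eapply Reg_intro; [apply HB; eapply Reg_base; eassumption | | | |].
  - apply is_dt_mult; eapply Reg_is_dt; eassumption.
  - apply is_dx_mult; eapply Reg_is_dx; eassumption.
  - apply Reg_plus; [easy | apply IHn | apply IHn]; try apply Reg_cdt; auto using Reg_S.
  - apply Reg_plus; [easy | apply IHn | apply IHn]; try apply Reg_cdx; auto using Reg_S.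
Qed.

Lemma periodic2_plus f g : periodic2 f -> periodic2 g -> periodic2 (fun t x => f t x + g t x)%C.
Proof. intros Hf Hg t x; now rewrite Hf, Hg. Qed.

Lemma periodic2_mult f g : periodic2 f -> periodic2 g -> periodic2 (fun t x => f t x * g t x)%C.
Proof. intros Hf Hg t x; now rewrite Hf, Hg. Qed.

Lemma bounded2_plus f g : bounded2 f -> bounded2 g -> bounded2 (fun t x => f t x + g t x)%C.
Proof.
  intros [Hf [M HM]] [Hg [N HN]]; split; [now apply periodic2_plus | exists (M + N); intros t x].
  eapply Rle_trans; [apply Cmod_triangle | now apply Rplus_le_compat].
Qed.

Lemma bounded2_mult f g : bounded2 f -> bounded2 g -> bounded2 (fun t x => f t x * g t x)%C.
Proof.
  intros [Hf [M HM]] [Hg [N HN]]; split; [now apply periodic2_mult | exists (M * N); intros t x].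
  rewrite Cmod_mult; apply Rmult_le_compat; auto using Cmod_ge_0.
Qed.

Lemma decaying2_plus f g : decaying2 f -> decaying2 g -> decaying2 (fun t x => f t x + g t x)%C.
Proof.
  intros [Hf HM] [Hg HN]; split; [now apply periodic2_plus | intros k].
  destruct (HM k) as [M HM'], (HN k) as [N HN']; exists (M + N); intros t x.
  rewrite Cmult_plus_distr_l.
  eapply Rle_trans; [apply Cmod_triangle | now apply Rplus_le_compat].
Qed.

Lemma bounded2_decaying2_mult f g :
  bounded2 f -> decaying2 g -> decaying2 (fun t x => f t x * g t x)%C.
Proof.
  intros [Hf [M HM]] [Hg HN]; split; [now apply periodic2_mult | intros k].
  destruct (HN k) as [N HN']; exists (M * N); intros t x.
  replace (RtoC (x ^ k) * (f t x * g t x))%C with (f t x * (RtoC (x ^ k) * g t x))%C by ring.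
  rewrite Cmod_mult; apply Rmult_le_compat; auto using Cmod_ge_0.
Qed.

Lemma decaying2_bounded2 f : decaying2 f -> bounded2 f.
Proof.
  intros [Hp H]; split; [easy |]; destruct (H O) as [M HM]; exists M; intros t x.
  rewrite <- (Cmult_1_l (f t x)); exact (HM t x).
Qed.

Lemma decaying2_x f : decaying2 f -> decaying2 (fun t x => x * f t x)%C.
Proof.
  intros [Hp H]; split; [intros t x; now rewrite Hp | intros k].
  destruct (H (S k)) as [M HM]; exists M; intros t x.
  replace (RtoC (x ^ k) * (x * f t x))%C with (RtoC (x ^ S k) * f t x)%C; [apply HM |].
  simpl; rewrite RtoC_mult; ring.
Qed.

Lemma Sch_plus f g : Sch f -> Sch g -> Sch (fun t x => f t x + g t x)%C.
Proof. intros Hf Hg n; apply Reg_plus; [apply decaying2_plus | apply Hf | apply Hg]. Qed.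

Lemma Mul_plus f g : Mul f -> Mul g -> Mul (fun t x => f t x + g t x)%C.
Proof. intros Hf Hg n; apply Reg_plus; [apply bounded2_plus | apply Hf | apply Hg]. Qed.

Lemma Mul_mult f g : Mul f -> Mul g -> Mul (fun t x => f t x * g t x)%C.
Proof.
  intros Hf Hg n; apply (Reg_mult bounded2 bounded2);
    auto using bounded2_plus, bounded2_mult.
Qed.

Lemma Reg_bounded_decaying n f g :
  Reg bounded2 n f -> Reg decaying2 n g -> Reg decaying2 n (fun t x => f t x * g t x)%C.
Proof. apply Reg_mult; auto using decaying2_plus, bounded2_decaying2_mult. Qed.

Lemma Mul_Sch f g : Mul f -> Sch g -> Sch (fun t x => f t x * g t x)%C.
Proof. intros Hf Hg n; apply Reg_bounded_decaying; [apply Hf | apply Hg]. Qed.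

Lemma Reg_decaying_bounded n f : Reg decaying2 n f -> Reg bounded2 n f.
Proof. apply Reg_impl, decaying2_bounded2. Qed.

Lemma Sch_Mul f : Sch f -> Mul f.
Proof. intros H n; apply Reg_decaying_bounded, H. Qed.

Lemma Mul_const (z : C) : Mul (fun _ _ => z).
Proof.
  intros n; revert z; induction n; intros z.
  - split; [easy | exists (Cmod z); intros; lra].
  - apply Reg_intro with (fun _ _ => 0) (fun _ _ => 0); try apply IHn.
    + split; [easy | exists (Cmod z); intros; lra].
    + intros t x; apply isD_const.
    + intros t x; apply isD_const.
Qed.

Lemma Sch_scal (z : C) f : Sch f -> Sch (fun t x => z * f t x)%C.
Proof. intros H; apply (Mul_Sch (fun _ _ => z)); [apply Mul_const | easy]. Qed.

Lemma Mul_scal (z : C) f : Mul f -> Mul (fun t x => z * f t x)%C.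
Proof. intros H; apply (Mul_mult (fun _ _ => z)); [apply Mul_const | easy]. Qed.

Lemma Reg_x (B : (R -> R -> C) -> Prop) :
  (forall f g, B f -> B g -> B (fun t x => f t x + g t x)%C) ->
  (forall f, B f -> B (fun t x => x * f t x)%C) ->
  forall n f, Reg B n f -> Reg B n (fun t x => x * f t x)%C.
Proof.
  intros HP HX n; induction n; intros f H; [now apply HX |].
  apply Reg_intro with (fun t x : R => x * cdt f t x)%C (fun t x : R => f t x + x * cdx f t x)%C.
  - eapply HX, Reg_base, H.
  - intros t x; apply isD_scal; eapply Reg_is_dt, H.
  - intros t x; eapply isD_val; [apply isD_mult; [apply isD_id | eapply Reg_is_dx, H] | simpl; ring].
  - apply IHn; now apply Reg_cdt.
  - apply Reg_plus; [apply HP | now apply Reg_S | apply IHn; now apply Reg_cdx].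
Qed.

Lemma Reg_decaying_x n f : Reg decaying2 n f -> Reg decaying2 n (fun t x => x * f t x)%C.
Proof. apply Reg_x; auto using decaying2_plus, decaying2_x. Qed.

Lemma Sch_x f : Sch f -> Sch (fun t x => x * f t x)%C.
Proof. intros H n; apply Reg_decaying_x, H. Qed.

Lemma Sch_is_dt f : Sch f -> is_dt f (cdt f).
Proof. intros H; exact (Reg_is_dt _ O _ (H 1%nat)). Qed.

Lemma Sch_is_dx f : Sch f -> is_dx f (cdx f).
Proof. intros H; exact (Reg_is_dx _ O _ (H 1%nat)). Qed.

Lemma Sch_cdt f : Sch f -> Sch (cdt f).
Proof. intros H n; apply Reg_cdt, H. Qed.

Lemma Sch_cdx f : Sch f -> Sch (cdx f).
Proof. intros H n; apply Reg_cdx, H. Qed.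

Lemma Mul_is_dt f : Mul f -> is_dt f (cdt f).
Proof. intros H; exact (Reg_is_dt _ O _ (H 1%nat)). Qed.

Lemma Mul_cdt f : Mul f -> Mul (cdt f).
Proof. intros H n; apply Reg_cdt, H. Qed.

(** Moving in [t] and then in [x] with bounded partial derivatives gives a joint estimate, the
    source of the joint continuity that [smooth2] demands. *)
Lemma Reg_bounded_Lipschitz f :
  Reg bounded2 1 f -> exists M, 0 <= M /\ forall t x t' x', Cmod (f t' x' - f t x) <= M * (Rabs (t' - t) + Rabs (x' - x)).
Proof.
  intros H; destruct (Reg_base _ _ _ (Reg_cdt _ _ _ H)) as [_ [M HM]].
  destruct (Reg_base _ _ _ (Reg_cdx _ _ _ H)) as [_ [N HN]].
  assert (0 <= M) by (eapply Rle_trans; [apply Cmod_ge_0 | apply (HM 0 0)]).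
  assert (0 <= N) by (eapply Rle_trans; [apply Cmod_ge_0 | apply (HN 0 0)]).
  exists (2 * M + 2 * N); split; [lra |]; intros t x t' x'.
  replace (f t' x' - f t x)%C with ((f t' x' - f t x') + (f t x' - f t x))%C by ring.
  eapply Rle_trans; [apply Cmod_triangle |].
  assert (Cmod (f t' x' - f t x') <= 2 * M * Rabs (t' - t)).
  { apply (isD_Lipschitz (fun s => f s x') (fun s => cdt f s x')); intros; [eapply Reg_is_dt, H | apply HM]. }
  assert (Cmod (f t x' - f t x) <= 2 * N * Rabs (x' - x)).
  { apply (isD_Lipschitz (fun y => f t y) (fun y => cdx f t y)); intros; [eapply Reg_is_dx, H | apply HN]. }
  generalize (Rabs_pos (t' - t)) (Rabs_pos (x' - x)); intros; nra.
Qed.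

Lemma continuous_of_Lipschitz2 (h : R * R -> R) (M : R) :
  0 <= M -> (forall p q, Rabs (h q - h p) <= M * (Rabs (fst q - fst p) + Rabs (snd q - snd p))) ->
  forall p, continuous h p.
Proof.
  intros HM H p; apply filterlim_locally; intros eps.
  assert (Hd : 0 < eps / (2 * M + 1)) by (apply Rdiv_lt_0_compat; [apply cond_pos | lra]).
  exists (mkposreal _ Hd); intros q [H1 H2].
  change (Rabs (fst q - fst p) < eps / (2 * M + 1)) in H1.
  change (Rabs (snd q - snd p) < eps / (2 * M + 1)) in H2.
  change (Rabs (h q - h p) < eps); eapply Rle_lt_trans; [apply H |].
  set (e := eps / (2 * M + 1)) in *.
  assert (E : e * (2 * M + 1) = eps) by (unfold e; field; lra).
  apply Rle_lt_trans with (M * (2 * e)); [apply Rmult_le_compat_l; [easy |] | lra].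
  replace (2 * e) with (e + e) by ring.
  apply Rplus_le_compat; apply Rlt_le; [exact H1 | exact H2].
Qed.

(** * Agreement of [Sch] with the Schwartz space of the statement *)

Lemma Sch_word f (w : list bool) :
  Sch f -> exists g, Sch g /\ pdw w (cre f) = cre g /\ pdw w (cim f) = cim g.
Proof.
  revert f; induction w as [| b w IH]; intros f H; [now exists f |].
  destruct b.
  - destruct (IH (cdt f) (Sch_cdt f H)) as [g [Hg [H1 H2]]]; exists g; auto.
  - destruct (IH (cdx f) (Sch_cdx f H)) as [g [Hg [H1 H2]]]; exists g; auto.
Qed.

Lemma Sch_smooth f : Sch f -> csmooth2 f.
Proof.
  intros H; split; intros w t x;
    destruct (Sch_word f w H) as [g [Hg [H1 H2]]]; rewrite ?H1, ?H2;
    destruct (Reg_bounded_Lipschitz g (Sch_Mul g Hg 1%nat)) as [M [HM HL]].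
  - split; [| split].
    + apply continuous_of_Lipschitz2 with M; [easy |]; intros p q.
      eapply Rle_trans; [| apply HL]; eapply Rle_trans; [| apply re_le_Cmod].
      right; f_equal; unfold cre, Re; simpl; ring.
    + exists (Re (cdt g t x)); exact (proj1 (Sch_is_dt g Hg t x)).
    + exists (Re (cdx g t x)); exact (proj1 (Sch_is_dx g Hg t x)).
  - split; [| split].
    + apply continuous_of_Lipschitz2 with M; [easy |]; intros p q.
      eapply Rle_trans; [| apply HL]; eapply Rle_trans; [| apply im_le_Cmod].
      right; f_equal; unfold cim, Im; simpl; ring.
    + exists (Im (cdt g t x)); exact (proj2 (Sch_is_dt g Hg t x)).
    + exists (Im (cdx g t x)); exact (proj2 (Sch_is_dx g Hg t x)).
Qed.

Lemma Sch_cdtn n f : Sch f -> Sch (cdtn n f).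
Proof. intros H; induction n; [easy | now apply Sch_cdt]. Qed.

Lemma Sch_cdxn n f : Sch f -> Sch (cdxn n f).
Proof. intros H; induction n; [easy | now apply Sch_cdx]. Qed.

Lemma Sch_Schwartz f : Sch f -> Schwartz f.
Proof.
  intros H; split; [apply (H O) | split; [now apply Sch_smooth |]].
  intros a b k; apply (Sch_cdtn a _ (Sch_cdxn b f H) O).
Qed.

(** The seminorms apply the [x]-derivatives before the [t]-derivatives, so closure of [Schwartz]
    under [cdt] requires exchanging the two; the continuity of mixed derivatives contained in
    [smooth2] permits it. *)
Lemma pdx_pdt g : smooth2 g -> pdx (pdt g) = pdt (pdx g).
Proof.
  intros H; apply functional_extensionality; intros t; apply functional_extensionality; intros x.
  unfold pdx, pdt; symmetry; apply Schwarz.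
  - exists (mkposreal 1 Rlt_0_1); intros u v _ _; split; [| split; [| split]].
    + exact (proj1 (proj2 (H nil u v))).
    + exact (proj2 (proj2 (H nil u v))).
    + exact (proj1 (proj2 (H (cons false nil) u v))).
    + exact (proj2 (proj2 (H (cons true nil) u v))).
  - apply continuity_2d_pt_filterlim; exact (proj1 (H (cons false (cons true nil)) t x)).
  - apply continuity_2d_pt_filterlim; exact (proj1 (H (cons true (cons false nil)) t x)).
Qed.

Lemma cdx_cdt f : csmooth2 f -> cdx (cdt f) = cdt (cdx f).
Proof.
  intros [H1 H2]; apply funext2; intros t x.
  change ((pdx (pdt (cre f)) t x, pdx (pdt (cim f)) t x) = (pdt (pdx (cre f)) t x, pdt (pdx (cim f)) t x)).
  now rewrite (pdx_pdt _ H1), (pdx_pdt _ H2).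
Qed.

Lemma csmooth2_cdt f : csmooth2 f -> csmooth2 (cdt f).
Proof. intros [H1 H2]; split; intros w; [apply (H1 (cons true w)) | apply (H2 (cons true w))]. Qed.

Lemma csmooth2_cdx f : csmooth2 f -> csmooth2 (cdx f).
Proof. intros [H1 H2]; split; intros w; [apply (H1 (cons false w)) | apply (H2 (cons false w))]. Qed.

Lemma csmooth2_is_dt f : csmooth2 f -> is_dt f (cdt f).
Proof. intros [H1 H2] t x; split; apply Derive_correct; [exact (proj1 (proj2 (H1 nil t x))) | exact (proj1 (proj2 (H2 nil t x)))]. Qed.

Lemma csmooth2_is_dx f : csmooth2 f -> is_dx f (cdx f).
Proof. intros [H1 H2] t x; split; apply Derive_correct; [exact (proj2 (proj2 (H1 nil t x))) | exact (proj2 (proj2 (H2 nil t x)))]. Qed.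

Lemma csmooth2_cdxn n f : csmooth2 f -> csmooth2 (cdxn n f).
Proof. intros H; induction n; [easy | now apply csmooth2_cdx]. Qed.

Lemma cdxn_cdt n f : csmooth2 f -> cdxn n (cdt f) = cdt (cdxn n f).
Proof.
  intros H; induction n; [easy |].
  change (cdx (cdxn n (cdt f)) = cdt (cdx (cdxn n f))).
  rewrite IHn; now apply cdx_cdt, csmooth2_cdxn.
Qed.

Lemma isD_shift (f df : R -> C) (c : R) :
  (forall s, f (s + c) = f s) -> (forall s, isD f s (df s)) -> forall s, df (s + c) = df s.
Proof.
  intros Hp HD s; apply isD_unique with f s; [| apply HD].
  apply isD_ext with (fun u => f (u + c)); [easy | now apply isD_translate].
Qed.

Lemma Schwartz_cdt f : Schwartz f -> Schwartz (cdt f).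
Proof.
  intros [Hp [Hs Hb]]; split; [| split].
  - intros t x; apply (isD_shift (fun s => f s x) (fun s => cdt f s x)); [intros; apply Hp |].
    intros s; now apply csmooth2_is_dt.
  - now apply csmooth2_cdt.
  - intros a b k; destruct (Hb (S a) b k) as [M HM]; exists M.
    rewrite (cdxn_cdt b f Hs); unfold cdtn in *; now rewrite Nat.iter_succ_r in HM.
Qed.

Lemma Schwartz_cdx f : Schwartz f -> Schwartz (cdx f).
Proof.
  intros [Hp [Hs Hb]]; split; [| split].
  - intros t x; apply isD_unique with (fun y => f (t + 2 * PI) y) x; [now apply csmooth2_is_dx |].
    apply isD_ext with (fun y => f t y); [intros; symmetry; apply Hp | now apply csmooth2_is_dx].
  - now apply csmooth2_cdx.
  - intros a b k; destruct (Hb a (S b) k) as [M HM]; exists M.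
    unfold cdxn in *; now rewrite Nat.iter_succ_r in HM.
Qed.

Lemma Schwartz_Sch f : Schwartz f -> Sch f.
Proof.
  intros H n; revert f H; induction n; intros f H.
  - split; [apply H | intros k; apply (proj2 (proj2 H) O O k)].
  - apply Reg_intro with (cdt f) (cdx f).
    + split; [apply H | intros k; apply (proj2 (proj2 H) O O k)].
    + apply csmooth2_is_dt, H.
    + apply csmooth2_is_dx, H.
    + now apply IHn, Schwartz_cdt.
    + now apply IHn, Schwartz_cdx.
Qed.

Lemma decaying2_weight f :
  decaying2 f -> exists K, forall t x, Cmod (f t x) <= K / (1 + x ^ 2).
Proof.
  intros [_ H]; destruct (H O) as [M HM], (H 2%nat) as [N HN]; exists (M + N); intros t x.
  apply Rle_div_r; [apply one_plus_sq_pos |].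
  specialize (HM t x); specialize (HN t x); rewrite Cmod_mult, Cmod_R in HM, HN.
  rewrite (Rabs_pos_eq (x ^ 2)) in HN by apply pow2_ge_0.
  simpl in HM; rewrite Rabs_R1 in HM; nra.
Qed.

Lemma Reg_decaying_dominated f :
  Reg decaying2 1 f -> exists K, forall t, Cdominated (f t) K.
Proof.
  intros H; destruct (decaying2_weight f (Reg_base _ _ _ H)) as [K HK]; exists K; intros t; split; [| apply HK].
  apply isD_Ccontinuous with (cdx f t); intros x; eapply Reg_is_dx, H.
Qed.

Lemma Reg_decaying_isD_CI f :
  Reg decaying2 3 f -> forall t, isD (fun s => CI (f s)) t (CI (cdt f t)).
Proof.
  intros H.
  destruct (Reg_decaying_dominated f (Reg_S _ _ _ (Reg_S _ _ _ H))) as [K HK].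
  assert (H1 : Reg decaying2 2 (cdt f)) by now apply Reg_cdt.
  destruct (Reg_decaying_dominated _ (Reg_S _ _ _ H1)) as [K1 HK1].
  destruct (decaying2_weight _ (Reg_base _ _ _ (Reg_cdt _ _ _ H1))) as [N HN].
  apply (isD_CI f (cdt f) (2 * N) (Rmax K K1)).
  - intros p; apply (Cdominated_le _ K); [apply Rmax_l | apply HK].
  - intros p; apply (Cdominated_le _ K1); [apply Rmax_r | apply HK1].
  - intros p x; eapply Reg_is_dt, H.
  - intros p p' x; eapply Rle_trans.
    + apply (isD_Lipschitz (fun s => cdt f s x) (fun s => cdt (cdt f) s x) p p' (N / (1 + x ^ 2))).
      * intros; eapply Reg_is_dt, H1.
      * intros; apply HN.
    + right; unfold Rdiv; ring.
Qed.

(** * The bilinear pairing and duality *)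

Lemma periodic_IZR {A : Type} (f : R -> A) (T : R) :
  (forall t, f (t + T) = f t) -> forall (k : Z) t, f (t + IZR k * T) = f t.
Proof.
  intros H.
  assert (Hn : forall (n : nat) t, f (t + INR n * T) = f t).
  { induction n; intros t; [f_equal; simpl; ring |].
    rewrite S_INR; replace (t + (INR n + 1) * T) with ((t + INR n * T) + T) by ring.
    now rewrite H. }
  intros k t; destruct (Z_le_gt_dec 0 k) as [h | h].
  - rewrite <- (Z2Nat.id k h), <- INR_IZR_INZ; apply Hn.
  - rewrite <- (Hn (Z.to_nat (- k)) (t + IZR k * T)), INR_IZR_INZ, Z2Nat.id by lia.
    f_equal; rewrite opp_IZR; ring.
Qed.

Lemma period_representative (t a T : R) : 0 < T -> exists k : Z, a <= t + IZR k * T < a + T.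
Proof.
  (* [y < up y <= y + 1], so adding [1 - up y] brings [y] into [[0, 1)]. *)
  intros HT; exists (1 - up ((t - a) / T))%Z; rewrite minus_IZR.
  destruct (archimed ((t - a) / T)) as [H1 H2].
  assert (E : (t - a) / T * T = t - a) by (field; lra).
  split; nra.
Qed.

Lemma two_PI_pos : 0 < 2 * PI.
Proof. generalize PI_RGT_0; lra. Qed.

Lemma periodic_forall (P : R -> Prop) (a : R) (f : R -> R) :
  (forall t, f (t + 2 * PI) = f t) ->
  (forall t y, f t = y -> a <= t <= a + 2 * PI -> P y) -> forall t, P (f t).
Proof.
  intros Hp H t; destruct (period_representative t a _ two_PI_pos) as [k Hk].
  rewrite <- (periodic_IZR f (2 * PI) Hp k t); eapply H; [reflexivity | lra].
Qed.

Lemma periodic_continuous_bounded (f : R -> R) :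
  (forall t, f (t + 2 * PI) = f t) -> (forall t, continuous f t) -> exists M, forall t, Rabs (f t) <= M.
Proof.
  intros Hp Hc.
  assert (Hc' : forall c, 0 <= c <= 2 * PI -> continuity_pt (fun t => Rabs (f t)) c).
  { intros c _; apply continuity_pt_filterlim; apply (continuous_comp f Rabs); [apply Hc | apply continuous_Rabs]. }
  destruct (continuity_ab_maj (fun t => Rabs (f t)) 0 (2 * PI) (Rlt_le _ _ two_PI_pos) Hc') as [m [Hm _]].
  exists (Rabs (f m)); apply (periodic_forall (fun y => Rabs y <= Rabs (f m)) 0 f Hp).
  intros t y <- Ht; apply Hm; lra.
Qed.

Lemma Cperiodic_continuous_bounded (f : R -> C) :
  (forall t, f (t + 2 * PI) = f t) -> Ccontinuous f -> exists M, forall t, Cmod (f t) <= M.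
Proof.
  intros Hp Hc.
  destruct (periodic_continuous_bounded (fun t => Re (f t))) as [M HM].
  { intros t; now rewrite Hp. } { exact (fun t => proj1 (Hc t)). }
  destruct (periodic_continuous_bounded (fun t => Im (f t))) as [N HN].
  { intros t; now rewrite Hp. } { exact (fun t => proj2 (Hc t)). }
  exists (M + N); intros t; eapply Rle_trans; [apply Cmod_le_Re_Im |].
  now apply Rplus_le_compat.
Qed.

(** A function of [t] seen as constant in [x], so that smooth periodic coefficients inherit the
    algebra of [Mul]. *)
Definition smT (a : R -> C) : Prop := Mul (fun t _ => a t).

Lemma smT_const (z : C) : smT (fun _ => z).
Proof. exact (Mul_const z). Qed.

Lemma smT_deriv a : smT a -> exists a', smT a' /\ forall t, isD a t (a' t).
Proof.
  intros H; exists (fun t => cdt (fun t _ => a t) t 0); split; [exact (Mul_cdt _ H) |].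
  intros t; exact (Mul_is_dt _ H t 0).
Qed.

Lemma smT_mult a b : smT a -> smT b -> smT (fun t => a t * b t)%C.
Proof. intros Ha Hb; exact (Mul_mult _ _ Ha Hb). Qed.

Lemma smT_plus a b : smT a -> smT b -> smT (fun t => a t + b t)%C.
Proof. intros Ha Hb; exact (Mul_plus _ _ Ha Hb). Qed.

Lemma smT_scal z a : smT a -> smT (fun t => z * a t)%C.
Proof. intros Ha; exact (Mul_scal z _ Ha). Qed.

Lemma smT_bounded a : smT a -> exists M, forall t, Cmod (a t) <= M.
Proof. intros Ha; destruct (Ha O) as [_ [M HM]]; exists M; intros t; exact (HM t 0). Qed.

Lemma smT_periodic a : smT a -> forall t, a (t + 2 * PI) = a t.
Proof. intros Ha t; exact (proj1 (Ha O) t 0). Qed.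

Lemma smT_continuous a : smT a -> Ccontinuous a.
Proof. intros Ha; destruct (smT_deriv a Ha) as [a' [_ HD]]; exact (isD_Ccontinuous _ _ HD). Qed.

Lemma smooth1_Derive g : smooth1 g -> smooth1 (Derive g).
Proof.
  intros H n t; apply ex_derive_ext with (Derive_n g (S n)); [| apply H].
  intros s; rewrite <- (Nat.add_1_r n), <- (Derive_n_comp g n 1); reflexivity.
Qed.

Lemma smooth_T1_smT (c : R -> C) : smooth_T1 c -> smT c.
Proof.
  intros Hc n; revert c Hc; induction n as [| n IHn]; intros c [Hp [H1 H2]].
  all: assert (HD : forall t, isD c t (Derive (fun s => Re (c s)) t, Derive (fun s => Im (c s)) t))
    by (intros t; split; apply Derive_correct; [exact (H1 O t) | exact (H2 O t)]).
  all: assert (HB : bounded2 (fun t _ => c t)) by (split; [intros t x; apply Hp |];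
    destruct (Cperiodic_continuous_bounded c Hp (isD_Ccontinuous _ _ HD)) as [M HM]; now exists M).
  - easy.
  - eapply Reg_intro; [easy | intros t x; apply HD | intros t x; apply isD_const | | apply (Mul_const 0)].
    apply IHn; split; [exact (isD_shift c _ (2 * PI) Hp HD) | split; now apply smooth1_Derive].
Qed.

(** * Integrals over an interval and over the cylinder *)

Definition CRI (h : R -> C) (a b : R) : C := (RInt (fun t => Re (h t)) a b, RInt (fun t => Im (h t)) a b).

Lemma CRI_plus (f g : R -> C) (a b : R) :
  Ccontinuous f -> Ccontinuous g -> CRI (fun t => f t + g t)%C a b = (CRI f a b + CRI g a b)%C.
Proof.
  intros Hf Hg; apply C_ext; unfold CRI; simpl.
  - apply (RInt_plus (fun t => Re (f t)) (fun t => Re (g t))); apply ex_RInt_continuous_all; [exact (fun t => proj1 (Hf t)) | exact (fun t => proj1 (Hg t))].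
  - apply (RInt_plus (fun t => Im (f t)) (fun t => Im (g t))); apply ex_RInt_continuous_all; [exact (fun t => proj2 (Hf t)) | exact (fun t => proj2 (Hg t))].
Qed.

Lemma CRI_FTC (F f : R -> C) (a b : R) :
  (forall t, isD F t (f t)) -> Ccontinuous f -> CRI f a b = (F b - F a)%C.
Proof.
  intros HF Hf; apply C_ext; unfold CRI; simpl.
  - apply (RInt_FTC (fun t => Re (F t))); [exact (fun t => proj1 (HF t)) | exact (fun t => proj1 (Hf t))].
  - apply (RInt_FTC (fun t => Im (F t))); [exact (fun t => proj2 (HF t)) | exact (fun t => proj2 (Hf t))].
Qed.

Lemma isD_CRI (f : R -> C) (a t : R) : Ccontinuous f -> isD (fun s => CRI f a s) t (f t).
Proof. intros H; split; apply is_derive_RInt_upper; [exact (fun t => proj1 (H t)) | exact (fun t => proj2 (H t))]. Qed.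

Lemma CRI_scal (z : C) (f : R -> C) (a b : R) :
  Ccontinuous f -> CRI (fun t => z * f t)%C a b = (z * CRI f a b)%C.
Proof.
  intros Hf; rewrite (CRI_FTC (fun s => z * CRI f a s)%C).
  - replace (CRI f a a) with (RtoC 0); [ring |].
    apply C_ext; unfold CRI; simpl; symmetry; exact (RInt_point a _).
  - intros t; now apply isD_scal, isD_CRI.
  - apply Ccontinuous_mult; [apply Ccontinuous_const | easy].
Qed.

Lemma CRI_bound (f : R -> C) (a b M : R) :
  a <= b -> Ccontinuous f -> (forall t, a <= t <= b -> Cmod (f t) <= M) -> Cmod (CRI f a b) <= 2 * (b - a) * M.
Proof.
  intros Hab Hf HM; eapply Rle_trans; [apply Cmod_le_Re_Im |]; unfold CRI; simpl.
  assert (H1 : Rabs (RInt (fun t => Re (f t)) a b) <= (b - a) * M).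
  { apply abs_RInt_le_const; [easy | apply ex_RInt_continuous_all; exact (fun t => proj1 (Hf t)) |].
    intros; eapply Rle_trans; [apply re_le_Cmod | now apply HM]. }
  assert (H2 : Rabs (RInt (fun t => Im (f t)) a b) <= (b - a) * M).
  { apply abs_RInt_le_const; [easy | apply ex_RInt_continuous_all; exact (fun t => proj2 (Hf t)) |].
    intros; eapply Rle_trans; [apply im_le_Cmod | now apply HM]. }
  eapply Rle_trans; [exact (Rplus_le_compat _ _ _ _ H1 H2) | lra].
Qed.

Definition I2 (p : R -> R -> C) : C := CRI (fun t => CI (p t)) 0 (2 * PI).

Lemma cpair_I2 f phi : cpair f phi = I2 (fun t x => f t x * phi t x)%C.
Proof. reflexivity. Qed.

Lemma Reg_CI_continuous p : Reg decaying2 3 p -> Ccontinuous (fun t => CI (p t)).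
Proof. intros H; exact (isD_Ccontinuous _ _ (Reg_decaying_isD_CI p H)). Qed.

Lemma Reg_31 B p : Reg B 3 p -> Reg B 1 p.
Proof. intros H; now do 2 apply Reg_S. Qed.

Lemma I2_plus p r :
  Reg decaying2 3 p -> Reg decaying2 3 r -> I2 (fun t x => p t x + r t x)%C = (I2 p + I2 r)%C.
Proof.
  intros Hp Hr; unfold I2; rewrite <- CRI_plus by now apply Reg_CI_continuous.
  f_equal; apply functional_extensionality; intros t.
  destruct (Reg_decaying_dominated p (Reg_31 _ _ Hp)) as [K HK].
  destruct (Reg_decaying_dominated r (Reg_31 _ _ Hr)) as [L HL].
  exact (CI_plus _ _ _ _ (HK t) (HL t)).
Qed.

Lemma I2_scal (z : C) p : Reg decaying2 3 p -> I2 (fun t x => z * p t x)%C = (z * I2 p)%C.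
Proof.
  intros Hp; unfold I2; rewrite <- CRI_scal by now apply Reg_CI_continuous.
  f_equal; apply functional_extensionality; intros t.
  destruct (Reg_decaying_dominated p (Reg_31 _ _ Hp)) as [K HK].
  exact (CI_scal _ _ _ (HK t)).
Qed.

Lemma I2_cdt p : Reg decaying2 4 p -> I2 (cdt p) = 0.
Proof.
  intros Hp; unfold I2.
  rewrite (CRI_FTC (fun t => CI (p t))).
  - destruct (Reg_base _ _ _ Hp) as [Hper _].
    replace (p (2 * PI)) with (p 0); [ring |].
    apply functional_extensionality; intros x; rewrite <- (Hper 0 x); f_equal; ring.
  - now apply Reg_decaying_isD_CI, Reg_S.
  - now apply Reg_CI_continuous, Reg_cdt.
Qed.

Lemma I2_cdx (a : R -> C) p : Reg decaying2 4 p -> I2 (fun t x => a t * cdx p t x)%C = 0.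
Proof.
  intros Hp; unfold I2.
  replace (fun t => CI (fun x => a t * cdx p t x)%C) with (fun _ : R => RtoC 0).
  - apply C_ext; unfold CRI; simpl.
    + generalize (RInt_const 0 (2 * PI) (0 : R)); unfold scal; simpl; unfold mult; simpl; rewrite Rmult_0_r; easy.
    + generalize (RInt_const 0 (2 * PI) (0 : R)); unfold scal; simpl; unfold mult; simpl; rewrite Rmult_0_r; easy.
  - apply functional_extensionality; intros t; symmetry.
    destruct (Reg_decaying_dominated p (Reg_31 _ _ (Reg_S _ _ _ Hp))) as [K HK].
    destruct (Reg_decaying_dominated _ (Reg_31 _ _ (Reg_cdx _ _ _ Hp))) as [L HL].
    rewrite (CI_scal _ _ (a t) (HL t)).
    rewrite (CI_derive _ _ _ _ (HL t) (Cdominated_x _ _ (HK t))); [ring |].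
    intros x; eapply Reg_is_dx, Hp.
Qed.

(** [L] acting on functions; [Lop] acts on functionals through the transpose. *)
Definition LL (c q : R -> C) (U : R -> R -> C) : R -> R -> C :=
  fun t x => (cdt U t x + c t * cdx U t x + q t * U t x)%C.

Lemma Sch_Lt c q phi :
  smT c -> smT q -> Sch phi -> Sch (Lt c q phi).
Proof.
  intros Hc Hq Hp.
  replace (Lt c q phi) with (fun t x => (- (1)) * (cdt phi t x + c t * cdx phi t x) + q t * phi t x)%C
    by (apply funext2; intros; unfold Lt; ring).
  apply Sch_plus; [apply Sch_scal, Sch_plus; [now apply Sch_cdt |] |].
  - apply (Mul_Sch (fun t _ => c t)); [easy | now apply Sch_cdx].
  - now apply (Mul_Sch (fun t _ => q t)).
Qed.

(** [U tL phi + d_t (U phi) + c d_x (U phi) = (L U) phi], and the two added terms have integral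
    zero: one by periodicity, the other because [c] depends on [t] only. All decay comes from
    [phi]. *)
Lemma cpair_Lt c q U phi :
  smT c -> smT q -> Reg bounded2 4 U -> Sch phi ->
  cpair U (Lt c q phi) = cpair (LL c q U) phi.
Proof.
  intros Hc Hq HU Hp.
  set (p := fun t x => (U t x * phi t x)%C).
  assert (HP : Reg decaying2 4 p) by (apply Reg_bounded_decaying; [easy | apply Hp]).
  assert (Edt : cdt p = fun t x => (cdt U t x * phi t x + U t x * cdt phi t x)%C).
  { apply is_dt_cdt, is_dt_mult; [eapply Reg_is_dt, HU | now apply Sch_is_dt]. }
  assert (Edx : cdx p = fun t x => (cdx U t x * phi t x + U t x * cdx phi t x)%C).
  { apply is_dx_cdx, is_dx_mult; [eapply Reg_is_dx, HU | now apply Sch_is_dx]. }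
  assert (HA : Reg decaying2 3 (fun t x => U t x * Lt c q phi t x)%C).
  { apply Reg_bounded_decaying; [now apply Reg_S | now apply Sch_Lt]. }
  assert (HB : Reg decaying2 3 (cdt p)) by now apply Reg_cdt.
  assert (HC : Reg decaying2 3 (fun t x => c t * cdx p t x)%C).
  { apply (Reg_bounded_decaying 3 (fun t _ => c t)); [apply Hc | now apply Reg_cdx]. }
  rewrite !cpair_I2.
  replace (fun t x => LL c q U t x * phi t x)%C
    with (fun t x => (U t x * Lt c q phi t x + cdt p t x) + c t * cdx p t x)%C.
  - rewrite I2_plus, I2_plus, I2_cdt, I2_cdx; auto; [ring |].
    apply Reg_plus; auto using decaying2_plus.
  - apply funext2; intros t x; rewrite Edt, Edx; unfold LL, Lt; ring.
Qed.

Lemma tempered_cpair U : Reg bounded2 3 U -> tempered (cpair U).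
Proof.
  intros HU.
  assert (HP : forall f, Schwartz f -> Reg decaying2 3 (fun t x => U t x * f t x)%C).
  { intros f Hf; apply Reg_bounded_decaying; [easy | now apply Schwartz_Sch]. }
  split; [| split].
  - intros f g Hf Hg; rewrite !cpair_I2, <- I2_plus by now apply HP.
    f_equal; apply funext2; intros; ring.
  - intros a f Hf; rewrite !cpair_I2, <- I2_scal by now apply HP.
    f_equal; apply funext2; intros; ring.
  - destruct (Reg_base _ _ _ HU) as [_ [B HB]].
    assert (HB0 : 0 <= B) by (eapply Rle_trans; [apply Cmod_ge_0 | apply (HB 0 0)]).
    (* [2 (2 PI - 0)] comes from integrating in [t] and [2 PI] from integrating in [x]; [B] bounds
       [U], and the last 2 adds the seminorms with weights 1 and [x^2]. *)
    exists 2%nat, (2 * (2 * PI - 0) * (2 * PI * (B * 2))); intros f M Hf HM.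
    rewrite cpair_I2; unfold I2; rewrite Rmult_assoc.
    apply CRI_bound; [generalize PI_RGT_0; lra | now apply Reg_CI_continuous, HP |].
    intros t _; rewrite Rmult_assoc.
    destruct (Reg_decaying_dominated _ (Reg_31 _ _ (HP f Hf))) as [K HK].
    apply CI_bound; split; [apply HK |].
    intros x; rewrite Cmod_mult; unfold Rdiv; rewrite (Rmult_assoc B), (Rmult_assoc B).
    apply Rmult_le_compat; auto using Cmod_ge_0.
    apply Rle_div_r; [apply one_plus_sq_pos |].
    assert (H0 : Cmod (RtoC (x ^ 0) * cdtn 0 (cdxn 0 f) t x) <= M) by (apply HM; lia).
    assert (H2 : Cmod (RtoC (x ^ 2) * cdtn 0 (cdxn 0 f) t x) <= M) by (apply HM; lia).
    rewrite Cmod_mult, Cmod_R in H0, H2; rewrite (Rabs_pos_eq (x ^ 2)) in H2 by apply pow2_ge_0.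
    simpl in H0, H2 |- *; rewrite Rabs_R1 in H0; unfold cdtn, cdxn in *; simpl in *; nra.
Qed.

Lemma GH_of_solvable c q :
  smT c -> smT q ->
  (forall f, Sch f -> exists v, Sch v /\ LL c q v = f) ->
  (forall psi, Sch psi -> exists phi, Sch phi /\ Lt c q phi = psi) ->
  Schwartz_GH c q.
Proof.
  intros Hc Hq HL HLt u Hu [f [Hf Huf]].
  destruct (HL f (Schwartz_Sch f Hf)) as [v [Hv Ev]].
  exists v; split; [now apply Sch_Schwartz |]; intros psi Hpsi.
  destruct (HLt psi (Schwartz_Sch psi Hpsi)) as [phi [Hphi <-]].
  rewrite cpair_Lt, Ev; auto; [| apply Sch_Mul, Hv].
  now apply Huf, Sch_Schwartz.
Qed.

(** * The Fourier transform in x *)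

Definition wave (z x : R) : C := cexp (Ci * RtoC (z * x)).

Lemma Cmod_wave z x : Cmod (wave z x) = 1.
Proof.
  unfold wave; rewrite Cmod_cexp; replace (Re _) with 0 by (unfold Re; simpl; ring); apply exp_0.
Qed.

Lemma wave_0_l x : wave 0 x = 1.
Proof. unfold wave; rewrite Rmult_0_l, <- cexp_0; f_equal; ring. Qed.

Lemma wave_plus_r z x y : wave z (x + y) = (wave z x * wave z y)%C.
Proof. unfold wave; rewrite <- cexp_plus; f_equal; rewrite Rmult_plus_distr_l, RtoC_plus; ring. Qed.

Lemma wave_opp z x : (wave z x * wave (- z) x)%C = 1.
Proof.
  unfold wave; rewrite <- cexp_plus, <- cexp_0; f_equal.
  rewrite <- Ropp_mult_distr_l, RtoC_opp; ring.
Qed.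

Lemma isD_lin (a x : R) : isD (fun y => RtoC (a * y)) x a.
Proof.
  eapply isD_val; [apply isD_RtoC, is_derive_scal, is_derive_id | apply f_equal; unfold one; simpl; ring].
Qed.

Lemma isD_wave_x z x : isD (wave z) x (Ci * z * wave z x)%C.
Proof.
  unfold wave; apply (isD_cexp (fun y => Ci * RtoC (z * y))%C), isD_scal, isD_lin.
Qed.

Lemma isD_wave_z z x : isD (fun y => wave y x) z (Ci * x * wave z x)%C.
Proof.
  unfold wave; apply (isD_cexp (fun y => Ci * RtoC (y * x))%C), isD_scal.
  apply isD_ext with (fun y => RtoC (x * y)); [intros; f_equal; ring | apply isD_lin].
Qed.

Lemma Mul_wave z : Mul (fun _ x => wave z x).
Proof.
  intros n; induction n.
  - split; [easy | exists 1; intros; rewrite Cmod_wave; lra].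
  - apply Reg_intro with (fun _ _ => 0) (fun _ x => Ci * z * wave z x)%C.
    + split; [easy | exists 1; intros; rewrite Cmod_wave; lra].
    + intros t x; apply isD_const.
    + intros t x; apply isD_wave_x.
    + apply (Mul_const 0).
    + apply (Reg_mult bounded2 bounded2); auto using bounded2_plus, bounded2_mult.
      apply (Mul_const (Ci * z)%C).
Qed.

Lemma Sch_wave z f : Sch f -> Sch (fun t x => wave z x * f t x)%C.
Proof. apply (Mul_Sch (fun _ x => wave z x)), Mul_wave. Qed.

Lemma Sch_dominated f : Sch f -> exists K, forall t, Cdominated (f t) K.
Proof. intros H; exact (Reg_decaying_dominated f (H 1%nat)). Qed.

(** Unnormalised; the frequency takes the place of [x], so the transform maps [Sch] into itself and
    may be iterated. *)
Definition Fourier (f : R -> R -> C) : R -> R -> C := fun t xi => CI (fun x => wave (- xi) x * f t x)%C.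

Lemma Fourier_wave_dominated f : Sch f -> exists K, forall xi t, Cdominated (fun x => wave xi x * f t x)%C K.
Proof.
  intros H; destruct (Sch_dominated f H) as [K HK]; exists K; intros xi t.
  destruct (Sch_dominated _ (Sch_wave xi f H)) as [K' HK'].
  split; [apply (HK' t) | intros x].
  rewrite Cmod_mult, Cmod_wave, Rmult_1_l; apply HK.
Qed.

Lemma Fourier_plus f g : Sch f -> Sch g -> Fourier (fun t x => f t x + g t x)%C = fun t xi => (Fourier f t xi + Fourier g t xi)%C.
Proof.
  intros Hf Hg; apply funext2; intros t xi; unfold Fourier.
  destruct (Fourier_wave_dominated f Hf) as [K HK], (Fourier_wave_dominated g Hg) as [L HL].
  rewrite <- (CI_plus _ _ _ _ (HK (- xi) t) (HL (- xi) t)).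
  f_equal; apply functional_extensionality; intros x; ring.
Qed.

Lemma Fourier_scal (a : R -> C) f : Sch f -> Fourier (fun t x => a t * f t x)%C = fun t xi => (a t * Fourier f t xi)%C.
Proof.
  intros Hf; apply funext2; intros t xi; unfold Fourier.
  destruct (Fourier_wave_dominated f Hf) as [K HK].
  rewrite <- (CI_scal _ _ (a t) (HK (- xi) t)).
  f_equal; apply functional_extensionality; intros x; ring.
Qed.

Lemma Fourier_cdx f t xi : Sch f -> Fourier (cdx f) t xi = (Ci * xi * Fourier f t xi)%C.
Proof.
  intros Hf; unfold Fourier.
  destruct (Fourier_wave_dominated f Hf) as [K HK].
  destruct (Fourier_wave_dominated _ (Sch_cdx f Hf)) as [L HL].
  generalize (Cdominated_scal _ _ (- (Ci * xi))%C (HK (- xi) t)); intros HK'.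
  assert (E : (CI (fun x => - (Ci * xi) * (wave (- xi) x * f t x))
    + CI (fun x => wave (- xi) x * cdx f t x))%C = 0).
  { rewrite <- (CI_plus _ _ _ _ HK' (HL (- xi) t)).
    eapply CI_derive; [exact (Cdominated_plus _ _ _ _ HK' (HL (- xi) t)) | exact (Cdominated_x _ _ (HK (- xi) t)) |].
    intros x; eapply isD_val; [apply isD_mult; [apply isD_wave_x | now apply Sch_is_dx] |].
    simpl; rewrite RtoC_opp; ring. }
  rewrite (CI_scal _ _ _ (HK (- xi) t)) in E.
  set (A := CI (fun x => wave (- xi) x * f t x)%C) in *.
  set (B := CI (fun x => wave (- xi) x * cdx f t x)%C) in *.
  replace B with ((- (Ci * xi) * A + B) + Ci * xi * A)%C by ring; rewrite E; ring.
Qed.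

Lemma Fourier_is_dt f : Sch f -> is_dt (Fourier f) (Fourier (cdt f)).
Proof.
  intros Hf t xi; unfold Fourier.
  assert (E : cdt (fun t x => wave (- xi) x * f t x)%C = fun t x => (wave (- xi) x * cdt f t x)%C).
  { apply is_dt_cdt; intros s x; apply isD_scal; now apply Sch_is_dt. }
  generalize (Reg_decaying_isD_CI _ (Sch_wave (- xi) f Hf 3%nat) t); now rewrite E.
Qed.

Lemma isD_wave_neg xi x (z : C) : isD (fun xi => wave (- xi) x * z)%C xi (wave (- xi) x * (- Ci * (x * z)))%C.
Proof.
  eapply isD_val.
  - apply isD_mult; [| apply isD_const].
    apply (isD_comp (fun y => wave y x) (fun y => - y) xi (- (1))); [apply isD_wave_z |].
    apply is_derive_Ropp, (is_derive_id xi).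
  - simpl; rewrite !RtoC_opp; ring.
Qed.

(** Phrased through domination alone, because it also serves the quotient [k] of [CI_Fourier_zero],
    for which domination is what is established. *)
Lemma isD_CI_wave (h h1 : R -> C) (K : R) :
  (forall xi, Cdominated (fun x => wave xi x * h x)%C K) ->
  (forall xi, Cdominated (fun x => wave xi x * h1 x)%C K) ->
  (forall x : R, h1 x = - Ci * (x * h x))%C -> (forall x : R, Cmod (x * h1 x) <= K / (1 + x ^ 2)) ->
  forall xi, isD (fun xi => CI (fun x => wave (- xi) x * h x)%C) xi (CI (fun x => wave (- xi) x * h1 x)%C).
Proof.
  intros H H1 E1 H2 xi.
  apply (isD_CI (fun xi x => wave (- xi) x * h x)%C (fun xi x => wave (- xi) x * h1 x)%C (2 * K) K).
  - intros p; apply H.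
  - intros p; apply H1.
  - intros p x; rewrite E1; apply isD_wave_neg.
  - intros p p' x; eapply Rle_trans.
    + apply (isD_Lipschitz (fun s => wave (- s) x * h1 x)%C (fun s => wave (- s) x * (- Ci * (x * h1 x)))%C p p' (K / (1 + x ^ 2))).
      * intros; apply isD_wave_neg.
      * intros; rewrite Cmod_mult, Cmod_wave, Cmod_mult, Cmod_opp, Cmod_Ci, !Rmult_1_l; apply H2.
    + right; unfold Rdiv; ring.
Qed.

Lemma Fourier_is_dx f : Sch f -> is_dx (Fourier f) (Fourier (fun t x => - Ci * (x * f t x))%C).
Proof.
  intros Hf t xi; unfold Fourier.
  assert (Hf1 : Sch (fun t x => - Ci * (x * f t x))%C) by now apply Sch_scal, Sch_x.
  destruct (Fourier_wave_dominated f Hf) as [K HK], (Fourier_wave_dominated _ Hf1) as [L HL].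
  destruct (Sch_dominated _ (Sch_x _ Hf1)) as [N HN].
  set (M := Rmax K (Rmax L N)).
  assert (K <= M) by apply Rmax_l.
  assert (L <= M) by (eapply Rle_trans; [apply Rmax_l | apply Rmax_r]).
  assert (N <= M) by (eapply Rle_trans; [apply Rmax_r | apply Rmax_r]).
  apply (isD_CI_wave (f t) _ M).
  - intros z; apply Cdominated_le with K; auto.
  - intros z; apply Cdominated_le with L; auto.
  - easy.
  - intros x; exact (proj2 (Cdominated_le _ _ _ H1 (HN t)) x).
Qed.

(** Each factor [xi] is traded for a derivative in [x]. *)
Lemma Fourier_decaying f : Sch f -> decaying2 (Fourier f).
Proof.
  intros Hf; split.
  - intros t xi; unfold Fourier; f_equal; apply functional_extensionality; intros x.
    now rewrite (proj1 (Hf O)).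
  - intros k; revert f Hf; induction k; intros f Hf.
    + destruct (Fourier_wave_dominated f Hf) as [K HK]; exists (2 * PI * K); intros t xi.
      simpl; rewrite Cmult_1_l; apply CI_bound, HK.
    + destruct (IHk (fun t x => - Ci * cdx f t x)%C) as [M HM]; [now apply Sch_scal, Sch_cdx |].
      exists M; intros t xi; specialize (HM t xi).
      rewrite (Fourier_scal (fun _ => - Ci)%C) in HM by now apply Sch_cdx.
      rewrite Fourier_cdx in HM by easy.
      replace (RtoC (xi ^ S k) * Fourier f t xi)%C
        with (RtoC (xi ^ k) * (- Ci * (Ci * xi * Fourier f t xi)))%C; [easy |].
      simpl (xi ^ S k); rewrite RtoC_mult.
      transitivity (- (Ci * Ci) * (RtoC xi * RtoC (xi ^ k)) * Fourier f t xi)%C; [ring |].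
      replace (- (Ci * Ci))%C with (RtoC 1); [ring |]. apply C_ext; unfold Re, Im; simpl; ring.
Qed.

Lemma Sch_Fourier f : Sch f -> Sch (Fourier f).
Proof.
  intros Hf n; revert f Hf; induction n; intros f Hf; [now apply Fourier_decaying |].
  eapply Reg_intro; [now apply Fourier_decaying | now apply Fourier_is_dt | now apply Fourier_is_dx | |].
  - now apply IHn, Sch_cdt.
  - now apply IHn, Sch_scal, Sch_x.
Qed.

Lemma decaying2_shift f c : decaying2 f -> decaying2 (fun t x => f t (x + c)).
Proof.
  intros [Hp H]; split; [intros t x; apply Hp |].
  intros k; revert f Hp H; induction k; intros f Hp H.
  - destruct (H O) as [M HM]; exists M; intros t x; apply (HM t (x + c)).
  - assert (Hd : decaying2 f) by now split.
    destruct (decaying2_x f Hd) as [Hp1 H1].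
    destruct (IHk _ Hp1 H1) as [M HM], (IHk _ Hp H) as [N HN].
    exists (M + Rabs c * N); intros t x.
    replace (RtoC (x ^ S k) * f t (x + c)%R)%C
      with (RtoC (x ^ k) * ((x + c)%R * f t (x + c)%R) + - c * (RtoC (x ^ k) * f t (x + c)%R))%C
      by (simpl; rewrite RtoC_mult, RtoC_plus; ring).
    eapply Rle_trans; [apply Cmod_triangle |]; apply Rplus_le_compat; [apply HM |].
    rewrite Cmod_mult, Cmod_opp, Cmod_R; apply Rmult_le_compat_l; [apply Rabs_pos | apply HN].
Qed.

Lemma Sch_shift f c : Sch f -> Sch (fun t x => f t (x + c)).
Proof.
  intros H n; specialize (H n); revert f H; induction n; intros f H; [now apply decaying2_shift |].
  apply Reg_intro with (fun t x => cdt f t (x + c)) (fun t x => cdx f t (x + c)).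
  - eapply decaying2_shift, Reg_base, H.
  - intros t x; eapply Reg_is_dt, H.
  - intros t x; apply (isD_translate (f t)); intros; eapply Reg_is_dx, H.
  - now apply IHn, Reg_cdt.
  - now apply IHn, Reg_cdx.
Qed.

Lemma Sch_reflect f : Sch f -> Sch (fun t x => f t (- x)).
Proof.
  assert (HB : forall f, decaying2 f -> decaying2 (fun t x => f t (- x))).
  { intros g [Hp H]; split; [intros t x; apply Hp |]; intros k; destruct (H k) as [M HM]; exists M; intros t x.
    rewrite Cmod_mult, Cmod_R, <- RPow_abs, <- Rabs_Ropp, RPow_abs, <- Cmod_R, <- Cmod_mult; apply HM. }
  intros H n; specialize (H n); revert f H; induction n; intros f H; [now apply HB |].
  apply Reg_intro with (fun t x => cdt f t (- x)) (fun t x => - (1) * cdx f t (- x)%R)%C.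
  - eapply HB, Reg_base, H.
  - intros t x; eapply Reg_is_dt, H.
  - intros t x; eapply isD_val; [apply (isD_comp (f t) Ropp x (- (1))); [eapply Reg_is_dx, H |] |].
    + apply is_derive_Ropp, (is_derive_id x).
    + f_equal; apply RtoC_opp.
  - now apply IHn, Reg_cdt.
  - apply (Reg_bounded_decaying n (fun _ _ => - (1))%C); [apply Mul_const | now apply IHn, Reg_cdx].
Qed.

(** * The Gaussian and its moments *)

Lemma exp_INR_mult (n : nat) (z : R) : exp (INR n * z) = exp z ^ n.
Proof.
  induction n; [simpl; now rewrite Rmult_0_l, exp_0 |].
  rewrite S_INR, Rmult_plus_distr_r, exp_plus, IHn, Rmult_1_l; simpl; ring.
Qed.

(** From [y / k <= exp (y / k)] raised to the power [k]. The constant is crude but explicit, and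
    serves the Gaussian, the flat functions and [core] alike. *)
Lemma pow_le_exp (k : nat) (y : R) : 0 <= y -> y ^ k <= INR k ^ k * exp y.
Proof.
  intros Hy; destruct k as [| k]; [simpl; generalize (exp_ineq1_le y); lra |].
  set (n := S k); assert (Hn : 0 < INR n) by (apply lt_0_INR; unfold n; lia).
  assert (E : exp y = exp (y / INR n) ^ n).
  { rewrite <- exp_INR_mult; f_equal; field; lra. }
  rewrite E, <- Rpow_mult_distr; apply pow_incr; split; [easy |].
  generalize (exp_ineq1_le (y / INR n)); intros H.
  apply Rle_trans with (INR n * (y / INR n)); [right; field; lra | apply Rmult_le_compat_l; lra].
Qed.

Definition gauss (x : R) : R := exp (- (x * x / 2)).

Lemma gauss_moment (k : nat) : exists M, forall x, Rabs (x ^ k * gauss x) <= M.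
Proof.
  exists (INR k ^ k * exp (1 / 2)); intros x; unfold gauss.
  rewrite Rabs_mult, (Rabs_pos_eq (exp _)) by (left; apply exp_pos).
  rewrite <- RPow_abs.
  apply Rle_trans with (INR k ^ k * exp (Rabs x) * exp (- (x * x / 2))).
  - apply Rmult_le_compat_r; [left; apply exp_pos | apply pow_le_exp, Rabs_pos].
  - rewrite Rmult_assoc, <- exp_plus; apply Rmult_le_compat_l; [apply pow_le, pos_INR |].
    assert (Rabs x + - (x * x / 2) <= 1 / 2).
    { replace (x * x) with (Rabs x * Rabs x) by (rewrite <- Rabs_mult; apply Rabs_pos_eq; nra).
      generalize (pow2_ge_0 (Rabs x - 1)); intros; nra. }
    destruct (Rle_lt_or_eq_dec _ _ H) as [h | h]; [left; now apply exp_increasing | rewrite h; lra].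
Qed.

Lemma isD_gauss x : isD (fun y => RtoC (gauss y)) x (- (1) * (x * gauss x))%C.
Proof.
  eapply isD_val.
  - apply isD_RtoC, (is_derive_Rcomp exp (fun y => - (y * y / 2)) x (gauss x) (- x)); [apply is_derive_exp |].
    auto_derive; [easy | field].
  - fold (gauss x); rewrite RtoC_mult, RtoC_opp; ring.
Qed.

Lemma Sch_gauss : Sch (fun _ x => RtoC (gauss x)).
Proof.
  assert (HB : decaying2 (fun _ x => RtoC (gauss x))).
  { split; [easy |]; intros k; destruct (gauss_moment k) as [M HM]; exists M; intros _ x.
    rewrite <- RtoC_mult, Cmod_R; apply HM. }
  intros n; induction n; [easy |].
  apply Reg_intro with (fun _ _ => 0) (fun _ x : R => - (1) * (x * gauss x))%C; auto.
  - intros t x; apply isD_const.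
  - intros t x; apply isD_gauss.
  - assert (HR : Reg decaying2 n (fun _ x : R => 0 * gauss x)%C).
    { apply (Reg_bounded_decaying n (fun _ _ => 0)); [apply Mul_const | easy]. }
    replace (fun _ _ : R => RtoC 0) with (fun (_ : R) (x : R) => 0 * gauss x)%C; [easy |].
    apply funext2; intros; ring.
  - apply (Reg_bounded_decaying n (fun _ _ => - (1))%C); [apply Mul_const |].
    now apply Reg_decaying_x.
Qed.

(** * Smooth division by [x], with bounded derivatives *)

Fixpoint CB (n : nat) (h : R -> C) : Prop :=
  (exists M, forall x, Cmod (h x) <= M) /\
  match n with
  | O => True
  | S m => exists h', (forall x, isD h x (h' x)) /\ CB m h'
  end.

Lemma Reg_CB n f t : Reg bounded2 n f -> CB n (f t).
Proof.
  revert f; induction n; intros f H.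
  - split; [| easy]. destruct H as [_ [M HM]]; exists M; intros; apply HM.
  - split; [destruct (Reg_base _ _ _ H) as [_ [M HM]]; exists M; intros; apply HM |].
    exists (cdx f t); split; [intros x; eapply Reg_is_dx, H | now apply IHn, Reg_cdx].
Qed.

Lemma CB_S n h : CB (S n) h -> CB n h.
Proof.
  revert h; induction n; intros h [H0 [h' [H1 H2]]]; [now split |].
  split; [easy |]; exists h'; auto.
Qed.

Lemma CB_le n m h : CB n h -> (m <= n)%nat -> CB m h.
Proof. intros H Hm; induction Hm; auto using CB_S. Qed.

Lemma CB_deriv n h h' : CB (S n) h -> (forall x, isD h x (h' x)) -> CB n h'.
Proof.
  intros [_ [k [Hk1 Hk2]]] H; replace h' with k; [easy |].
  apply functional_extensionality; intros x; now apply isD_unique with h x.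
Qed.

(** [m] counts the factors [s] that differentiation in [y] brings out; if [h 0 = 0], then
    [moment 0 h'] is the quotient [h y / y] of Hadamard's lemma. *)
Definition moment (m : nat) (g : R -> C) (y : R) : C := CRI (fun s => RtoC (s ^ m) * g (s * y)%R)%C 0 1.

Lemma moment_continuous m g y :
  CB 1 g -> Ccontinuous (fun s => RtoC (s ^ m) * g (s * y)%R)%C.
Proof.
  intros [_ [g' [Hg _]]]; eapply isD_Ccontinuous; intros s; apply isD_mult.
  - apply isD_RtoC; apply is_derive_pow, (is_derive_id s).
  - apply (isD_comp g (fun s => s * y) s y); [apply Hg |].
    auto_derive; [easy | ring].
Qed.

Lemma moment_isD m g g' y :
  CB 2 g -> (forall x, isD g x (g' x)) -> isD (moment m g) y (moment (S m) g' y).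
Proof.
  intros Hg HD; destruct (CB_deriv _ _ _ Hg HD) as [_ [g'' [HD2 [[M HM] _]]]].
  assert (HM0 : 0 <= M) by (eapply Rle_trans; [apply Cmod_ge_0 | apply (HM 0)]).
  apply isD_of_quad with (2 * (1 - 0) * (2 * (2 * M))); intros z _; unfold moment.
  assert (Hc1 : Ccontinuous (fun s => RtoC (s ^ m) * g (s * z)%R)%C) by now apply moment_continuous, CB_S.
  assert (Hc2 : Ccontinuous (fun s => RtoC (s ^ m) * g (s * y)%R)%C) by now apply moment_continuous, CB_S.
  assert (Hc3 : Ccontinuous (fun s => RtoC (s ^ S m) * g' (s * y)%R)%C) by (apply moment_continuous; eapply CB_deriv; eassumption).
  set (f1 := (fun s => RtoC (s ^ m) * g (s * z)%R)%C) in *.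
  set (f2 := (fun s => RtoC (s ^ m) * g (s * y)%R)%C) in *.
  set (f3 := (fun s => RtoC (s ^ S m) * g' (s * y)%R)%C) in *.
  replace (CRI f1 0 1 - CRI f2 0 1 - (z - y)%R * CRI f3 0 1)%C
    with ((CRI f1 0 1 + - (1) * CRI f2 0 1) + - (z - y)%R * CRI f3 0 1)%C by ring.
  rewrite <- !CRI_scal by easy.
  assert (Hs2 : Ccontinuous (fun s => - (1) * f2 s)%C) by (apply Ccontinuous_mult; [apply Ccontinuous_const | easy]).
  assert (Hs3 : Ccontinuous (fun s => - (z - y)%R * f3 s)%C) by (apply Ccontinuous_mult; [apply Ccontinuous_const | easy]).
  rewrite <- !CRI_plus by auto using Ccontinuous_plus.
  rewrite Rmult_assoc; apply CRI_bound; [lra | auto using Ccontinuous_plus |].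
  intros s Hs.
  replace (f1 s + - (1) * f2 s + - (z - y)%R * f3 s)%C
    with (RtoC (s ^ m) * (g (s * z)%R - g (s * y)%R - (s * z - s * y)%R * g' (s * y)%R))%C.
  2: { unfold f1, f2, f3; rewrite !RtoC_minus, !RtoC_mult; simpl; rewrite RtoC_mult; ring. }
  assert (Hp : 0 <= s ^ m <= 1).
  { split; [apply pow_le; lra |]. rewrite <- (pow1 m); apply pow_incr; lra. }
  rewrite Cmod_mult, Cmod_R, Rabs_pos_eq by easy.
  apply Rle_trans with (1 * (2 * (2 * M) * (s * z - s * y) ^ 2)).
  - apply Rmult_le_compat; try easy; [apply Cmod_ge_0 |].
    apply (isD_Taylor g g' (s * y) (2 * M)); [easy |].
    intros u; apply (isD_Lipschitz g' g''); auto.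
  - replace ((s * z - s * y) ^ 2) with (s ^ 2 * (z - y) ^ 2) by ring.
    assert (0 <= M * (z - y) ^ 2 * (1 - s ^ 2)).
    { apply Rmult_le_pos; [apply Rmult_le_pos; [easy | apply pow2_ge_0] | nra]. }
    lra.
Qed.

Lemma moment_bounded m g : CB 1 g -> exists M, forall x, Cmod (moment m g x) <= M.
Proof.
  intros Hg; destruct (proj1 Hg) as [M HM]; exists (2 * (1 - 0) * M); intros x; unfold moment.
  apply CRI_bound; [lra | now apply moment_continuous |].
  intros s Hs; rewrite Cmod_mult, Cmod_R, Rabs_pos_eq by (apply pow_le; lra).
  assert (s ^ m <= 1) by (rewrite <- (pow1 m); apply pow_incr; lra).
  rewrite <- (Rmult_1_l M); apply Rmult_le_compat; auto using Cmod_ge_0; apply pow_le; lra.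
Qed.

(** The two spare orders come from [moment_isD], which rests on a bound for the second derivative;
    they are harmless for functions with bounded derivatives of every order. *)
Lemma moment_CB n m g : CB (S (S n)) g -> CB n (moment m g).
Proof.
  revert m g; induction n; intros m g Hg.
  - split; [now apply moment_bounded, CB_S | easy].
  - split; [apply moment_bounded, (CB_le _ _ _ Hg); lia |].
    assert (Hg' := Hg); destruct Hg' as [_ [g' [HD HC]]].
    exists (moment (S m) g'); split; [| now apply IHn].
    intros x; apply moment_isD; [apply (CB_le _ _ _ Hg); lia | easy].
Qed.

(** Integrate [d/ds h (s y) = y h'(s y)] over [[0, 1]]. *)
Lemma Hadamard_division (h h' : R -> C) :
  (forall x, isD h x (h' x)) -> CB 1 h' -> h 0 = 0 -> forall y, h y = (y * moment 0 h' y)%C.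
Proof.
  intros HD HC H0 y; unfold moment.
  rewrite <- CRI_scal by now apply moment_continuous.
  rewrite (CRI_FTC (fun s => h (s * y))).
  - rewrite Rmult_1_l, Rmult_0_l, H0; ring.
  - intros s; eapply isD_val; [apply (isD_comp h (fun s => s * y) s y); [apply HD |] | simpl; ring].
    auto_derive; [easy | ring].
  - apply Ccontinuous_mult; [apply Ccontinuous_const | now apply moment_continuous].
Qed.

(** It serves the inversion formula, and later strips powers of [x] off the singular function of the
    necessity part. *)
Lemma smooth_division (h : R -> C) :
  (forall n, CB n h) -> h 0 = 0 -> exists k, (forall n, CB n k) /\ forall y, h y = (y * k y)%C.
Proof.
  intros H H0; assert (H' := H); destruct (H' 1%nat) as [_ [h' [HD _]]].
  assert (HC : forall n, CB n h') by (intros n; eapply CB_deriv; [apply H | exact HD]).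
  exists (moment 0 h'); split; [intros n; now apply moment_CB | now apply Hadamard_division].
Qed.

(** * Fourier inversion *)

Lemma wave_sym z x : wave z x = wave x z.
Proof. unfold wave; now rewrite Rmult_comm. Qed.

(** With [f t x = x k x], the transform [Phi] of [k] satisfies [Phi' = - i F], where [F] is the
    transform of [f t]. Concluding by [CI_derive] requires [xi Phi] to be bounded, which is an
    integration by parts against [k']. Both [k] and [k'] are dominated, because [x^2 k = x f] and
    [x^2 k' = x f' - f] are bounded. *)
Lemma CI_Fourier_zero f t : Sch f -> f t 0 = 0 -> CI (Fourier f t) = 0.
Proof.
  intros Hf H0.
  assert (HCB : forall n, CB n (f t)) by (intros n; apply Reg_CB, Sch_Mul, Hf).
  destruct (smooth_division (f t) HCB H0) as [k [Hk Ek]].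
  destruct (Hk 1%nat) as [[B HB] [k' [HD [[B' HB'] _]]]].
  assert (Ef' : forall x, cdx f t x = (k x + x * k' x)%C).
  { intros x; apply isD_unique with (f t) x; [now apply Sch_is_dx |].
    apply isD_ext with (fun y : R => y * k y)%C; [intros; now rewrite Ek |].
    eapply isD_val; [apply isD_mult; [apply isD_id | apply HD] | simpl; ring]. }
  assert (Hk'c : Ccontinuous k').
  { assert (CB 1 k') as [_ [k'' [H _]]] by (eapply CB_deriv; [apply Hk | exact HD]).
    eapply isD_Ccontinuous, H. }
  assert (Hkc : Ccontinuous k) by (eapply isD_Ccontinuous, HD).
  destruct (Sch_Mul _ (Sch_x f Hf) O) as [_ [M1 HM1]].
  destruct (Sch_Mul _ Hf O) as [_ [M0 HM0]].
  destruct (Sch_Mul _ (Sch_x _ (Sch_cdx f Hf)) O) as [_ [M2 HM2]].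
  destruct (Sch_dominated _ (Sch_x f Hf)) as [K1 HK1].
  destruct (Sch_dominated _ (Sch_scal (- Ci)%C f Hf)) as [K0 HK0].
  assert (Hkd : Cdominated k (B + M1)).
  { apply Cdominated_of_bounds; auto; intros x; rewrite <- Ek; apply HM1. }
  assert (Hk'd : Cdominated k' (B' + (M2 + M0))).
  { apply Cdominated_of_bounds; auto; intros x.
    replace (x * (x * k' x))%C with (x * cdx f t x + - f t x)%C by (rewrite Ef', Ek; ring).
    eapply Rle_trans; [apply Cmod_triangle |]; rewrite Cmod_opp; apply Rplus_le_compat; auto. }
  assert (Hwave : forall h N, Cdominated h N -> forall xi, Cdominated (fun x => wave xi x * h x)%C N).
  { intros h N [H1 H2] xi; split.
    - apply Ccontinuous_mult; [| easy].
      eapply isD_Ccontinuous; intros x; apply isD_wave_x.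
    - intros x; rewrite Cmod_mult, Cmod_wave, Rmult_1_l; apply H2. }
  set (M := Rmax (B + M1) (Rmax K0 K1)).
  assert (B + M1 <= M) by apply Rmax_l.
  assert (HA0 : K0 <= M) by (eapply Rle_trans; [apply Rmax_l | apply Rmax_r]).
  assert (HA1 : K1 <= M) by (eapply Rle_trans; [apply Rmax_r | apply Rmax_r]).
  set (Phi := fun xi => CI (fun x => wave (- xi) x * k x)%C).
  assert (HPhi : forall xi : R, isD Phi xi (- Ci * Fourier f t xi)%C).
  { intros xi; unfold Phi.
    eapply isD_val; [apply (isD_CI_wave k (fun x => - Ci * f t x)%C M) |].
    - intros z; apply Hwave, (Cdominated_le k (B + M1)); auto.
    - intros z; apply Hwave, (Cdominated_le _ K0); auto.
    - intros x; now rewrite Ek.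
    - intros x; replace (x * (- Ci * f t x))%C with (- Ci * (x * f t x))%C by ring.
      rewrite Cmod_mult, Cmod_opp, Cmod_Ci, Rmult_1_l; exact (proj2 (Cdominated_le _ _ _ HA1 (HK1 t)) x).
    - generalize (Fourier_scal (fun _ => - Ci)%C f Hf); intros E.
      exact (f_equal (fun g => g t xi) E). }
  assert (HPhi2 : forall xi : R, Cmod (xi * Phi xi) <= 2 * PI * (B' + (M2 + M0))).
  { intros xi.
    assert (E : (CI (fun x => - (Ci * xi) * (wave (- xi) x * k x))
      + CI (fun x => wave (- xi) x * k' x))%C = 0).
    { generalize (Cdominated_scal _ _ (- (Ci * xi))%C (Hwave _ _ Hkd (- xi))); intros G1.
      rewrite <- (CI_plus _ _ _ _ G1 (Hwave _ _ Hk'd (- xi))).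
      eapply CI_derive; [exact (Cdominated_plus _ _ _ _ G1 (Hwave _ _ Hk'd (- xi)))
        | exact (Cdominated_x _ _ (Hwave _ _ Hkd (- xi))) |].
      intros x; eapply isD_val; [apply isD_mult; [apply isD_wave_x | apply HD] |].
      simpl; rewrite RtoC_opp; ring. }
    rewrite (CI_scal _ _ _ (Hwave _ _ Hkd (- xi))) in E.
    generalize (CI_bound _ _ (Hwave _ _ Hk'd (- xi))).
    replace (CI (fun x => wave (- xi) x * k' x)%C) with (Ci * (xi * Phi xi))%C.
    - now rewrite Cmod_mult, Cmod_Ci, Rmult_1_l.
    - fold (Phi xi) in E.
      set (b := CI (fun x => wave (- xi) x * k' x)%C) in *.
      replace b with ((- (Ci * xi) * Phi xi + b) + Ci * (xi * Phi xi))%C by ring; rewrite E; ring. }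
  destruct (Sch_dominated _ (Sch_Fourier f Hf)) as [N HN].
  apply CI_derive with (fun xi : R => Ci * Phi xi)%C N (2 * PI * (B' + (M2 + M0))); [apply HN | |].
  - intros xi; replace (xi * (Ci * Phi xi))%C with (Ci * (xi * Phi xi))%C by ring.
    rewrite Cmod_mult, Cmod_Ci, Rmult_1_l; apply HPhi2.
  - intros xi; eapply isD_val; [apply isD_scal, HPhi |].
    apply C_ext; unfold Re, Im; simpl; ring.
Qed.

(** The square of the Gaussian integral, that is [2 PI]; the argument calls for its being
    nonzero. *)
Definition inversion_constant : C := CI (Fourier (fun _ x => RtoC (gauss x)) 0).

(** Transforming both sides of [gauss' = - x gauss] gives the equation [G' = - xi G], whose
    solutions are the multiples of the Gaussian. *)
Lemma Fourier_gauss t xi :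
  Fourier (fun _ x => RtoC (gauss x)) t xi = (CI (fun x => RtoC (gauss x)) * gauss xi)%C.
Proof.
  set (G := Fourier (fun _ x => RtoC (gauss x)) t).
  assert (HG : forall xi, isD G xi (- xi * G xi)%C).
  { intros z; eapply isD_val; [apply (Fourier_is_dx _ Sch_gauss) |].
    generalize (Fourier_cdx _ t z Sch_gauss).
    rewrite (is_dx_cdx _ (fun _ x => - (1) * (x * gauss x))%C).
    - rewrite (Fourier_scal (fun _ => - (1))%C), (Fourier_scal (fun _ => - Ci)%C) by apply Sch_x, Sch_gauss.
      fold G; intros E; set (A := Fourier _ t z) in *.
      transitivity (Ci * (- (1) * A))%C; [ring |]; rewrite E.
      transitivity (Ci * Ci * z * G z)%C; [ring |].
      replace (Ci * Ci)%C with (- (1))%C by (apply C_ext; unfold Re, Im; simpl; ring); ring.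
    - intros s x; apply isD_gauss. }
  assert (E : forall z, (G z * exp (z * z / 2))%C = (G 0 * exp (0 * 0 / 2))%C).
  { intros z; apply (isD_const_of_zero (fun z => G z * exp (z * z / 2))%C); intros y.
    eapply isD_val.
    - apply isD_mult; [apply HG |]. 
      apply isD_RtoC, (is_derive_Rcomp exp (fun y => y * y / 2) y (exp (y * y / 2)) y); [apply is_derive_exp |].
      auto_derive; [easy | field].
    - simpl; rewrite RtoC_mult; ring. }
  assert (E0 : G 0 = CI (fun x => RtoC (gauss x))).
  { unfold G, Fourier; f_equal; apply functional_extensionality; intros x.
    rewrite Ropp_0, wave_0_l; ring. }
  rewrite <- E0; generalize (E xi); replace (0 * 0 / 2) with 0 by field; rewrite exp_0, Cmult_1_r.
  intros <-; rewrite <- Cmult_assoc, <- RtoC_mult; unfold gauss; rewrite <- exp_plus.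
  replace (xi * xi / 2 + - (xi * xi / 2)) with 0 by ring; rewrite exp_0; ring.
Qed.

Lemma inversion_constant_neq_0 : inversion_constant <> 0.
Proof.
  destruct (Sch_dominated _ Sch_gauss) as [K HK].
  assert (E : inversion_constant = (CI (fun x => RtoC (gauss x)) * CI (fun x => RtoC (gauss x)))%C).
  { unfold inversion_constant.
    rewrite <- (CI_scal _ _ (CI (fun x => RtoC (gauss x))) (HK 0)).
    f_equal; apply functional_extensionality; intros x; apply Fourier_gauss. }
  assert (Hp : 0 < Re (CI (fun x => RtoC (gauss x)))).
  { apply (IR_pos_of_point _ K 0); [exact (Cdominated_Re _ _ (HK 0)) | |].
    - intros x; simpl; left; apply exp_pos.
    - simpl; apply exp_pos. }
  rewrite E; intros E0; apply (f_equal Cmod) in E0; rewrite Cmod_mult, Cmod_0 in E0.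
  assert (H0 : 0 < Cmod (CI (fun x => RtoC (gauss x)))).
  { eapply Rlt_le_trans; [exact Hp |]. eapply Rle_trans; [apply RRle_abs | apply re_le_Cmod]. }
  nra.
Qed.

Lemma Fourier_shift f t x0 xi :
  Sch f -> Fourier (fun t x => f t (x + x0)) t xi = (wave x0 xi * Fourier f t xi)%C.
Proof.
  intros Hf; unfold Fourier.
  destruct (Fourier_wave_dominated f Hf) as [K HK].
  destruct (Fourier_wave_dominated _ (Sch_shift f x0 Hf)) as [L HL].
  assert (E : forall x, (wave (- xi) (x + x0) * f t (x + x0)%R)%C = (wave (- xi) x0 * (wave (- xi) x * f t (x + x0)%R))%C).
  { intros x; rewrite wave_plus_r; ring. }
  assert (HS : Cdominated (fun x => wave (- xi) (x + x0) * f t (x + x0)%R)%C (Cmod (wave (- xi) x0) * L)).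
  { rewrite (functional_extensionality _ _ E); apply Cdominated_scal, HL. }
  rewrite <- (CI_shift _ _ _ x0 (HK (- xi) t) HS), (functional_extensionality _ _ E).
  rewrite (CI_scal _ _ _ (HL (- xi) t)), Cmult_assoc, (wave_sym x0 xi), wave_opp; ring.
Qed.

(* Subtracting a multiple of the Gaussian reduces the inversion formula to a function vanishing at the
   point; such a function is [x k], whose transform is a derivative and so has integral zero. *)
Lemma Fourier_inversion f t x0 :
  Sch f -> Fourier (Fourier f) t (- x0) = (inversion_constant * f t x0)%C.
Proof.
  intros Hf; unfold Fourier at 1; rewrite Ropp_involutive.
  set (a := f t x0).
  set (f1 := (fun s x => f s (x + x0)%R + - a * gauss x)%C).
  assert (Hf1 : Sch f1) by (apply Sch_plus; [now apply Sch_shift | apply Sch_scal, Sch_gauss]).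
  assert (H0 : f1 t 0 = 0).
  { unfold f1, a, gauss; rewrite Rplus_0_l; replace (- (0 * 0 / 2)) with 0 by field; rewrite exp_0; ring. }
  destruct (Sch_dominated _ (Sch_Fourier _ Hf1)) as [K HK].
  destruct (Sch_dominated _ (Sch_Fourier _ Sch_gauss)) as [L HL].
  replace (fun x => wave x0 x * Fourier f t x)%C
    with (fun x => Fourier f1 t x + a * Fourier (fun _ x => RtoC (gauss x)) t x)%C.
  - rewrite (CI_plus _ _ _ _ (HK t) (Cdominated_scal _ _ a (HL t))), (CI_scal _ _ _ (HL t)).
    rewrite CI_Fourier_zero by easy; unfold inversion_constant.
    replace (Fourier (fun _ x => RtoC (gauss x)) 0) with (Fourier (fun _ x => RtoC (gauss x)) t) by reflexivity.
    ring.
  - apply functional_extensionality; intros xi; rewrite <- Fourier_shift by easy.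
    unfold f1; rewrite Fourier_plus, (Fourier_scal (fun _ => - a)%C);
      [ring | apply Sch_gauss | now apply Sch_shift | apply Sch_scal, Sch_gauss].
Qed.

(** The inverse transform [v] of [w] is differentiated under the integral, [d_x] becoming
    multiplication by [i xi] inside. The equation for [w] then collapses [L v] to the inverse
    transform of [Fourier f], so the inversion formula is applied to [f] alone. *)
Lemma solvable_of_Fourier_solvable c q f w :
  smT c -> smT q -> Sch f -> Sch w ->
  (forall t xi, isD (fun s => w s xi) t (Fourier f t xi - (Ci * c t * xi + q t) * w t xi)%C) ->
  exists v, Sch v /\ LL c q v = f.
Proof.
  intros Hc Hq Hf Hw HD.
  set (w1 := (fun t (x : R) => - Ci * (x * w t x))%C).
  assert (Hw1 : Sch w1) by now apply Sch_scal, Sch_x.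
  set (v := fun t x => (/ inversion_constant * Fourier w t (- x)%R)%C).
  assert (Edt : cdt v = fun t x => (/ inversion_constant * Fourier (cdt w) t (- x)%R)%C).
  { apply is_dt_cdt; intros t x; apply isD_scal; now apply Fourier_is_dt. }
  assert (Edx : cdx v = fun t x => (/ inversion_constant * (- (1) * Fourier w1 t (- x)%R))%C).
  { apply is_dx_cdx; intros t x; apply isD_scal.
    eapply isD_val; [apply (isD_comp (Fourier w t) Ropp x (- (1))); [now apply Fourier_is_dx |] |].
    + apply is_derive_Ropp, (is_derive_id x).
    + rewrite RtoC_opp; reflexivity. }
  exists v; split; [apply Sch_scal; now apply (Sch_reflect (Fourier w)), Sch_Fourier |].
  apply funext2; intros t x; unfold LL; rewrite Edt, Edx; unfold v.
  assert (E : cdt w = (fun t xi => Fourier f t xi + (c t * w1 t xi + - (1) * q t * w t xi))%C).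
  { apply is_dt_cdt; intros s xi; eapply isD_val; [apply HD | unfold w1; ring]. }
  rewrite E, Fourier_plus, Fourier_plus, (Fourier_scal c), (Fourier_scal (fun t => - (1) * q t)%C), Fourier_inversion.
  - field; apply inversion_constant_neq_0.
  - easy.
  - easy.
  - easy.
  - now apply (Mul_Sch (fun t _ => c t)).
  - apply (Mul_Sch (fun t _ => - (1) * q t)%C); [now apply smT_scal | easy].
  - now apply Sch_Fourier.
  - apply Sch_plus; [now apply (Mul_Sch (fun t _ => c t)) |].
    apply (Mul_Sch (fun t _ => - (1) * q t)%C); [now apply smT_scal | easy].
Qed.

(** * Periodic solutions of first-order equations *)

Definition psol (a g w : R -> C) : Prop :=
  (forall t, w (t + 2 * PI) = w t) /\ forall t, isD w t (g t - a t * w t)%C.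

Definition primitive (a : R -> C) (t : R) : C := CRI a 0 t.

Lemma isD_primitive a t : Ccontinuous a -> isD (primitive a) t (a t).
Proof. apply isD_CRI. Qed.

Lemma primitive_0 a : primitive a 0 = 0.
Proof. apply C_ext; unfold primitive, CRI; simpl; exact (RInt_point 0 _). Qed.

Lemma primitive_period a t :
  Ccontinuous a -> (forall s, a (s + 2 * PI) = a s) ->
  primitive a (t + 2 * PI) = (primitive a t + primitive a (2 * PI))%C.
Proof.
  intros Hc Hp.
  assert (E : (primitive a (t + 2 * PI) - primitive a t = primitive a (0 + 2 * PI) - primitive a 0)%C).
  { apply (isD_const_of_zero (fun s => primitive a (s + 2 * PI) - primitive a s)%C); intros s.
    eapply isD_val; [apply isD_minus; [apply (isD_translate (primitive a) a) |]; intros; now apply isD_primitive |].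
    rewrite Hp; ring. }
  rewrite Rplus_0_l, primitive_0 in E.
  transitivity ((primitive a (t + 2 * PI) - primitive a t) + primitive a t)%C; [ring | rewrite E; ring].
Qed.

Lemma isD_exp_primitive a t : Ccontinuous a -> isD (fun s => cexp (primitive a s)) t (a t * cexp (primitive a t))%C.
Proof. intros Ha; apply isD_cexp, isD_primitive, Ha. Qed.

(** Variation of constants. With [A] the primitive of [a], the initial value
    [h (2 PI) / (exp (A (2 PI)) - 1)] is the one that makes the solution return to itself after a
    period. *)
Definition psolution (a g : R -> C) (t : R) : C :=
  let h s := CRI (fun r => cexp (primitive a r) * g r)%C 0 s in
  (cexp (- primitive a t) * (h (2 * PI)%R / (cexp (primitive a (2 * PI)) - 1) + h t))%C.

Lemma psolution_spec a g :
  Ccontinuous a -> Ccontinuous g ->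
  (forall t, a (t + 2 * PI) = a t) -> (forall t, g (t + 2 * PI) = g t) ->
  cexp (primitive a (2 * PI)) <> 1 -> psol a g (psolution a g).
Proof.
  intros Ha Hg Pa Pg He.
  set (h := fun s => CRI (fun r => cexp (primitive a r) * g r)%C 0 s).
  set (w0 := (h (2 * PI)%R / (cexp (primitive a (2 * PI)) - 1))%C).
  assert (EP : forall t, psolution a g t = (cexp (- primitive a t) * (w0 + h t))%C) by reflexivity.
  assert (Hec : Ccontinuous (fun r => cexp (primitive a r))).
  { eapply isD_Ccontinuous; intros; now apply isD_exp_primitive. }
  assert (Hh : forall t, isD h t (cexp (primitive a t) * g t)%C).
  { intros t; apply isD_CRI, Ccontinuous_mult; auto. }
  assert (HD : forall t, isD (psolution a g) t (g t - a t * psolution a g t)%C).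
  { intros t; rewrite EP; apply isD_ext with (fun t => cexp (- primitive a t) * (w0 + h t))%C; [easy |].
    eapply isD_val.
    - apply isD_mult; [apply isD_cexp, isD_opp; now apply isD_primitive |].
      apply isD_plus; [apply isD_const | apply Hh].
    - simpl. rewrite Cplus_0_l, Cmult_assoc, (Cmult_comm (cexp (- _))), cexp_opp; ring. }
  split; [| easy].
  assert (E0 : psolution a g (0 + 2 * PI) = psolution a g 0).
  { rewrite Rplus_0_l, !EP.
    assert (h 0 = 0) as -> by (apply C_ext; unfold h, CRI; simpl; exact (RInt_point 0 _)).
    assert (h (2 * PI)%R = (w0 * (cexp (primitive a (2 * PI)) - 1))%C) as E.
    { unfold w0; field; intros E; apply He.
      transitivity ((cexp (primitive a (2 * PI)) - 1) + 1)%C; [ring | rewrite E; ring]. }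
    rewrite E, primitive_0.
    transitivity (w0 * (cexp (primitive a (2 * PI)) * cexp (- primitive a (2 * PI))))%C; [ring |].
    rewrite cexp_opp, <- (cexp_opp 0); rewrite cexp_0 at 1; ring. }
  (* The defect of periodicity solves the homogeneous equation and vanishes at 0, hence
     everywhere. *)
  set (z := fun t => (psolution a g (t + 2 * PI) - psolution a g t)%C).
  assert (Hz : forall t, (cexp (primitive a t) * z t = cexp (primitive a 0) * z 0)%C).
  { intros t; apply (isD_const_of_zero (fun t => cexp (primitive a t) * z t)%C); intros s.
    eapply isD_val.
    - apply isD_mult; [now apply isD_exp_primitive |].
      apply isD_minus; [apply (isD_translate _ _ _ HD) | apply HD].
    - rewrite Pa, Pg; unfold z; ring. }
  intros t; specialize (Hz t); unfold z at 2 in Hz; rewrite E0 in Hz.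
  assert (z t = 0).
  { replace (z t) with (cexp (- primitive a t) * (cexp (primitive a t) * z t))%C.
    - rewrite Hz; ring.
    - rewrite Cmult_assoc, (Cmult_comm (cexp (- _))), cexp_opp; ring. }
  transitivity (z t + psolution a g t)%C; [unfold z; ring | rewrite H; ring].
Qed.

Lemma deriv_upper (f df : R -> R) (a b k : R) :
  (forall x, is_derive f x (df x)) -> (forall x, df x <= k) -> a <= b -> f b - f a <= k * (b - a).
Proof.
  intros HD Hk Hab; destruct (MVT_gen f a b df) as [c [_ ->]].
  - intros; apply HD.
  - intros; apply continuity_pt_filterlim; exact (is_derive_continuous _ _ _ (HD x)).
  - apply Rmult_le_compat_r; [lra | apply Hk].
Qed.

(** With [A] the primitive of [a], the function [y = w exp A] satisfies [y' = g exp A], and its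
    increment over a period is [w exp A] times the multiplier minus 1. Since no formula for [w] is
    involved, the resulting bounds contain uniqueness and apply to differences of solutions. *)
Lemma psol_bound_core a g w G S t :
  Ccontinuous a -> (forall t, a (t + 2 * PI) = a t) -> psol a g w -> (forall t, Cmod (g t) <= G) ->
  (forall s, t <= s <= t + 2 * PI -> Cmod (cexp (primitive a s)) <= S) ->
  Cmod (w t) * Cmod (cexp (primitive a t)) * Cmod (cexp (primitive a (2 * PI)) - 1) <= 4 * PI * G * S.
Proof.
  intros Ha Pa [Pw HD] HG HS.
  set (y := fun s => (w s * cexp (primitive a s))%C).
  assert (E : (y (t + 2 * PI)%R - y t = w t * cexp (primitive a t) * (cexp (primitive a (2 * PI)) - 1))%C).
  { unfold y; rewrite Pw, primitive_period, cexp_plus by easy; ring. }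
  rewrite <- !Cmod_mult, <- E.
  replace (4 * PI * G * S) with (2 * (G * S) * Rabs (t + 2 * PI - t)).
  - apply (isD_Lipschitz y (fun s => g s * cexp (primitive a s))%C).
    + intros s _; eapply isD_val; [apply isD_mult; [apply HD | now apply isD_exp_primitive] | cbv beta; ring].
    + intros s Hs; rewrite Rmin_left, Rmax_right in Hs by (generalize PI_RGT_0; lra).
      rewrite Cmod_mult; apply Rmult_le_compat; auto using Cmod_ge_0.
  - rewrite Rabs_pos_eq by (generalize PI_RGT_0; lra); ring.
Qed.

Lemma exp_le (x y : R) : x <= y -> exp x <= exp y.
Proof. intros [H | ->]; [left; now apply exp_increasing | lra]. Qed.

(** [rho] is the scale of the multiplier: 1 when integrating forward, [|exp (A (2 PI))|] when
    integrating backward. It cancels between the gap and the growth of [exp A]. *)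
Lemma psol_bound a g w G k d rho t :
  Ccontinuous a -> (forall t, a (t + 2 * PI) = a t) -> psol a g w -> (forall t, Cmod (g t) <= G) ->
  0 < d -> 0 < rho -> rho * d <= Cmod (cexp (primitive a (2 * PI)) - 1) ->
  (forall s, t <= s <= t + 2 * PI ->
    Cmod (cexp (primitive a s)) <= Cmod (cexp (primitive a t)) * rho * exp (k * (2 * PI))) ->
  Cmod (w t) <= 4 * PI * exp (k * (2 * PI)) / d * G.
Proof.
  intros Ha Pa Hs HG Hd Hrho Hdl HE.
  assert (H := psol_bound_core a g w G _ t Ha Pa Hs HG HE).
  assert (He : 0 < Cmod (cexp (primitive a t))) by (rewrite Cmod_cexp; apply exp_pos).
  set (e := Cmod (cexp (primitive a t))) in *.
  assert (Hw : 0 <= Cmod (w t) * e) by (apply Rmult_le_pos; [apply Cmod_ge_0 | lra]).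
  assert (H2 : Cmod (w t) * d <= 4 * PI * G * exp (k * (2 * PI))).
  { apply Rmult_le_reg_l with (e * rho); [now apply Rmult_lt_0_compat |].
    assert (Cmod (w t) * e * (rho * d) <= Cmod (w t) * e * Cmod (cexp (primitive a (2 * PI)) - 1))
      by now apply Rmult_le_compat_l.
    lra. }
  apply Rle_div_r in H2; [| easy]. eapply Rle_trans; [exact H2 |]. right; field; lra.
Qed.

Lemma psol_bound_forward a g w G k d :
  Ccontinuous a -> (forall t, a (t + 2 * PI) = a t) -> psol a g w -> (forall t, Cmod (g t) <= G) ->
  0 <= k -> (forall t, Re (a t) <= k) -> 0 < d -> d <= Cmod (cexp (primitive a (2 * PI)) - 1) ->
  forall t, Cmod (w t) <= 4 * PI * exp (k * (2 * PI)) / d * G.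
Proof.
  intros Ha Pa Hs HG Hk Hre Hd Hdl t.
  apply (psol_bound a g w G k d 1); auto; [lra | lra |].
  intros s Hst; rewrite Rmult_1_r, !Cmod_cexp, <- exp_plus; apply exp_le.
  assert (Re (primitive a s) - Re (primitive a t) <= k * (s - t)).
  { apply (deriv_upper (fun s => Re (primitive a s)) (fun s => Re (a s))); auto; [| lra].
    intros x; apply (isD_primitive a x Ha). }
  assert (k * (s - t) <= k * (2 * PI)) by (apply Rmult_le_compat_l; lra). lra.
Qed.

(** [exp A] is compared with its value at the right end [t + 2 PI], which is the value at [t] times
    the multiplier; the relevant gap is that of the inverse multiplier. *)
Lemma psol_bound_backward a g w G k d :
  Ccontinuous a -> (forall t, a (t + 2 * PI) = a t) -> psol a g w -> (forall t, Cmod (g t) <= G) ->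
  0 <= k -> (forall t, - k <= Re (a t)) -> 0 < d -> d <= Cmod (cexp (- primitive a (2 * PI)) - 1) ->
  forall t, Cmod (w t) <= 4 * PI * exp (k * (2 * PI)) / d * G.
Proof.
  intros Ha Pa Hs HG Hk Hre Hd Hdl t.
  assert (Hrho : 0 < Cmod (cexp (primitive a (2 * PI)))) by (rewrite Cmod_cexp; apply exp_pos).
  apply (psol_bound a g w G k d (Cmod (cexp (primitive a (2 * PI))))); auto.
  - replace (cexp (primitive a (2 * PI)) - 1)%C
      with (- (cexp (primitive a (2 * PI)) * (cexp (- primitive a (2 * PI)) - 1)))%C.
    + rewrite Cmod_opp, Cmod_mult; apply Rmult_le_compat_l; lra.
    + transitivity (cexp (primitive a (2 * PI)) - cexp (primitive a (2 * PI)) * cexp (- primitive a (2 * PI)))%C; [ring |].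
      rewrite cexp_opp; ring.
  - intros s Hst; rewrite <- Cmod_mult, <- cexp_plus, <- primitive_period, !Cmod_cexp, <- exp_plus by easy.
    apply exp_le.
    assert (- Re (primitive a (t + 2 * PI)) - - Re (primitive a s) <= k * (t + 2 * PI - s)).
    { apply (deriv_upper (fun s => - Re (primitive a s)) (fun s => - Re (a s))); [| | lra].
      - intros x; apply is_derive_Ropp, (isD_primitive a x Ha).
      - intros x; specialize (Hre x); lra. }
    assert (k * (t + 2 * PI - s) <= k * (2 * PI)) by (apply Rmult_le_compat_l; lra). lra.
Qed.

Lemma Cmod_cexp_minus_1 (z : C) : Rabs (exp (Re z) - 1) <= Cmod (cexp z - 1).
Proof.
  rewrite <- Cmod_cexp, <- Cmod_1 at 1.
  apply Rabs_le; split.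
  - assert (Cmod 1 <= Cmod (cexp z) + Cmod (cexp z - 1)); [| lra].
    replace (RtoC 1) with (cexp z + - (cexp z - 1))%C at 1 by ring.
    eapply Rle_trans; [apply Cmod_triangle | rewrite Cmod_opp; lra].
  - assert (Cmod (cexp z) <= Cmod (cexp z - 1) + Cmod 1); [| lra].
    replace (cexp z) with ((cexp z - 1) + 1)%C at 1 by ring. apply Cmod_triangle.
Qed.

Lemma exp_ge_2 : 2 <= exp 1.
Proof. generalize (exp_ineq1_le 1); lra. Qed.

(** If [b = 0] the modulus is constant. Either it differs from 1, or the exponent is purely
    imaginary; in that case [r <> 0] would make it pass through 0, so it is a single point. If
    [b <> 0], the modulus is at least [e] or at most [1 / e] outside the compact range
    [|b xi + g| <= 1], where a minimum is attained. *)
Lemma cexp_line_gap (b g r s : R) :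
  (forall xi : R, cexp (b * xi + g, r * xi + s) <> 1) ->
  exists d, 0 < d /\ forall xi : R, d <= Cmod (cexp (b * xi + g, r * xi + s) - 1).
Proof.
  intros H.
  assert (Hpos : forall xi : R, 0 < Cmod (cexp ((b * xi + g)%R, (r * xi + s)%R) - 1)).
  { intros xi; apply Cmod_gt_0; intros E; apply (H xi).
    transitivity ((cexp ((b * xi + g)%R, (r * xi + s)%R) - 1) + 1)%C; [ring | rewrite E; ring]. }
  destruct (Req_dec b 0) as [Hb | Hb].
  - destruct (Req_dec g 0) as [Hg | Hg].
    + destruct (Req_dec r 0) as [Hr | Hr].
      * exists (Cmod (cexp ((b * 0 + g)%R, (r * 0 + s)%R) - 1)); split; [apply Hpos |].
        intros xi; rewrite Hb, Hr, !Rmult_0_l; lra.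
      * exfalso; apply (H (- s / r)); rewrite <- cexp_0; f_equal.
        rewrite Hb, Hg; apply C_ext; simpl; [ring | field; easy].
    + exists (Rabs (exp g - 1)); split.
      * apply Rabs_pos_lt; intros E; apply Hg, exp_inv; rewrite exp_0; lra.
      * intros xi; eapply Rle_trans; [| apply Cmod_cexp_minus_1]; simpl.
        rewrite Hb, Rmult_0_l, Rplus_0_l; lra.
  (* The squared distance to 1 in terms of the real part [u = b xi + g], whose critical range is
     [[-1, 1]]. *)
  - set (F := fun u => (exp u * cos (r * ((u - g) / b) + s) - 1) ^ 2 + (exp u * sin (r * ((u - g) / b) + s)) ^ 2).
    assert (HF : forall u, F u = Cmod (cexp ((b * ((u - g) / b) + g)%R, (r * ((u - g) / b) + s)%R) - 1) ^ 2).
    { intros u; rewrite Cmod2_alt; unfold F, cexp, Re, Im; simpl.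
      replace (b * ((u - g) / b) + g) with u by (field; easy); ring. }
    destruct (continuity_ab_min F (-1) 1) as [m [Hm _]]; [lra | |].
    { intros u _; apply continuity_pt_filterlim; refine (ex_derive_continuous F u _).
      unfold F; auto_derive; easy. }
    exists (Rmin (1 / 2) (Cmod (cexp ((b * ((m - g) / b) + g)%R, (r * ((m - g) / b) + s)%R) - 1))).
    split; [apply Rmin_pos; [lra | apply Hpos] |].
    intros xi.
    destruct (Rle_dec (-1) (b * xi + g)) as [h1 | h1]; [destruct (Rle_dec (b * xi + g) 1) as [h2 | h2] |].
    + eapply Rle_trans; [apply Rmin_r |].
      specialize (Hm (b * xi + g) (conj h1 h2)); rewrite !HF in Hm.
      replace ((b * xi + g - g) / b) with xi in Hm by (field; easy).
      apply Rsqr_incr_0; [rewrite !Rsqr_pow2; exact Hm | apply Cmod_ge_0 | apply Cmod_ge_0].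
    + eapply Rle_trans; [apply Rmin_l |]; eapply Rle_trans; [| apply Cmod_cexp_minus_1]; simpl.
      assert (exp 1 <= exp (b * xi + g)) by (apply exp_le; lra).
      generalize exp_ge_2; intros; rewrite Rabs_pos_eq; lra.
    + eapply Rle_trans; [apply Rmin_l |]; eapply Rle_trans; [| apply Cmod_cexp_minus_1]; simpl.
      assert (exp (b * xi + g) <= exp (- (1))) by (apply exp_le; lra).
      assert (exp (- (1)) <= 1 / 2).
      { rewrite exp_Ropp; replace (1 / 2) with (/ 2) by field. apply Rinv_le_contravar; [lra | apply exp_ge_2]. }
      rewrite Rabs_left1; lra.
Qed.

Lemma cexp_eq_1 (z : C) : cexp z = 1 -> exists k : Z, z = (0, 2 * PI * IZR k).
Proof.
  intros H.
  assert (Hre : Re z = 0).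
  { apply exp_inv; rewrite exp_0, <- Cmod_cexp, H; apply Cmod_1. }
  assert (Hc : cos (Im z) = 1).
  { apply (f_equal fst) in H; unfold cexp in H; simpl in H; rewrite Hre, exp_0 in H; lra. }
  assert (Hs : sin (Im z / 2) = 0).
  { replace (Im z) with (2 * (Im z / 2)) in Hc by field; rewrite cos_2a_sin in Hc; nra. }
  apply sin_eq_0_0 in Hs; destruct Hs as [k Hk]; exists k.
  apply C_ext; simpl; [easy | lra].
Qed.

(** * Sufficiency *)

(* The periodic problem comes with sup bounds at fixed [xi] only; decay together with a Lipschitz bound in
   [xi] is the regularity that such bounds propagate from [g] to [w]. *)
Definition Lipdecay (g : R -> R -> C) : Prop :=
  periodic2 g /\ (forall xi, Ccontinuous (fun t => g t xi)) /\
  forall k : nat, exists M, 0 <= M /\ (forall t xi : R, Cmod (RtoC (xi ^ k) * g t xi) <= M) /\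
    forall t xi eta : R, Cmod (RtoC (xi ^ k) * g t xi - RtoC (eta ^ k) * g t eta) <= M * Rabs (xi - eta).

Lemma Lipdecay_plus f g : Lipdecay f -> Lipdecay g -> Lipdecay (fun t x => f t x + g t x)%C.
Proof.
  intros [Pf [Cf Hf]] [Pg [Cg Hg]]; split; [now apply periodic2_plus |]; split.
  { intros xi; apply Ccontinuous_plus; auto. }
  intros k; destruct (Hf k) as [M [HM0 [HM HM1]]], (Hg k) as [N [HN0 [HN HN1]]]; exists (M + N); split; [lra |]; split.
  - intros t xi; rewrite Cmult_plus_distr_l.
    eapply Rle_trans; [apply Cmod_triangle | now apply Rplus_le_compat].
  - intros t xi eta.
    replace (RtoC (xi ^ k) * (f t xi + g t xi) - RtoC (eta ^ k) * (f t eta + g t eta))%C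
      with ((RtoC (xi ^ k) * f t xi - RtoC (eta ^ k) * f t eta) + (RtoC (xi ^ k) * g t xi - RtoC (eta ^ k) * g t eta))%C by ring.
    eapply Rle_trans; [apply Cmod_triangle |]; rewrite Rmult_plus_distr_r; now apply Rplus_le_compat.
Qed.

Lemma Lipdecay_x f : Lipdecay f -> Lipdecay (fun t x => x * f t x)%C.
Proof.
  intros [Pf [Cf Hf]]; split; [intros t x; now rewrite Pf |]; split.
  { intros xi; apply Ccontinuous_mult; [apply Ccontinuous_const | auto]. }
  intros k; destruct (Hf (S k)) as [M [HM0 [HM HM1]]]; exists M; split; [easy |].
  assert (E : forall t xi : R, (RtoC (xi ^ k) * (xi * f t xi))%C = (RtoC (xi ^ S k) * f t xi)%C).
  { intros t xi; simpl; rewrite RtoC_mult; ring. }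
  split; intros; rewrite !E; auto.
Qed.

Definition tmult (m : R -> R -> C) : Prop := exists a, smT a /\ m = fun t _ => a t.

Lemma Lipdecay_tmult m f : tmult m -> Lipdecay f -> Lipdecay (fun t x => m t x * f t x)%C.
Proof.
  intros [a [Ha ->]] [Pf [Cf Hf]]; split; [intros t x; now rewrite Pf, (smT_periodic a Ha) |]; split.
  { intros xi; apply Ccontinuous_mult; [now apply smT_continuous | auto]. }
  destruct (smT_bounded a Ha) as [A HA].
  assert (HA0 : 0 <= A) by (eapply Rle_trans; [apply Cmod_ge_0 | apply (HA 0)]).
  intros k; destruct (Hf k) as [M [HM0 [HM HM1]]]; exists (A * M); split; [now apply Rmult_le_pos |]; split.
  - intros t xi; replace (RtoC (xi ^ k) * (a t * f t xi))%C with (a t * (RtoC (xi ^ k) * f t xi))%C by ring.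
    rewrite Cmod_mult; apply Rmult_le_compat; auto using Cmod_ge_0.
  - intros t xi eta.
    replace (RtoC (xi ^ k) * (a t * f t xi) - RtoC (eta ^ k) * (a t * f t eta))%C
      with (a t * (RtoC (xi ^ k) * f t xi - RtoC (eta ^ k) * f t eta))%C by ring.
    rewrite Cmod_mult, Rmult_assoc; apply Rmult_le_compat; auto using Cmod_ge_0.
Qed.

Lemma Reg_Lipdecay_t a n f : smT a -> Reg Lipdecay n f -> Reg Lipdecay n (fun t x => a t * f t x)%C.
Proof.
  intros Ha; apply (Reg_mult tmult Lipdecay Lipdecay_plus Lipdecay_tmult n (fun t _ => a t)).
  clear f; revert a Ha; induction n as [| n IHn]; intros a Ha; [now exists a |].
  destruct (smT_deriv a Ha) as [a' [Ha' HD]].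
  apply Reg_intro with (fun t _ => a' t) (fun _ _ => 0); [now exists a | | | now apply IHn | apply IHn, smT_const].
  - intros t x; apply HD.
  - intros t x; apply isD_const.
Qed.

Lemma Reg_decaying_pow k n f : Reg decaying2 n f -> Reg decaying2 n (fun t x => RtoC (x ^ k) * f t x)%C.
Proof.
  intros H; induction k.
  - replace (fun t x => RtoC (x ^ 0) * f t x)%C with f; [easy | apply funext2; intros; simpl; ring].
  - replace (fun t x => RtoC (x ^ S k) * f t x)%C with (fun t x : R => x * (RtoC (x ^ k) * f t x))%C.
    + now apply Reg_decaying_x.
    + apply funext2; intros; simpl; rewrite RtoC_mult; ring.
Qed.

Lemma Sch_Lipdecay f : Sch f -> Lipdecay f.
Proof.
  intros Hf; split; [apply (Hf O) | split].
  - intros xi; eapply isD_Ccontinuous; intros t; apply (Sch_is_dt f Hf t xi).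
  - intros k; destruct (proj2 (Hf O) k) as [M HM].
    destruct (Reg_bounded_Lipschitz _ (Reg_decaying_bounded _ _ (Reg_decaying_pow k 1 f (Hf 1%nat)))) as [N [HN0 HN]].
    assert (HM0 : 0 <= M) by (eapply Rle_trans; [apply Cmod_ge_0 | apply (HM 0 0)]).
    exists (M + N); split; [lra |]; split.
    + intros t xi; specialize (HM t xi); lra.
    + intros t xi eta; specialize (HN t eta t xi); simpl in HN.
      rewrite Rminus_diag, Rabs_R0, Rplus_0_l in HN.
      generalize (Rabs_pos (xi - eta)); nra.
Qed.

Lemma Sch_Reg_Lipdecay n f : Sch f -> Reg Lipdecay n f.
Proof.
  revert f; induction n; intros f Hf; [now apply Sch_Lipdecay |].
  eapply Reg_intro; [now apply Sch_Lipdecay | now apply Sch_is_dt | now apply Sch_is_dx | |]; apply IHn.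
  - now apply Sch_cdt.
  - now apply Sch_cdx.
Qed.

Definition symb (c q : R -> C) (xi t : R) : C := (Ci * c t * xi + q t)%C.

Definition uniform_bound (c q : R -> C) (K : R) : Prop :=
  forall xi g w G, psol (symb c q xi) g w -> (forall t, Cmod (g t) <= G) -> forall t, Cmod (w t) <= K * G.

Definition nonresonant (c q : R -> C) : Prop :=
  forall xi, cexp (primitive (symb c q xi) (2 * PI)) <> 1.

Lemma symb_continuous c q xi : Ccontinuous c -> Ccontinuous q -> Ccontinuous (symb c q xi).
Proof.
  intros Hc Hq; unfold symb.
  apply (Ccontinuous_plus (fun t => Ci * c t * xi)%C q); [| easy].
  apply (Ccontinuous_mult (fun t => Ci * c t)%C (fun _ => RtoC xi)); [| apply Ccontinuous_const].
  apply (Ccontinuous_mult (fun _ => Ci) c); [apply Ccontinuous_const | easy].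
Qed.

Definition psolves (c q : R -> C) (g w : R -> R -> C) : Prop :=
  forall xi, psol (symb c q xi) (fun t => g t xi) (fun t => w t xi).

(** Multiplication by [xi^k] commutes with the equation at fixed [xi]. Solutions at [xi] and [eta]
    are compared in the equation at [xi]: the change of coefficient moves to the right-hand side as
    [i c (eta - xi)] times the weighted solution at [eta], which is already bounded. *)
Lemma psolves_Lipdecay c q K g w :
  smT c -> uniform_bound c q K -> psolves c q g w -> Lipdecay g -> Lipdecay w.
Proof.
  intros Hc HK Hw [Pg [Cg Hg]].
  destruct (smT_bounded c Hc) as [A HA].
  assert (HA0 : 0 <= A) by (eapply Rle_trans; [apply Cmod_ge_0 | apply (HA 0)]).
  assert (Hpow : forall k xi, psol (symb c q xi) (fun t => RtoC (xi ^ k) * g t xi)%C (fun t => RtoC (xi ^ k) * w t xi)%C).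
  { intros k xi; destruct (Hw xi) as [Pw HD]; split; [intros t; now rewrite Pw |].
    intros t; eapply isD_val; [apply isD_scal, HD | ring]. }
  split; [intros t xi; apply (Hw xi) |]; split.
  { intros xi; eapply isD_Ccontinuous; apply (Hw xi). }
  intros k; destruct (Hg k) as [M [HM0 [HM HM1]]].
  assert (Hb : forall t xi : R, Cmod (RtoC (xi ^ k) * w t xi) <= K * M).
  { intros t xi; refine (HK xi _ _ M (Hpow k xi) _ t); intros; apply HM. }
  assert (HKM : 0 <= K * M) by (eapply Rle_trans; [apply Cmod_ge_0 | apply (Hb 0 0)]).
  assert (HL : forall t xi eta : R, Cmod (RtoC (xi ^ k) * w t xi - RtoC (eta ^ k) * w t eta) <= K * ((M + A * (K * M)) * Rabs (xi - eta))).
  { intros t xi eta.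
    refine (HK xi (fun t => (RtoC (xi ^ k) * g t xi - RtoC (eta ^ k) * g t eta) + Ci * c t * (eta - xi)%R * (RtoC (eta ^ k) * w t eta))%C
      (fun t => RtoC (xi ^ k) * w t xi - RtoC (eta ^ k) * w t eta)%C _ _ _ t).
    - split.
      + intros s; now rewrite (proj1 (Hw xi)), (proj1 (Hw eta)).
      + intros s; eapply isD_val; [apply isD_minus; [apply (Hpow k xi) | apply (Hpow k eta)] |].
        unfold symb; rewrite RtoC_minus; ring.
    - intros s; eapply Rle_trans; [apply Cmod_triangle |]; rewrite Rmult_plus_distr_r.
      apply Rplus_le_compat; [apply HM1 |].
      rewrite (Cmod_mult (Ci * c s * (eta - xi)%R)), (Cmod_mult (Ci * c s)), (Cmod_mult Ci), Cmod_Ci, Rmult_1_l, Cmod_R.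
      rewrite (Rabs_minus_sym xi eta).
      replace (A * (K * M) * Rabs (eta - xi)) with (A * Rabs (eta - xi) * (K * M)) by ring.
      apply Rmult_le_compat; auto using Cmod_ge_0.
      * apply Rmult_le_pos; [apply Cmod_ge_0 | apply Rabs_pos].
      * apply Rmult_le_compat_r; [apply Rabs_pos | apply HA]. }
  exists (Rmax (K * M) (K * (M + A * (K * M)))); split; [eapply Rle_trans; [exact HKM | apply Rmax_l] |]; split.
  - intros t xi; eapply Rle_trans; [apply Hb | apply Rmax_l].
  - intros t xi eta; eapply Rle_trans; [apply HL |]; rewrite <- Rmult_assoc.
    apply Rmult_le_compat_r; [apply Rabs_pos | apply Rmax_r].
Qed.

(** The candidate [w1] solves the equation differentiated in [xi]. The Taylor remainder of [w]
    solves the equation at [xi] with a right-hand side of order [(eta - xi)^2], one part from the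
    remainder of [g], the other from the Lipschitz bound on [w]; the uniform bound hands this order
    on to the remainder. *)
Lemma psolves_is_dx c q K g g1 w w1 :
  smT c -> uniform_bound c q K -> psolves c q g w -> Lipdecay w ->
  is_dx g g1 -> Lipdecay g1 ->
  psolves c q (fun t xi => g1 t xi + - (Ci * c t) * w t xi)%C w1 -> is_dx w w1.
Proof.
  intros Hc HK Hw [_ [_ Lw]] Hg1 [_ [_ L1]] Hw1 t xi.
  destruct (smT_bounded c Hc) as [A HA].
  destruct (Lw O) as [W [HW0 [_ HW]]], (L1 O) as [M [HM0 [_ HM]]]; simpl in HW, HM.
  apply isD_of_quad with (K * (2 * M + A * W)); intros eta _.
  rewrite Rmult_assoc.
  refine (HK xi (fun s => (g s eta - g s xi - (eta - xi)%R * g1 s xi) + Ci * c s * (eta - xi)%R * (w s xi - w s eta))%C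
    (fun s => w s eta - w s xi - (eta - xi)%R * w1 s xi)%C _ _ _ t).
  - split.
    + intros s; now rewrite (proj1 (Hw xi)), (proj1 (Hw eta)), (proj1 (Hw1 xi)).
    + intros s; eapply isD_val.
      * apply isD_minus; [apply isD_minus; [apply (Hw eta) | apply (Hw xi)] | apply isD_scal, (Hw1 xi)].
      * unfold symb; rewrite RtoC_minus; ring.
  - intros s; eapply Rle_trans; [apply Cmod_triangle |]; rewrite Rmult_plus_distr_r.
    apply Rplus_le_compat.
    + apply (isD_Taylor (g s) (g1 s) xi M); [apply Hg1 |].
      intros y; specialize (HM s y xi); now rewrite !Cmult_1_l in HM.
    + rewrite !Cmod_mult, Cmod_Ci, Rmult_1_l, Cmod_R, <- (pow2_abs (eta - xi)).
      specialize (HW s xi eta); rewrite !Cmult_1_l, Rabs_minus_sym in HW.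
      replace (A * W * Rabs (eta - xi) ^ 2) with (A * Rabs (eta - xi) * (W * Rabs (eta - xi))) by ring.
      apply Rmult_le_compat; auto using Cmod_ge_0.
      * apply Rmult_le_pos; [apply Cmod_ge_0 | apply Rabs_pos].
      * apply Rmult_le_compat_r; [apply Rabs_pos | apply HA].
Qed.

Lemma symb_periodic c q xi t : smT c -> smT q -> symb c q xi (t + 2 * PI) = symb c q xi t.
Proof. intros Hc Hq; unfold symb; now rewrite (smT_periodic c Hc), (smT_periodic q Hq). Qed.

Lemma psolves_exists c q g :
  smT c -> smT q -> nonresonant c q -> Lipdecay g ->
  psolves c q g (fun t xi => psolution (symb c q xi) (fun t => g t xi) t).
Proof.
  intros Hc Hq Hn [Pg [Cg _]] xi; apply psolution_spec; auto.
  - apply symb_continuous; now apply smT_continuous.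
  - intros t; now apply symb_periodic.
Qed.

(** The [t]-derivative is read off the equation, its factor [xi] being absorbed by the decay. The
    [xi]-derivative is again a periodic solution, with right-hand side [d_xi g - i c w], so the
    induction runs over all pairs [g], [w]. *)
Lemma Reg_Lipdecay_psolves c q K :
  smT c -> smT q -> nonresonant c q -> uniform_bound c q K ->
  forall n g w, Reg Lipdecay n g -> psolves c q g w -> Reg Lipdecay n w.
Proof.
  intros Hc Hq Hn HK n; induction n; intros g w Hg Hw.
  { exact (psolves_Lipdecay c q K g w Hc HK Hw Hg). }
  assert (Hw0 := psolves_Lipdecay c q K g w Hc HK Hw (Reg_base _ _ _ Hg)).
  assert (Hwn : Reg Lipdecay n w) by (apply (IHn g); [now apply Reg_S | easy]).
  set (h := (fun t xi => cdx g t xi + - (Ci * c t) * w t xi)%C).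
  assert (Hct : forall z f, Reg Lipdecay n f -> Reg Lipdecay n (fun t x => z * c t * f t x)%C).
  { intros z f; exact (Reg_Lipdecay_t _ n f (smT_scal z c Hc)). }
  assert (Hh : Reg Lipdecay n h).
  { apply Reg_plus; [exact Lipdecay_plus | now apply Reg_cdx |].
    replace (fun t x => - (Ci * c t) * w t x)%C with (fun t x => (- Ci) * c t * w t x)%C
      by (apply funext2; intros; ring).
    now apply Hct. }
  assert (Hw1 := psolves_exists c q h Hc Hq Hn (Reg_base _ _ _ Hh)).
  set (w1 := fun t xi => psolution (symb c q xi) (fun t => h t xi) t) in *.
  apply Reg_intro with (fun t xi => g t xi + (- Ci * c t * (xi * w t xi) + - (1) * q t * w t xi))%C w1.
  - easy.
  - intros t xi; eapply isD_val; [apply (Hw xi) | unfold symb; ring].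
  - apply (psolves_is_dx c q K g (cdx g) w w1); auto.
    + eapply Reg_is_dx, Hg.
    + eapply Reg_base, Reg_cdx, Hg.
  - apply Reg_plus; [exact Lipdecay_plus | now apply Reg_S |].
    apply Reg_plus; [exact Lipdecay_plus | apply Hct; apply Reg_x; auto using Lipdecay_plus, Lipdecay_x |].
    exact (Reg_Lipdecay_t _ n w (smT_scal (- (1))%C q Hq) Hwn).
  - now apply (IHn h).
Qed.

Lemma Lipdecay_decaying2 g : Lipdecay g -> decaying2 g.
Proof. intros [Pg [_ H]]; split; [easy |]; intros k; destruct (H k) as [M [_ [HM _]]]; now exists M. Qed.

Lemma solvable_Sch c q K f :
  smT c -> smT q -> nonresonant c q -> uniform_bound c q K -> Sch f ->
  exists v, Sch v /\ LL c q v = f.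
Proof.
  intros Hc Hq Hn HK Hf.
  assert (HF := Sch_Fourier f Hf).
  assert (Hw := psolves_exists c q _ Hc Hq Hn (Sch_Lipdecay _ HF)).
  set (w := fun t xi => psolution (symb c q xi) (fun t => Fourier f t xi) t) in *.
  apply (solvable_of_Fourier_solvable c q f w); try easy.
  - intros n; apply (Reg_impl _ _ n w Lipdecay_decaying2).
    apply (Reg_Lipdecay_psolves c q K Hc Hq Hn HK n (Fourier f)); [now apply Sch_Reg_Lipdecay | easy].
  - intros t xi; exact (proj2 (Hw xi) t).
Qed.

Lemma CRI_linear_symb c q xi b :
  Ccontinuous c -> Ccontinuous q -> primitive (symb c q xi) b = (Ci * xi * primitive c b + primitive q b)%C.
Proof.
  intros Hc Hq; unfold primitive, symb.
  rewrite <- CRI_scal by easy.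
  rewrite <- CRI_plus; [| apply Ccontinuous_mult; [apply Ccontinuous_const | easy] | easy].
  f_equal; apply functional_extensionality; intros; ring.
Qed.

Lemma mean_primitive c : primitive c (2 * PI) = (RtoC (2 * PI) * mean c)%C.
Proof.
  apply C_ext; unfold primitive, CRI, mean, Re, Im; simpl; gen_RInt; field; generalize PI_RGT_0; lra.
Qed.

Lemma primitive_symb_mean c q xi :
  Ccontinuous c -> Ccontinuous q ->
  primitive (symb c q xi) (2 * PI) = (RtoC (2 * PI) * (Ci * xi * mean c + mean q))%C.
Proof. intros; rewrite CRI_linear_symb, !mean_primitive by easy; ring. Qed.

(** [k + c_0 xi - i q_0 = 0] is the same as [i c_0 xi + q_0 = - i k]: a multiplier equal to 1 at
    [xi] yields a point of [Z_L0] with the opposite integer. *)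
Lemma nonresonant_of_Z c q :
  Ccontinuous c -> Ccontinuous q -> (forall p, ~ Z_L0 c q p) -> nonresonant c q.
Proof.
  intros Hc Hq HZ xi E; rewrite primitive_symb_mean in E by easy.
  apply cexp_eq_1 in E; destruct E as [k Ek].
  assert (E : (Ci * xi * mean c + mean q)%C = (0, IZR k)).
  { assert (HP : RtoC (2 * PI) <> 0) by (intros E; injection E; generalize PI_RGT_0; lra).
    transitivity (/ RtoC (2 * PI) * (RtoC (2 * PI) * (Ci * xi * mean c + mean q)))%C; [field; easy |].
    rewrite Ek; transitivity (/ RtoC (2 * PI) * (RtoC (2 * PI) * (0, IZR k)))%C; [| field; easy].
    f_equal; apply C_ext; unfold Re, Im; simpl; ring. }
  apply (HZ ((- k)%Z, xi)); unfold Z_L0; simpl.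
  transitivity (RtoC (IZR (- k)) + - Ci * (Ci * xi * mean c + mean q))%C.
  - transitivity (RtoC (IZR (- k)) + - (Ci * Ci) * xi * mean c - Ci * mean q)%C; [| ring].
    replace (- (Ci * Ci))%C with (RtoC 1) by (apply C_ext; unfold Re, Im; simpl; ring); ring.
  - rewrite E, opp_IZR; apply C_ext; unfold Re, Im; simpl; ring.
Qed.

(** The real part of the symbol is [Re q - xi Im c]. For each [xi] the sign of [xi Im c] is constant
    in [t] and selects the forward or the backward estimate. Their gaps differ, whence two
    constants, which are added. *)
Lemma uniform_bound_exists c q :
  smT c -> smT q -> nonresonant c q ->
  ((forall t, 0 <= Im (c t)) \/ (forall t, Im (c t) <= 0)) -> exists K, uniform_bound c q K.
Proof.
  intros Hc Hq Hn Hb.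
  assert (Cc := smT_continuous c Hc); assert (Cq := smT_continuous q Hq).
  destruct (smT_bounded q Hq) as [k Hk].
  assert (Hk0 : 0 <= k) by (eapply Rle_trans; [apply Cmod_ge_0 | apply (Hk 0)]).
  set (C2 := primitive c (2 * PI)); set (Q2 := primitive q (2 * PI)).
  assert (E : forall xi, primitive (symb c q xi) (2 * PI) = (- Im C2 * xi + Re Q2, Re C2 * xi + Im Q2)).
  { intros xi; rewrite CRI_linear_symb by easy; fold C2 Q2; apply C_ext; unfold Re, Im; simpl; ring. }
  destruct (cexp_line_gap (- Im C2) (Re Q2) (Re C2) (Im Q2)) as [d [Hd Hd1]].
  { intros xi; rewrite <- E; apply Hn. }
  assert (E' : forall xi, (- primitive (symb c q xi) (2 * PI))%C = (Im C2 * xi + - Re Q2, - Re C2 * xi + - Im Q2)).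
  { intros xi; rewrite E; apply C_ext; unfold Re, Im; simpl; ring. }
  destruct (cexp_line_gap (Im C2) (- Re Q2) (- Re C2) (- Im Q2)) as [d' [Hd' Hd1']].
  { intros xi; rewrite <- E'; intros E1; apply (Hn xi).
    rewrite <- (cexp_opp (primitive (symb c q xi) (2 * PI))), E1; ring. }
  set (L := 4 * PI * exp (k * (2 * PI))).
  assert (HL : 0 < L) by (unfold L; generalize PI_RGT_0 (exp_pos (k * (2 * PI))); nra).
  assert (Hre : forall xi t, Rabs (Re (symb c q xi t) + Im (c t) * xi) <= k).
  { intros xi t; replace (Re (symb c q xi t) + Im (c t) * xi) with (Re (q t)) by (unfold symb, Re, Im; simpl; ring).
    eapply Rle_trans; [apply re_le_Cmod | apply Hk]. }
  exists (L / d + L / d'); intros xi g w G Hw HG t.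
  assert (HG0 : 0 <= G) by (eapply Rle_trans; [apply Cmod_ge_0 | apply (HG 0)]).
  assert (0 <= L / d * G) by (apply Rmult_le_pos; [left; now apply Rdiv_lt_0_compat | easy]).
  assert (0 <= L / d' * G) by (apply Rmult_le_pos; [left; now apply Rdiv_lt_0_compat | easy]).
  assert (Cs : Ccontinuous (symb c q xi)) by now apply symb_continuous.
  assert (Ps : forall t, symb c q xi (t + 2 * PI) = symb c q xi t) by (intros; now apply symb_periodic).
  assert (Hcase : (forall t, 0 <= Im (c t) * xi) \/ (forall t, Im (c t) * xi <= 0)).
  { destruct Hb as [Hb | Hb], (Rle_dec 0 xi) as [h | h]; [left | right | right | left]; intros s; specialize (Hb s); nra. }
  rewrite Rmult_plus_distr_r; destruct Hcase as [Hs | Hs].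
  - assert (Cmod (w t) <= L / d * G); [| lra].
    apply (psol_bound_forward (symb c q xi) g w G k d); auto.
    + intros s; specialize (Hre xi s); specialize (Hs s); apply Rabs_le_between in Hre; lra.
    + rewrite E; apply Hd1.
  - assert (Cmod (w t) <= L / d' * G); [| lra].
    apply (psol_bound_backward (symb c q xi) g w G k d'); auto.
    + intros s; specialize (Hre xi s); specialize (Hs s); apply Rabs_le_between in Hre; lra.
    + rewrite E'; apply Hd1'.
Qed.

Lemma solvable_of_Z c q f :
  smT c -> smT q -> (forall p, ~ Z_L0 c q p) ->
  ((forall t, 0 <= Im (c t)) \/ (forall t, Im (c t) <= 0)) ->
  Sch f -> exists v, Sch v /\ LL c q v = f.
Proof.
  intros Hc Hq HZ Hb Hf.
  assert (Hn : nonresonant c q) by (apply nonresonant_of_Z; auto using smT_continuous).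
  destruct (uniform_bound_exists c q Hc Hq Hn Hb) as [K HK].
  eapply solvable_Sch; eassumption.
Qed.

Lemma Z_L0_opp c q : Ccontinuous q -> (forall p, ~ Z_L0 c q p) -> forall p, ~ Z_L0 c (fun t => - (1) * q t)%C p.
Proof.
  intros Cq HZ [k xi] E; apply (HZ ((- k)%Z, - xi)); unfold Z_L0 in *; simpl in *.
  assert (Em : mean (fun t => - (1) * q t)%C = (- mean q)%C).
  { assert (HP : RtoC (2 * PI) <> 0) by (intros E0; injection E0; generalize PI_RGT_0; lra).
    transitivity (/ RtoC (2 * PI) * (RtoC (2 * PI) * mean (fun t => - (1) * q t)))%C; [field; easy |].
    rewrite <- mean_primitive; unfold primitive; rewrite CRI_scal by easy.
    fold (primitive q (2 * PI)); rewrite mean_primitive; field; easy. }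
  rewrite Em in E; rewrite opp_IZR, !RtoC_opp.
  transitivity (- (RtoC (IZR k) + mean c * xi - Ci * - mean q))%C; [ring | rewrite E; ring].
Qed.

Lemma sufficiency c q :
  smT c -> smT q -> (forall p, ~ Z_L0 c q p) ->
  ((forall t, 0 <= Im (c t)) \/ (forall t, Im (c t) <= 0)) -> Schwartz_GH c q.
Proof.
  intros Hc Hq HZ Hb; apply GH_of_solvable; try easy.
  - intros f Hf; now apply solvable_of_Z.
  - intros psi Hpsi.
    (* [tL phi = psi] reads [L phi = - psi] with [- q] in place of [q], and this replacement
       reflects the resonance set through the origin. *)
    destruct (solvable_of_Z c (fun t => - (1) * q t)%C (fun t x => - (1) * psi t x)%C) as [phi [Hphi E]];
      auto using smT_scal, Z_L0_opp, Sch_scal, smT_continuous.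
    exists phi; split; [easy |]; apply funext2; intros t x.
    assert (E1 := f_equal (fun g => g t x) E); simpl in E1; unfold LL in E1; unfold Lt.
    transitivity (- (cdt phi t x + c t * cdx phi t x + - (1) * q t * phi t x))%C; [ring | rewrite E1; ring].
Qed.

(** * Test functions and the resonant case *)

Lemma cos_add_2PI x : cos (x + 2 * PI) = cos x.
Proof. rewrite cos_plus, cos_2PI, sin_2PI; ring. Qed.

Lemma sin_add_2PI x : sin (x + 2 * PI) = sin x.
Proof. rewrite sin_plus, cos_2PI, sin_2PI; ring. Qed.

(** The derivative of each member is a combination of two others, so smoothness of the bumps is an
    induction generalised over [n]. *)
Definition flat (n : nat) (y : R) : R := if Rle_dec y 0 then 0 else (/ y) ^ n * exp (- / y).

Lemma flat_npos n y : y <= 0 -> flat n y = 0.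
Proof. intros H; unfold flat; now destruct (Rle_dec y 0). Qed.

Lemma flat_gt n y : 0 < y -> flat n y = (/ y) ^ n * exp (- / y).
Proof. intros H; unfold flat; destruct (Rle_dec y 0); [lra | easy]. Qed.

Lemma flat_pos n y : 0 < y -> 0 < flat n y.
Proof.
  intros H; rewrite flat_gt by easy; apply Rmult_lt_0_compat; [| apply exp_pos].
  now apply pow_lt, Rinv_0_lt_compat.
Qed.

Lemma flat_nonneg n y : 0 <= flat n y.
Proof.
  destruct (Rle_dec y 0); [rewrite flat_npos by easy; lra | left; apply flat_pos; lra].
Qed.

(** The quadratic bound is what yields the derivative 0 at the origin. *)
Lemma flat_quad n y : flat n y <= INR (S (S n)) ^ (S (S n)) * y ^ 2.
Proof.
  assert (H0 : 0 <= INR (S (S n)) ^ (S (S n))) by apply pow_le, pos_INR.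
  destruct (Rle_dec y 0) as [h | h].
  - rewrite flat_npos by easy; apply Rmult_le_pos; [easy | apply pow2_ge_0].
  - assert (Hy : 0 < y) by lra; rewrite flat_gt by easy.
    assert (Hi : 0 < / y) by now apply Rinv_0_lt_compat.
    generalize (pow_le_exp (S (S n)) (/ y) (Rlt_le _ _ Hi)); intros HE.
    replace ((/ y) ^ n) with ((/ y) ^ (S (S n)) * y ^ 2) by (simpl; field; lra).
    rewrite exp_Ropp.
    apply Rmult_le_reg_r with (exp (/ y)); [apply exp_pos |].
    replace ((/ y) ^ S (S n) * y ^ 2 * / exp (/ y) * exp (/ y)) with ((/ y) ^ S (S n) * y ^ 2).
    2: field; generalize (exp_pos (/ y)); lra.
    generalize (pow2_ge_0 y); intros; nra.
Qed.

Lemma flat_bounded n y : flat n y <= INR n ^ n.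
Proof.
  assert (H0 : 0 <= INR n ^ n) by apply pow_le, pos_INR.
  destruct (Rle_dec y 0) as [h | h]; [now rewrite flat_npos |].
  rewrite flat_gt by lra; rewrite exp_Ropp.
  apply Rle_div_l; [apply exp_pos |]; apply pow_le_exp; left; apply Rinv_0_lt_compat; lra.
Qed.

Lemma is_derive_flat n y : is_derive (flat n) y (flat (S (S n)) y - INR n * flat (S n) y).
Proof.
  destruct (Rtotal_order y 0) as [h | [-> | h]].
  - rewrite !flat_npos by lra.
    apply is_derive_ext_loc with (fun _ => 0).
    + exists (mkposreal (- y) ltac:(lra)); intros z Hz.
      change (Rabs (z - y) < - y) in Hz; apply Rabs_def2 in Hz; rewrite flat_npos; [easy | lra].
    + eapply is_derive_val; [exact (is_derive_const 0 y) | unfold zero; simpl; ring].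
  - rewrite !flat_npos by lra.
    apply is_derive_of_quad with (INR (S (S n)) ^ (S (S n))); intros s _.
    rewrite (flat_npos n 0) by lra.
    replace (flat n s - 0 - (s - 0) * (0 - INR n * 0)) with (flat n s) by ring.
    rewrite Rminus_0_r, Rabs_pos_eq by apply flat_nonneg; apply flat_quad.
  - rewrite !flat_gt by lra.
    apply is_derive_ext_loc with (fun z => (/ z) ^ n * exp (- / z)).
    + exists (mkposreal y h); intros z Hz.
      change (Rabs (z - y) < y) in Hz; apply Rabs_def2 in Hz; rewrite flat_gt; [easy | lra].
    + assert (Hi : is_derive Rinv y (- / y ^ 2)) by (auto_derive; [lra | field; lra]).
      eapply is_derive_val.
      * apply is_derive_Rmult; [apply (is_derive_pow Rinv n y _ Hi) |].
        apply (is_derive_Rcomp exp (fun z => - / z) y (exp (- / y)) (- - / y ^ 2));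
          [apply is_derive_exp | now apply is_derive_Ropp].
      * destruct n; simpl; [field; lra |].
        destruct n; simpl; field; lra.
Qed.

Lemma isD_flat_comp n (k : R -> R) (t l : R) :
  is_derive k t l ->
  isD (fun s => RtoC (flat n (k s))) t (RtoC l * (RtoC (flat (S (S n)) (k t)) + - INR n * RtoC (flat (S n) (k t))))%C.
Proof.
  intros H; eapply isD_val; [apply isD_RtoC, (is_derive_Rcomp (flat n) k t _ l (is_derive_flat n (k t)) H) |].
  rewrite RtoC_mult, RtoC_minus, RtoC_mult; ring.
Qed.

(** Differentiation shifts the phase by [PI / 2], hence the free [m]. *)
Lemma smT_cos (m : R) : smT (fun t => RtoC (cos (t + m))).
Proof.
  assert (HB : forall m, bounded2 (fun t _ => RtoC (cos (t + m)))).
  { intros u; split.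
    - intros t x; replace (t + 2 * PI + u) with (t + u + 2 * PI) by ring; now rewrite cos_add_2PI.
    - exists 1; intros t _; rewrite Cmod_R; apply Rabs_le; apply COS_bound. }
  intros n; revert m; induction n; intros m; [apply HB |].
  apply Reg_intro with (fun t _ => RtoC (cos (t + (m + PI / 2)))) (fun _ _ => 0); auto.
  - intros t x; apply isD_RtoC.
    replace (cos (t + (m + PI / 2))) with (- sin (t + m)).
    + auto_derive; [easy | ring].
    + rewrite <- Rplus_assoc, cos_plus, cos_PI2, sin_PI2; ring.
  - intros t x; apply isD_const.
  - apply (Mul_const 0).
Qed.

(** The cosine makes the bump periodic: for [0 < r < PI] it is positive exactly at distance less
    than [r] from [m] modulo [2 PI]. *)
Definition tbump (m r : R) (n : nat) (t : R) : R := flat n (cos (t + - m) - cos r).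

Lemma smT_tbump m r n : smT (fun t => RtoC (tbump m r n t)).
Proof.
  assert (HB : forall n, bounded2 (fun t _ => RtoC (tbump m r n t))).
  { intros k; split.
    - intros t x; unfold tbump; replace (t + 2 * PI + - m) with (t + - m + 2 * PI) by ring; now rewrite cos_add_2PI.
    - exists (INR k ^ k); intros t _; rewrite Cmod_R, Rabs_pos_eq by apply flat_nonneg; apply flat_bounded. }
  intros k; revert n; induction k; intros n; [apply HB |].
  assert (HM : forall f g, Reg bounded2 k f -> Reg bounded2 k g -> Reg bounded2 k (fun t x => f t x * g t x)%C).
  { intros f g; apply Reg_mult; auto using bounded2_plus, bounded2_mult. }
  apply Reg_intro with
    (fun t _ => RtoC (cos (t + (- m + PI / 2))) * (RtoC (tbump m r (S (S n)) t) + - INR n * RtoC (tbump m r (S n) t)))%C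
    (fun _ _ => 0); auto.
  - intros t x; apply (isD_flat_comp n (fun t => cos (t + - m) - cos r)).
    replace (cos (t + (- m + PI / 2))) with (- sin (t + - m)).
    + auto_derive; [easy | ring].
    + rewrite <- Rplus_assoc, cos_plus, cos_PI2, sin_PI2; ring.
  - intros t x; apply isD_const.
  - apply (HM (fun t _ => RtoC (cos (t + (- m + PI / 2))))); [apply smT_cos |].
    apply Reg_plus; [exact bounded2_plus | apply IHk |].
    apply (HM (fun _ _ => - INR n)%C); [apply Mul_const | apply IHk].
  - apply (Mul_const 0).
Qed.

Definition xbump (x0 r : R) (n : nat) (x : R) : R := flat n (r ^ 2 - (x - x0) ^ 2).

Lemma Sch_xbump x0 r n : Sch (fun _ x => RtoC (xbump x0 r n x)).
Proof.
  assert (HB : forall n, decaying2 (fun _ x => RtoC (xbump x0 r n x))).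
  { intros k; split; [easy |]; intros j; exists ((Rabs x0 + Rabs r) ^ j * INR k ^ k); intros _ x.
    assert (H0 : 0 <= (Rabs x0 + Rabs r) ^ j) by (apply pow_le; generalize (Rabs_pos x0) (Rabs_pos r); lra).
    assert (H1 : 0 <= INR k ^ k) by apply pow_le, pos_INR.
    rewrite <- RtoC_mult, Cmod_R, Rabs_mult, (Rabs_pos_eq (xbump _ _ _ _)) by apply flat_nonneg.
    destruct (Rle_dec (r ^ 2 - (x - x0) ^ 2) 0) as [h | h].
    - unfold xbump; rewrite flat_npos, Rmult_0_r by easy; now apply Rmult_le_pos.
    - apply Rmult_le_compat; [apply Rabs_pos | apply flat_nonneg | | apply flat_bounded].
      rewrite <- RPow_abs; apply pow_incr; split; [apply Rabs_pos |].
      assert (Rabs (x - x0) <= Rabs r).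
      { apply Rsqr_le_abs_0; unfold Rsqr; nra. }
      replace x with (x0 + (x - x0)) by ring; eapply Rle_trans; [apply Rabs_triang | lra]. }
  intros k; revert n; induction k; intros n; [apply HB |].
  set (D := (fun (_ : R) (x : R) => RtoC (xbump x0 r (S (S n)) x) + - INR n * RtoC (xbump x0 r (S n) x))%C).
  assert (HD : Reg decaying2 k D).
  { apply Reg_plus; [exact decaying2_plus | apply IHk |].
    apply (Reg_bounded_decaying k (fun _ _ => - INR n)%C); [apply Mul_const | apply IHk]. }
  apply Reg_intro with (fun _ _ => RtoC 0) (fun t x : R => - (2) * (x * D t x) + (2 * x0)%R * D t x)%C; auto.
  - intros t x; apply isD_const.
  - intros t x; eapply isD_val; [apply (isD_flat_comp n (fun x => r ^ 2 - (x - x0) ^ 2) x (-2 * (x - x0))) |].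
    + auto_derive; [easy | ring].
    + unfold D, xbump; replace (-2 * (x - x0)) with (- (2 * x) + 2 * x0) by ring.
      rewrite RtoC_plus, RtoC_opp, RtoC_mult; ring.
  - replace (fun _ _ : R => RtoC 0) with (fun t x : R => 0 * D t x)%C by (apply funext2; intros; ring).
    apply (Reg_bounded_decaying k (fun _ _ => 0)); [apply Mul_const | easy].
  - apply Reg_plus; [exact decaying2_plus | |].
    + apply (Reg_bounded_decaying k (fun _ _ => - (2))%C); [apply Mul_const | now apply Reg_decaying_x].
    + apply (Reg_bounded_decaying k (fun _ _ => RtoC (2 * x0))); [apply Mul_const | easy].
Qed.

Lemma cos_gt_near u r : 0 < r < PI -> cos r < cos u -> exists k : Z, Rabs (u + IZR k * (2 * PI)) < r.
Proof.
  intros Hr H; destruct (period_representative u (- PI) (2 * PI) two_PI_pos) as [k Hk]; exists k.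
  set (v := u + IZR k * (2 * PI)) in *.
  assert (E : cos v = cos u) by (apply (periodic_IZR cos (2 * PI)); apply cos_add_2PI).
  assert (Ev : cos (Rabs v) = cos v) by (unfold Rabs; destruct (Rcase_abs v); [apply cos_neg | easy]).
  apply Rnot_le_lt; intros h.
  assert (cos (Rabs v) <= cos r); [| lra].
  destruct (Rle_lt_or_eq_dec _ _ h) as [h' | <-]; [left | lra].
  apply cos_decreasing_1; try lra.
  apply Rabs_le; lra.
Qed.

Lemma tbump_support m r n t : 0 < r < PI -> tbump m r n t <> 0 -> exists k : Z, Rabs (t - m + IZR k * (2 * PI)) < r.
Proof.
  intros Hr H; apply cos_gt_near; [easy |].
  apply Rnot_le_lt; intros h; apply H; unfold tbump; apply flat_npos.
  replace (t + - m) with (t - m) by ring; lra.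
Qed.

Lemma tbump_pos m r n : 0 < r < PI -> 0 < tbump m r n m.
Proof.
  intros Hr; apply flat_pos; rewrite Rplus_opp_r, cos_0.
  assert (cos r < cos 0); [apply cos_decreasing_1; lra | rewrite cos_0 in *; lra].
Qed.

Lemma xbump_support x0 r n x : 0 < r -> xbump x0 r n x <> 0 -> Rabs (x - x0) < r.
Proof.
  intros Hr H; apply Rnot_le_lt; intros h; apply H; unfold xbump; apply flat_npos.
  rewrite <- (pow2_abs (x - x0)); nra.
Qed.

Lemma xbump_pos x0 r n : 0 < r -> 0 < xbump x0 r n x0.
Proof. intros Hr; apply flat_pos; rewrite Rminus_diag; nra. Qed.

(** At a point where [D = U - f] does not vanish, the test function is the conjugate of that value
    times a bump so narrow that [D] moves by at most half its modulus; the pairing then has positive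
    real part. *)
Lemma cpair_determines U f :
  Reg bounded2 3 U -> Sch f -> (forall phi, Schwartz phi -> cpair U phi = cpair f phi) -> U = f.
Proof.
  intros HU Hf HE.
  set (D := fun t x => (U t x + - (1) * f t x)%C).
  assert (HD : Reg bounded2 3 D).
  { apply Reg_plus; [exact bounded2_plus | easy | apply Sch_Mul; now apply Sch_scal]. }
  assert (HD0 : forall phi, Sch phi -> I2 (fun t x => D t x * phi t x)%C = 0).
  { intros phi Hphi; specialize (HE phi (Sch_Schwartz phi Hphi)); rewrite !cpair_I2 in HE.
    assert (H1 : Reg decaying2 3 (fun t x => U t x * phi t x)%C) by (apply Reg_bounded_decaying; auto).
    assert (H2 : Reg decaying2 3 (fun t x => f t x * phi t x)%C) by (apply Mul_Sch; auto using Sch_Mul).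
    replace (fun t x => D t x * phi t x)%C
      with (fun t x => U t x * phi t x + - (1) * (f t x * phi t x))%C by (apply funext2; intros; unfold D; ring).
    rewrite I2_plus, I2_scal, HE; auto; [ring |].
    apply (Reg_bounded_decaying 3 (fun _ _ => - (1))%C); [apply Mul_const | easy]. }
  enough (H0 : forall t x, 0 <= t < 2 * PI -> D t x = 0).
  { apply funext2; intros t x.
    destruct (period_representative t 0 (2 * PI) two_PI_pos) as [k Hk]; rewrite Rplus_0_l in Hk.
    assert (E := periodic_IZR (fun t => D t x) (2 * PI) (fun t => proj1 (Reg_base _ _ _ HD) t x) k t).
    simpl in E; rewrite H0 in E by easy.
    transitivity (D t x + f t x)%C; [unfold D; ring | rewrite <- E; ring]. }
  intros t0 x0 Ht0; apply NNPP; intros Hne.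
  assert (Hd : 0 < Cmod (D t0 x0)) by now apply Cmod_gt_0.
  set (d := Cmod (D t0 x0)) in *.
  destruct (Reg_bounded_Lipschitz D (Reg_31 _ _ HD)) as [M [HM0 HM]].
  (* [D] moves by at most [M (r + r) <= d / 2] on the support of the bump; [r <= 1 < PI] is for the
     periodic factor. *)
  set (r := Rmin 1 (d / (4 * M + 1))).
  assert (Hr1 : r <= 1) by apply Rmin_l.
  assert (Hr0 : 0 < r) by (apply Rmin_pos; [lra | apply Rdiv_lt_0_compat; lra]).
  assert (Hr2 : M * (r + r) <= d / 2).
  { assert (r <= d / (4 * M + 1)) by apply Rmin_r.
    apply Rle_div_r in H; [nra | lra]. }
  assert (HrPI : 0 < r < PI) by (generalize PI2_1; lra).
  set (B := fun t x => tbump t0 r 0 t * xbump x0 r 0 x).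
  assert (HB0 : forall t x, 0 <= B t x) by (intros; apply Rmult_le_pos; apply flat_nonneg).
  set (phi := fun t x => (Cconj (D t0 x0) * RtoC (B t x))%C).
  assert (Hphi : Sch phi).
  { apply Sch_scal; unfold B.
    replace (fun t x => RtoC (tbump t0 r 0 t * xbump x0 r 0 x)) with (fun t x => RtoC (tbump t0 r 0 t) * RtoC (xbump x0 r 0 x))%C
      by (apply funext2; intros; now rewrite RtoC_mult).
    apply (Mul_Sch (fun t _ => RtoC (tbump t0 r 0 t))); [apply smT_tbump | apply Sch_xbump]. }
  set (p := fun t x => (D t x * phi t x)%C).
  assert (Hp : Reg decaying2 3 p) by (apply Reg_bounded_decaying; auto).
  assert (Hre : forall t x, B t x <> 0 -> 0 < Re (D t x * Cconj (D t0 x0))%C).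
  { intros t x HB.
    destruct (tbump_support t0 r 0 t HrPI) as [k Hk]; [intros E; apply HB; unfold B; rewrite E; ring |].
    assert (Hx : Rabs (x - x0) < r) by (apply (xbump_support x0 r 0); [easy | intros E; apply HB; unfold B; rewrite E; ring]).
    rewrite <- (periodic_IZR (fun t => D t x) (2 * PI) (fun t => proj1 (Reg_base _ _ _ HD) t x) k t).
    set (t' := t + IZR k * (2 * PI)).
    replace (t - t0 + IZR k * (2 * PI)) with (t' - t0) in Hk by (unfold t'; ring).
    assert (Hdiff : Cmod (D t' x - D t0 x0) <= d / 2).
    { eapply Rle_trans; [apply HM |]; eapply Rle_trans; [| exact Hr2]; apply Rmult_le_compat_l; lra. }
    replace (D t' x * Cconj (D t0 x0))%C with (D t0 x0 * Cconj (D t0 x0) + (D t' x - D t0 x0) * Cconj (D t0 x0))%C by ring.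
    rewrite <- Cmod2_conj; fold d.
    assert (Hs : Rabs (Re ((D t' x - D t0 x0) * Cconj (D t0 x0))%C) <= d / 2 * d).
    { eapply Rle_trans; [apply re_le_Cmod |]; rewrite Cmod_mult, Cmod_conj; fold d.
      apply Rmult_le_compat_r; lra. }
    apply Rabs_le_between in Hs.
    replace (Re (RtoC (d ^ 2) + (D t' x - D t0 x0) * Cconj (D t0 x0))%C)
      with (d ^ 2 + Re ((D t' x - D t0 x0) * Cconj (D t0 x0))%C) by (unfold Re; simpl; ring).
    assert (0 < d * d) by now apply Rmult_lt_0_compat.
    destruct Hs as [Hs _]; lra. }
  assert (Ep : forall t x, Re (p t x) = Re (D t x * Cconj (D t0 x0))%C * B t x).
  { intros t x; unfold p, phi, Re; simpl; ring. }
  assert (Hp0 : forall t x, 0 <= Re (p t x)).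
  { intros t x; rewrite Ep; destruct (Req_dec (B t x) 0) as [-> | h]; [lra |].
    apply Rmult_le_pos; [left; now apply Hre | apply HB0]. }
  assert (Hpp : 0 < Re (p t0 x0)).
  { assert (0 < B t0 x0) by (apply Rmult_lt_0_compat; [now apply tbump_pos | now apply xbump_pos]).
    rewrite Ep; apply Rmult_lt_0_compat; [apply Hre; lra | easy]. }
  destruct (Reg_decaying_dominated p (Reg_31 _ _ Hp)) as [K HK].
  assert (HI : 0 < Re (I2 p)).
  { refine (RInt_pos_of_point (fun t => Re (CI (p t))) 0 (2 * PI) t0 _ _ Ht0 _).
    - intros t; apply (Reg_CI_continuous p Hp t).
    - intros t; exact (IR_nonneg _ K (Cdominated_Re _ _ (HK t)) (Hp0 t)).
    - exact (IR_pos_of_point _ K x0 (Cdominated_Re _ _ (HK t0)) (Hp0 t0) Hpp). }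
  unfold p in HI; rewrite HD0 in HI by easy; simpl in HI; lra.
Qed.

(** A function with four bounded derivatives already counts as a tempered distribution; if
    hypoellipticity identifies it weakly with a Schwartz function, [cpair_determines] identifies the
    two pointwise. *)
Lemma not_GH_of_nonsmooth_solution c q U :
  smT c -> smT q -> Reg bounded2 4 U -> Sch (LL c q U) -> ~ Sch U -> ~ Schwartz_GH c q.
Proof.
  intros Hc Hq HU HL HnS HGH.
  destruct (HGH (cpair U)) as [g [Hg Eg]].
  - now apply tempered_cpair, Reg_S.
  - exists (LL c q U); split; [now apply Sch_Schwartz |].
    intros phi Hphi; apply cpair_Lt; auto using Schwartz_Sch.
  - apply HnS; rewrite (cpair_determines U g); auto using Schwartz_Sch, Reg_S.
Qed.

Lemma not_GH_of_Z c q p : smT c -> smT q -> Z_L0 c q p -> ~ Schwartz_GH c q.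
Proof.
  intros Hc Hq; destruct p as [k xi]; unfold Z_L0; simpl; intros HZ.
  assert (Cc := smT_continuous c Hc); assert (Cq := smT_continuous q Hq).
  assert (Ca : Ccontinuous (symb c q xi)) by now apply symb_continuous.
  assert (Pa : forall t, symb c q xi (t + 2 * PI) = symb c q xi t) by (intros; now apply symb_periodic).
  set (v := fun t => cexp (- primitive (symb c q xi) t)).
  assert (Hv : forall t, isD v t (- symb c q xi t * v t)%C).
  { intros t; apply isD_cexp, isD_opp, isD_primitive, Ca. }
  assert (Pv : forall t, v (t + 2 * PI) = v t).
  { intros t; unfold v; rewrite primitive_period, primitive_symb_mean by easy.
    (* Times [i], the equation of [Z_L0] reads [i c_0 xi + q_0 = - i k], so the exponent of [v]
       grows by [2 PI i k] over a period. *)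
    replace (- (primitive (symb c q xi) t + RtoC (2 * PI) * (Ci * xi * mean c + mean q)))%C
      with (- primitive (symb c q xi) t + RtoC (2 * PI) * (Ci * IZR k))%C.
    - rewrite cexp_plus.
      replace (cexp (RtoC (2 * PI) * (Ci * IZR k))) with (RtoC 1); [ring |].
      symmetry; apply C_ext; unfold cexp, Re, Im; simpl.
      + transitivity (exp 0 * cos (0 + IZR k * (2 * PI))).
        * f_equal; f_equal; ring.
        * rewrite (periodic_IZR cos (2 * PI) cos_add_2PI), exp_0, cos_0; ring.
      + transitivity (exp 0 * sin (0 + IZR k * (2 * PI))).
        * f_equal; f_equal; ring.
        * rewrite (periodic_IZR sin (2 * PI) sin_add_2PI), exp_0, sin_0; ring.
    - transitivity (- primitive (symb c q xi) t - RtoC (2 * PI) * (Ci * xi * mean c + mean q)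
          + RtoC (2 * PI) * Ci * (IZR k + mean c * xi - Ci * mean q)
          - RtoC (2 * PI) * (Ci * (mean c * xi - Ci * mean q) - (Ci * xi * mean c + mean q)))%C.
      + transitivity (- primitive (symb c q xi) t + RtoC (2 * PI) * (Ci * IZR k))%C; [easy | ring].
      + rewrite HZ.
        replace (Ci * (mean c * xi - Ci * mean q) - (Ci * xi * mean c + mean q))%C with (RtoC 0); [ring |].
        transitivity (- (Ci * Ci + 1) * mean q)%C; [| ring].
        replace (Ci * Ci + 1)%C with (RtoC 0) by (apply C_ext; unfold Re, Im; simpl; ring); ring. }
  set (U := fun t x => (v t * wave xi x)%C).
  assert (HaM : Mul (fun t _ => - symb c q xi t)%C).
  { replace (fun t (_ : R) => - symb c q xi t)%C
      with (fun t (_ : R) => (- Ci * xi) * c t + - (1) * q t)%C by (apply funext2; intros; unfold symb; ring).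
    now apply Mul_plus; apply Mul_scal. }
  assert (HUt : is_dt U (fun t x => - symb c q xi t * U t x)%C).
  { intros t x; eapply isD_val; [apply isD_mult; [apply Hv | apply isD_const] | unfold U; ring]. }
  assert (HUx : is_dx U (fun t x => (Ci * xi) * U t x)%C).
  { intros t x; eapply isD_val; [apply isD_scal, isD_wave_x | unfold U; ring]. }
  assert (HU : Mul U).
  { assert (HB : bounded2 U).
    { split; [intros t x; unfold U; now rewrite Pv |].
      destruct (Cperiodic_continuous_bounded v Pv (isD_Ccontinuous _ _ Hv)) as [M HM].
      exists M; intros t x; unfold U; rewrite Cmod_mult, Cmod_wave, Rmult_1_r; apply HM. }
    intros n; induction n; [easy |].
    apply (Reg_intro _ _ _ _ _ HB HUt HUx).
    - apply (Reg_mult bounded2 bounded2 bounded2_plus bounded2_mult n (fun t _ => - symb c q xi t)%C); [apply HaM | easy].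
    - apply (Reg_mult bounded2 bounded2 bounded2_plus bounded2_mult n (fun _ _ => Ci * xi)%C); [apply Mul_const | easy]. }
  apply (not_GH_of_nonsmooth_solution c q U Hc Hq (HU 4%nat)).
  - replace (LL c q U) with (fun _ x : R => 0 * RtoC (gauss x))%C; [apply Sch_scal, Sch_gauss |].
    apply funext2; intros t x; unfold LL; rewrite (is_dt_cdt _ _ HUt), (is_dx_cdx _ _ HUx); unfold symb; ring.
  (* [|U 0 x| = 1] for every [x], so the weight [x] makes it unbounded. *)
  - intros HS; destruct (proj2 (HS O) 1%nat) as [M HM].
    specialize (HM 0 (Rabs M + 1)).
    assert (Ev : v 0 = 1) by (unfold v; rewrite primitive_0, <- cexp_0; f_equal; ring).
    unfold U in HM; rewrite Ev, Cmod_mult, Cmod_mult, Cmod_wave, Cmod_1, Cmod_R, pow_1 in HM.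
    rewrite Rabs_pos_eq in HM by (generalize (Rabs_pos M); lra).
    generalize (RRle_abs M); lra.
Qed.

(** * Singular solutions *)

Lemma Cinv_0 : (/ 0)%C = 0.
Proof. apply C_ext; unfold Cinv, Re, Im; simpl; unfold Rdiv; ring. Qed.

(* Division by zero is zero in Coquelicot's [C], so [core 0 = 1]. *)
Definition core (z : C) : C := cexp (- (z * z) - Ci * / z).

(** [Re (- i / z) = - Im z / |z|^2], which singles out the upper half plane; the convention for
    [/ 0] makes the origin harmless. *)
Lemma Re_mCi_inv (z : C) : 0 <= Im z -> Re (- (Ci * / z))%C <= 0.
Proof.
  intros H; replace (Re (- (Ci * / z))%C) with (- (Im z / (Re z ^ 2 + Im z ^ 2)))
    by (unfold Re, Im, Rdiv; simpl; unfold Rdiv; ring).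
  destruct (Req_dec (Re z ^ 2 + Im z ^ 2) 0) as [E | E].
  - assert (Im z = 0) as -> by nra; unfold Rdiv; lra.
  - assert (0 <= Im z / (Re z ^ 2 + Im z ^ 2)); [| lra].
    apply Rmult_le_pos; [easy | left; apply Rinv_0_lt_compat; nra].
Qed.

Lemma Cmod_core (z : C) : 0 <= Im z -> Cmod (core z) <= exp (Im z ^ 2 - Re z ^ 2).
Proof.
  intros H; unfold core; rewrite Cmod_cexp; apply exp_le.
  replace (Re (- (z * z) - Ci * / z)%C) with (Im z ^ 2 - Re z ^ 2 + Re (- (Ci * / z))%C)
    by (unfold Re, Im; simpl; ring).
  generalize (Re_mCi_inv z H); lra.
Qed.

(** Powers of [z] and of [/ z] are kept apart: [j - k] measures the vanishing at 0, and
    differentiation stays within finite sums of the family. *)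
Definition mono (j k : nat) (z : C) : C := (z ^ j * (/ z) ^ k * core z)%C.

(** The complex derivative off 0, from [core' = (- 2 z + i / z^2) core]. No term lowers [j - k] by
    more than 2. *)
Definition mono' (j k : nat) (z : C) : C :=
  (INR j * mono (pred j) k z + (- INR k * mono j (S k) z
     + (- (2) * mono (S j) k z + Ci * mono j (S (S k)) z)))%C.

Lemma isD_pow (f : R -> C) (s : R) (l : C) (n : nat) :
  isD f s l -> isD (fun u => f u ^ n)%C s (INR n * l * f s ^ pred n)%C.
Proof.
  intros H; induction n.
  - simpl; eapply isD_val; [apply isD_const | ring].
  - apply isD_ext with (fun u => f u * f u ^ n)%C; [intros; simpl; ring |].
    eapply isD_val; [apply isD_mult; [exact H | exact IHn] |].
    rewrite S_INR, RtoC_plus; destruct n; simpl; ring.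
Qed.

Lemma isD_mono (z : R -> C) (s : R) (l : C) (j k : nat) :
  isD z s l -> z s <> 0 -> isD (fun u => mono j k (z u)) s (l * mono' j k (z s))%C.
Proof.
  intros H H0.
  assert (Hi := isD_inv z s l H H0).
  eapply isD_val.
  - apply isD_mult; [apply isD_mult; [apply isD_pow, H | apply isD_pow, Hi] |].
    apply isD_cexp, isD_minus; [apply isD_opp, isD_mult; exact H | apply isD_scal, Hi].
  - cbv beta; unfold mono', mono; fold (core (z s)).
    destruct k; simpl; ring.
Qed.

Lemma mono_at_0 (j k : nat) : (1 <= j)%nat -> mono j k 0 = 0.
Proof. intros H; destruct j; [lia |]; unfold mono; simpl; ring. Qed.

Lemma mono'_at_0 (j k : nat) : (2 <= j)%nat -> mono' j k 0 = 0.
Proof. intros H; unfold mono'; rewrite !mono_at_0 by lia; ring. Qed.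

Lemma Cmod_powers (j k m : nat) (z : C) : j = (k + m)%nat -> Cmod (z ^ j * (/ z) ^ k)%C <= Cmod z ^ m.
Proof.
  intros ->; destruct (classic (z = 0)) as [-> | H].
  - rewrite Cinv_0, Cmod_mult, !Cmod_pow, Cmod_0, <- pow_add.
    destruct (Nat.eq_dec k 0) as [-> | h]; [simpl; rewrite Nat.add_0_r; lra |].
    rewrite pow_i by lia; apply pow_le; lra.
  - rewrite Cpow_add_r, Cpow_inv by easy.
    replace (z ^ k * z ^ m * / z ^ k)%C with (z ^ m)%C by (field; now apply Cpow_nz).
    rewrite Cmod_pow; lra.
Qed.

(** Near a zero of [z] the product is [O(|u - s|^(j - k))], at least quadratic, hence the derivative
    0. The amplitude [b] confines [z] to the closed upper half plane, where [core] is controlled. *)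
Lemma isD_zero_of_flat (b z : R -> C) (s A L Y : R) (j k : nat) :
  (k + 2 <= j)%nat -> z s = 0 -> 0 <= L -> (forall u, Cmod (z u) <= L * Rabs (u - s)) ->
  (forall u, Cmod (b u) <= A) -> (forall u, Rabs (Im (z u)) <= Y) -> (forall u, b u <> 0 -> 0 <= Im (z u)) ->
  isD (fun u => b u * mono j k (z u))%C s 0.
Proof.
  intros Hjk Hz HL0 HL HA HY Hb.
  assert (HA0 : 0 <= A) by (eapply Rle_trans; [apply Cmod_ge_0 | apply (HA s)]).
  set (m := (j - k)%nat).
  apply isD_of_quad with (A * (L ^ m * exp (Y ^ 2))); intros u Hu.
  rewrite Hz, mono_at_0 by lia.
  replace (b u * mono j k (z u) - b s * 0 - (u - s)%R * 0)%C with (b u * mono j k (z u))%C by ring.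
  assert (HR : 0 <= A * (L ^ m * exp (Y ^ 2)) * (u - s) ^ 2).
  { apply Rmult_le_pos; [| apply pow2_ge_0]; apply Rmult_le_pos; [easy |].
    apply Rmult_le_pos; [now apply pow_le | left; apply exp_pos]. }
  destruct (classic (b u = 0)) as [-> | Hbu].
  { rewrite Cmult_0_l, Cmod_0; easy. }
  rewrite Cmod_mult, Rmult_assoc; apply Rmult_le_compat; auto using Cmod_ge_0.
  unfold mono; rewrite Cmod_mult, (Rmult_comm (L ^ m)), Rmult_assoc, Rmult_comm.
  apply Rmult_le_compat; auto using Cmod_ge_0.
  - eapply Rle_trans; [apply Cmod_core; auto |]; apply exp_le.
    rewrite <- (pow2_abs (Im (z u))).
    assert (Rabs (Im (z u)) ^ 2 <= Y ^ 2) by (apply pow_incr; split; [apply Rabs_pos | apply HY]).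
    generalize (pow2_ge_0 (Re (z u))); lra.
  - eapply Rle_trans; [apply (Cmod_powers j k m); unfold m; lia |].
    apply Rle_trans with ((L * Rabs (u - s)) ^ m); [apply pow_incr; split; [apply Cmod_ge_0 | apply HL] |].
    rewrite Rpow_mult_distr; apply Rmult_le_compat_l; [now apply pow_le |].
    rewrite <- (pow2_abs (u - s)); replace m with (2 + (m - 2))%nat by (unfold m; lia).
    rewrite pow_add; apply Rle_trans with (Rabs (u - s) ^ 2 * 1); [| lra].
    apply Rmult_le_compat_l; [apply pow_le, Rabs_pos |].
    rewrite <- (pow1 (m - 2)); apply pow_incr; split; [apply Rabs_pos | easy].
Qed.

(** [a] lives where [Im Z >= d]. With [d = 0] the singularity of [core] may be touched; with [d > 0]
    it is kept at distance [d]. *)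
Definition vanishing (Z : R -> C) (d : R) (a : R -> C) : Prop :=
  smT a /\ forall t, Im (Z t) < d -> a t = 0.

Lemma vanishing_locally Z d a t :
  Ccontinuous Z -> vanishing Z d a -> Im (Z t) < d -> exists e : posreal, forall s, Rabs (s - t) < e -> a s = 0.
Proof.
  intros HZ [_ Ha] Ht.
  assert (H : locally t (fun s => Im (Z s) < d)).
  { exact (proj2 (HZ t) (fun y => y < d) (open_lt d (Im (Z t)) Ht)). }
  destruct H as [e He]; exists e; intros s Hs; apply Ha, He, Hs.
Qed.

Lemma isD_ext_loc_0 (f : R -> C) (t : R) (e : posreal) :
  (forall s, Rabs (s - t) < e -> f s = 0) -> isD f t 0.
Proof.
  intros H; split; apply is_derive_ext_loc with (fun _ => 0).
  - exists e; intros s Hs; now rewrite H.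
  - exact (is_derive_const 0 t).
  - exists e; intros s Hs; now rewrite H.
  - exact (is_derive_const 0 t).
Qed.

Lemma vanishing_deriv Z d a a' :
  Ccontinuous Z -> vanishing Z d a -> smT a' -> (forall t, isD a t (a' t)) -> vanishing Z d a'.
Proof.
  intros HZ Ha Hs HD; split; [easy |]; intros t Ht.
  destruct (vanishing_locally Z d a t HZ Ha Ht) as [e He].
  apply isD_unique with a t; [apply HD | now apply isD_ext_loc_0 with e].
Qed.

Lemma vanishing_mult Z d a b : vanishing Z d a -> smT b -> vanishing Z d (fun t => b t * a t)%C.
Proof.
  intros [Ha H] Hb; split; [now apply smT_mult |]; intros t Ht; rewrite H by easy; ring.
Qed.

(** If [Z' = - c], smooth functions of [x + Z t] given by a complex-differentiable profile are
    annihilated by [d_t + c d_x]; the amplitude [a] localises and takes care of [q]. *)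
Definition wedge (Z a : R -> C) (j k : nat) (t x : R) : C := (a t * mono j k (x + Z t))%C.

Definition wedge' (Z a : R -> C) (j k : nat) (t x : R) : C := (a t * mono' j k (x + Z t))%C.

Lemma exp_weight (N : nat) (X : R) : (1 + Rabs X) ^ N * exp (- X ^ 2) <= INR N ^ N * exp 2.
Proof.
  assert (H0 := Rabs_pos X).
  apply Rle_trans with (INR N ^ N * exp (1 + Rabs X) * exp (- X ^ 2)).
  - apply Rmult_le_compat_r; [left; apply exp_pos | apply pow_le_exp; lra].
  - rewrite Rmult_assoc, <- exp_plus; apply Rmult_le_compat_l; [apply pow_le, pos_INR |].
    apply exp_le; rewrite <- (pow2_abs X); nra.
Qed.

(** As [Im (x + Z t)] is bounded, [core] is at most a constant times [exp (- X^2)] with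
    [X = Re (x + Z t)], and [|x|] is controlled by [1 + |X|]. The power of [/ z] is bounded either
    through the distance [d] to 0 or by cancellation against [z^j]. *)
Lemma wedge_decaying Z d a j k :
  smT Z -> 0 <= d -> vanishing Z d a -> (0 < d \/ (k <= j)%nat) -> decaying2 (wedge Z a j k).
Proof.
  intros HZ Hd [Ha Hv] Hjk; split.
  { intros t x; unfold wedge; now rewrite (smT_periodic a Ha), (smT_periodic Z HZ). }
  destruct (smT_bounded Z HZ) as [B HB], (smT_bounded a Ha) as [A HA].
  assert (HB0 : 0 <= B) by (eapply Rle_trans; [apply Cmod_ge_0 | apply (HB 0)]).
  assert (HA0 : 0 <= A) by (eapply Rle_trans; [apply Cmod_ge_0 | apply (HA 0)]).
  assert (HW : exists W, 0 <= W /\ forall t x : R, a t <> 0 ->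
     Cmod ((x + Z t) ^ j * (/ (x + Z t)) ^ k)%C <= W * (1 + Cmod (x + Z t)) ^ j).
  { destruct Hjk as [Hd' | Hjk].
    - exists ((/ d) ^ k); split; [apply pow_le; left; now apply Rinv_0_lt_compat |].
      intros t x Hat.
      assert (Him : d <= Im (Z t)) by (apply Rnot_lt_le; intros h; apply Hat, Hv, h).
      assert (Hz : d <= Cmod (x + Z t)).
      { eapply Rle_trans; [| apply im_le_Cmod]; replace (Im (x + Z t)%C) with (Im (Z t)) by (unfold Im; simpl; ring).
        rewrite Rabs_pos_eq; lra. }
      rewrite Cmod_mult, !Cmod_pow, Cmod_inv, Rmult_comm by (apply Cmod_gt_0; lra).
      apply Rmult_le_compat; try (apply pow_le; try lra).
      + left; apply Rinv_0_lt_compat; lra.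
      + apply pow_incr; split; [left; apply Rinv_0_lt_compat; lra | apply Rinv_le_contravar; lra].
      + apply pow_incr; lra.
    - exists 1; split; [lra |]; intros t x _; rewrite Rmult_1_l.
      assert (H0 := Cmod_ge_0 (x + Z t)).
      eapply Rle_trans; [apply (Cmod_powers j k (j - k)); lia |].
      apply Rle_trans with ((1 + Cmod (x + Z t)) ^ (j - k)); [apply pow_incr; lra |].
      apply Rle_pow; [lra | lia]. }
  destruct HW as [W [HW0 HW]].
  intros m; exists ((1 + B) ^ m * (A * (W * (2 + 2 * B) ^ j * exp (B ^ 2))) * (INR (m + j) ^ (m + j) * exp 2)).
  assert (HP1 : 0 <= (1 + B) ^ m) by (apply pow_le; lra).
  assert (HP2 : 0 <= (2 + 2 * B) ^ j) by (apply pow_le; lra).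
  assert (HP3 : 0 <= W * (2 + 2 * B) ^ j * exp (B ^ 2)).
  { apply Rmult_le_pos; [now apply Rmult_le_pos | left; apply exp_pos]. }
  assert (HP4 : 0 <= (1 + B) ^ m * (A * (W * (2 + 2 * B) ^ j * exp (B ^ 2)))).
  { apply Rmult_le_pos; [easy | now apply Rmult_le_pos]. }
  intros t x; unfold wedge.
  destruct (classic (a t = 0)) as [-> | Hat].
  { rewrite Cmult_0_l, Cmult_0_r, Cmod_0; apply Rmult_le_pos; [easy |].
    apply Rmult_le_pos; [apply pow_le, pos_INR | left; apply exp_pos]. }
  assert (Him : 0 <= Im (Z t)) by (apply Rnot_lt_le; intros h; apply Hat, Hv; lra).
  set (z := (x + Z t)%C) in *; set (X := Re z).
  assert (HIm : Im z = Im (Z t)) by (unfold z, Im; simpl; ring).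
  assert (HX : X = x + Re (Z t)) by (unfold X, z, Re; simpl; ring).
  assert (HReB : Rabs (Re (Z t)) <= B) by (eapply Rle_trans; [apply re_le_Cmod | apply HB]).
  assert (HImB : Rabs (Im (Z t)) <= B) by (eapply Rle_trans; [apply im_le_Cmod | apply HB]).
  assert (HX0 := Rabs_pos X).
  assert (Hx : Rabs x <= (1 + B) * (1 + Rabs X)).
  { replace x with (X + - Re (Z t)) by (rewrite HX; ring).
    eapply Rle_trans; [apply Rabs_triang |]; rewrite Rabs_Ropp; nra. }
  assert (Hz : 1 + Cmod z <= (2 + 2 * B) * (1 + Rabs X)).
  { generalize (Cmod_le_Re_Im z); fold X; rewrite HIm; nra. }
  assert (Hcore : Cmod (core z) <= exp (B ^ 2) * exp (- X ^ 2)).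
  { eapply Rle_trans; [apply Cmod_core; lra |]; rewrite <- exp_plus; apply exp_le; fold X.
    rewrite HIm, <- (pow2_abs (Im (Z t))).
    assert (Rabs (Im (Z t)) ^ 2 <= B ^ 2) by (apply pow_incr; split; [apply Rabs_pos | easy]). lra. }
  unfold mono; rewrite Cmod_mult, (Cmod_mult (a t)), (Cmod_mult (z ^ j * (/ z) ^ k)), Cmod_R, <- RPow_abs.
  assert (HE := exp_pos (- X ^ 2)); assert (HE2 := exp_pos (B ^ 2)).
  apply Rle_trans with (((1 + B) * (1 + Rabs X)) ^ m * (A * ((W * ((2 + 2 * B) * (1 + Rabs X)) ^ j) * (exp (B ^ 2) * exp (- X ^ 2))))).
  - apply Rmult_le_compat; [apply pow_le, Rabs_pos | | apply pow_incr; split; [apply Rabs_pos | easy] |].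
    { repeat apply Rmult_le_pos; apply Cmod_ge_0. }
    apply Rmult_le_compat; [apply Cmod_ge_0 | apply Rmult_le_pos; apply Cmod_ge_0 | apply HA |].
    apply Rmult_le_compat; [apply Cmod_ge_0 | apply Cmod_ge_0 | | easy].
    eapply Rle_trans; [now apply HW |]; fold z; apply Rmult_le_compat_l; [easy |].
    apply pow_incr; split; [generalize (Cmod_ge_0 z); lra | easy].
  - replace (((1 + B) * (1 + Rabs X)) ^ m * (A * ((W * ((2 + 2 * B) * (1 + Rabs X)) ^ j) * (exp (B ^ 2) * exp (- X ^ 2)))))
      with ((1 + B) ^ m * (A * (W * (2 + 2 * B) ^ j * exp (B ^ 2))) * ((1 + Rabs X) ^ (m + j) * exp (- X ^ 2)))
      by (rewrite !Rpow_mult_distr, pow_add; ring).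
    apply Rmult_le_compat_l; [easy | apply exp_weight].
Qed.

(** Below the level [d] the amplitude vanishes locally; at a zero of [x + Z] the product is flat
    enough to have derivative 0; elsewhere the chain rule applies. *)
Lemma wedge_is_dt Z Z' d a a' j k :
  smT Z -> smT Z' -> (forall t, isD Z t (Z' t)) -> 0 <= d -> vanishing Z d a -> smT a' -> (forall t, isD a t (a' t)) ->
  (0 < d \/ (k + 2 <= j)%nat) ->
  is_dt (wedge Z a j k) (fun t x => wedge Z a' j k t x + wedge' Z (fun t => Z' t * a t)%C j k t x)%C.
Proof.
  intros HZ HZ' HDZ Hd Hv Ha' HDa Hjk t x; unfold wedge, wedge'.
  assert (HZc := smT_continuous Z HZ).
  destruct (vanishing_deriv Z d a a' HZc Hv Ha' HDa) as [_ Hv'].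
  destruct (Rlt_dec (Im (Z t)) d) as [h | h].
  - destruct (vanishing_locally Z d a t HZc Hv h) as [e He].
    rewrite (Hv' t h), (proj2 Hv t h).
    eapply isD_val; [apply isD_ext_loc_0 with e | ring].
    intros s Hs; rewrite He by easy; ring.
  - assert (Hz : isD (fun s => x + Z s)%C t (Z' t)).
    { eapply isD_val; [apply isD_plus; [apply isD_const | apply HDZ] | ring]. }
    destruct (classic ((x + Z t)%C = 0)) as [E | E].
    + assert (Him : Im (Z t) = 0).
      { apply (f_equal Im) in E; unfold Im in *; simpl in E; lra. }
      destruct Hjk as [Hd' | Hjk]; [lra |].
      rewrite E, mono_at_0, mono'_at_0 by lia.
      destruct (smT_bounded Z HZ) as [B HB], (smT_bounded Z' HZ') as [L HL], (smT_bounded a (proj1 Hv)) as [A HA].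
      assert (HL0 : 0 <= L) by (eapply Rle_trans; [apply Cmod_ge_0 | apply (HL 0)]).
      eapply isD_val; [apply (isD_zero_of_flat a (fun s => x + Z s)%C t A (2 * L) B j k) | ring]; auto; try lra.
      * intros u; replace (x + Z u)%C with (Z u - Z t)%C.
        { apply (isD_Lipschitz Z Z'); auto. }
        transitivity ((x + Z u) - (x + Z t))%C; [ring | rewrite E; ring].
      * intros u; replace (Im (x + Z u)%C) with (Im (Z u)) by (unfold Im; simpl; ring).
        eapply Rle_trans; [apply im_le_Cmod | apply HB].
      * intros u Hu; replace (Im (x + Z u)%C) with (Im (Z u)) by (unfold Im; simpl; ring).
        apply Rnot_lt_le; intros h'; apply Hu, (proj2 Hv); lra.
    + eapply isD_val; [apply isD_mult; [apply HDa | apply (isD_mono (fun s => x + Z s)%C t _ j k Hz E)] | cbv beta; ring].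
Qed.

Lemma wedge_is_dx Z d a j k :
  0 <= d -> vanishing Z d a -> (0 < d \/ (k + 2 <= j)%nat) ->
  is_dx (wedge Z a j k) (wedge' Z a j k).
Proof.
  intros Hd Hv Hjk t x; unfold wedge, wedge'.
  assert (Hz : isD (fun y : R => y + Z t)%C x 1).
  { eapply isD_val; [apply isD_plus; [apply isD_id | apply isD_const] | ring]. }
  destruct (classic ((x + Z t)%C = 0)) as [E | E].
  - assert (Him : Im (Z t) = 0).
    { apply (f_equal Im) in E; unfold Im in *; simpl in E; lra. }
    destruct Hjk as [Hd' | Hjk].
    + rewrite (proj2 Hv t) by lra; eapply isD_val; [apply isD_ext with (fun _ => RtoC 0); [intros; ring | apply isD_const] | ring].
    + rewrite E, mono'_at_0 by lia.
      eapply isD_val; [apply (isD_zero_of_flat (fun _ => a t) (fun y : R => y + Z t)%C x (Cmod (a t)) 1 0 j k) | ring]; auto; try lra.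
      * intros u; replace (u + Z t)%C with (RtoC (u - x)).
        { rewrite Cmod_R; lra. }
        transitivity ((u + Z t) - (x + Z t))%C; [rewrite RtoC_minus; ring | rewrite E; ring].
      * intros u; lra.
      * intros u; replace (Im (u + Z t)%C) with (Im (Z t)) by (unfold Im; simpl; ring).
        rewrite Him, Rabs_R0; lra.
      * intros u _; replace (Im (u + Z t)%C) with (Im (Z t)) by (unfold Im; simpl; ring); lra.
  - eapply isD_val; [apply isD_scal, (isD_mono (fun y : R => y + Z t)%C x _ j k Hz E) | cbv beta; ring].
Qed.

(** Each derivative lowers [j - k] by at most 2, so [n] of them cost [2 n]; at a positive distance
    from the singularity they cost nothing. *)
Lemma Reg_wedge Z : smT Z -> forall n d a j k,
  0 <= d -> vanishing Z d a -> (0 < d \/ (k + 2 * n <= j)%nat) -> Reg decaying2 n (wedge Z a j k).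
Proof.
  intros HZ; destruct (smT_deriv Z HZ) as [Z' [HZ' HDZ]].
  intros n; induction n; intros d a j k Hd Hv Hjk.
  { apply (wedge_decaying Z d); auto; destruct Hjk; [now left | right; lia]. }
  assert (Hjk2 : 0 < d \/ (k + 2 <= j)%nat) by (destruct Hjk; [now left | right; lia]).
  assert (HW' : forall b, vanishing Z d b -> Reg decaying2 n (wedge' Z b j k)).
  { intros b Hb.
    assert (HT : forall (z : C) j' k', (0 < d \/ (k' + 2 * n <= j')%nat) -> Reg decaying2 n (fun t x => z * wedge Z b j' k' t x)%C).
    { intros z j' k' H'; apply (Reg_bounded_decaying n (fun _ _ => z)); [apply Mul_const |].
      now apply (IHn d). }
    replace (wedge' Z b j k) with (fun t x => INR j * wedge Z b (pred j) k t x + (- INR k * wedge Z b j (S k) t x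
      + (- (2) * wedge Z b (S j) k t x + Ci * wedge Z b j (S (S k)) t x)))%C
      by (apply funext2; intros; unfold wedge', wedge, mono'; ring).
    repeat (apply Reg_plus; [exact decaying2_plus | |]); apply HT; destruct Hjk; auto; right; lia. }
  destruct (smT_deriv a (proj1 Hv)) as [a' [Ha' HDa]].
  eapply Reg_intro.
  - apply (wedge_decaying Z d); auto; destruct Hjk; [now left | right; lia].
  - apply (wedge_is_dt Z Z' d a a'); auto.
  - now apply (wedge_is_dx Z d).
  - apply Reg_plus; [exact decaying2_plus | |].
    + apply (IHn d); auto; [| destruct Hjk; [now left | right; lia]].
      apply (vanishing_deriv Z d a); auto using smT_continuous.
    + apply HW'; now apply vanishing_mult.
  - now apply HW'.
Qed.

(** * Non-smoothness of [core] on the real line *)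

Lemma core_real (x : R) : core x = (exp (- x ^ 2) * cos (/ x), - (exp (- x ^ 2) * sin (/ x))).
Proof.
  assert (E : (- (x * x) - Ci * / x)%C = (- x ^ 2, - / x)).
  { destruct (Req_dec x 0) as [-> | H].
    - rewrite Cinv_0, Rinv_0; apply C_ext; unfold Re, Im; simpl; ring.
    - rewrite <- RtoC_inv by easy; apply C_ext; unfold Re, Im; simpl; ring. }
  unfold core; rewrite E; unfold cexp, Re, Im; simpl; rewrite cos_neg, sin_neg.
  f_equal; ring.
Qed.

Lemma CB_Lipschitz h : CB 1 h -> exists M, 0 <= M /\ forall x y, Cmod (h y - h x) <= M * Rabs (y - x).
Proof.
  intros [_ [h' [HD [[M HM] _]]]]; exists (2 * M); split.
  - generalize (Cmod_ge_0 (h' 0)) (HM 0); lra.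
  - intros x y; apply (isD_Lipschitz h h'); auto.
Qed.

(* Compares [core] at the points [1/(2 pi n)] and [1/(2 pi n + pi)]. *)
Lemma core_not_Lipschitz (k : R -> C) (z : C) :
  CB 1 k -> (forall x : R, x <> 0 -> k x = (z * core x)%C) -> z = 0.
Proof.
  intros Hk HE; destruct (CB_Lipschitz k Hk) as [M [HM0 HM]].
  apply Cmod_eq_0, Rle_antisym; [| apply Cmod_ge_0]; apply Rnot_lt_le; intros Hz.
  destruct (INR_unbounded (M / Cmod z)) as [N HN].
  set (n := S N).
  assert (Hn : 1 <= INR n) by (unfold n; rewrite S_INR; generalize (pos_INR N); lra).
  assert (HnM : M < INR n * Cmod z).
  { apply Rlt_div_l; [easy |]; unfold n; rewrite S_INR; lra. }
  assert (HPI := PI2_1).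
  set (u := IZR (Z.of_nat n) * (2 * PI)).
  assert (Hu : 2 * INR n <= u) by (unfold u; rewrite <- INR_IZR_INZ; nra).
  assert (Cu : forall w, cos (w + u) = cos w) by (intros w; apply (periodic_IZR cos (2 * PI) cos_add_2PI)).
  assert (Su : forall w, sin (w + u) = sin w) by (intros w; apply (periodic_IZR sin (2 * PI) sin_add_2PI)).
  set (x := / u); set (y := / (PI + u)).
  assert (Hx0 : 0 < x) by (apply Rinv_0_lt_compat; lra).
  assert (Hy0 : 0 < y) by (apply Rinv_0_lt_compat; lra).
  assert (Hyx : y <= x) by (apply Rinv_le_contravar; lra).
  assert (Hxu : x * u = 1) by (unfold x; field; lra).
  assert (Hx1 : x <= 1 / 2) by nra.
  assert (Hexp : forall w, 0 < w <= 1 / 2 -> 1 / 2 <= exp (- w ^ 2)).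
  { intros w Hw; generalize (exp_ineq1_le (- w ^ 2)); nra. }
  assert (Ex := HE x ltac:(lra)); assert (Ey := HE y ltac:(lra)).
  assert (Ecx : core x = (exp (- x ^ 2), 0)).
  { rewrite core_real; replace (/ x) with (0 + u) by (unfold x; rewrite Rinv_inv; ring).
    rewrite Cu, Su, cos_0, sin_0; f_equal; ring. }
  assert (Ecy : core y = (- exp (- y ^ 2), 0)).
  { rewrite core_real; replace (/ y) with (PI + u) by (unfold y; rewrite Rinv_inv; ring).
    rewrite Cu, Su, cos_PI, sin_PI; f_equal; ring. }
  specialize (HM y x); rewrite Ex, Ey in HM.
  replace (z * core x - z * core y)%C with (z * (core x - core y))%C in HM by ring.
  rewrite Cmod_mult, (Rabs_pos_eq (x - y)) in HM by lra.
  assert (H1 : 1 <= Cmod (core x - core y)).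
  { eapply Rle_trans; [| apply re_le_Cmod]; eapply Rle_trans; [| apply RRle_abs].
    rewrite Ecx, Ecy.
    replace (Re _) with (exp (- x ^ 2) + exp (- y ^ 2)) by (unfold Re, Cminus, Cplus, Copp; cbn [fst snd]; ring).
    generalize (Hexp x ltac:(lra)) (Hexp y ltac:(lra)); lra. }
  assert (H2 : Cmod z <= M * x).
  { apply Rle_trans with (Cmod z * Cmod (core x - core y)); [nra |].
    eapply Rle_trans; [exact HM |]; apply Rmult_le_compat_l; lra. }
  assert (H3 : Cmod z * u <= M).
  { apply Rle_trans with (M * x * u); [apply Rmult_le_compat_r; lra |]. rewrite Rmult_assoc, Hxu; lra. }
  assert (H4 : Cmod z * INR n <= Cmod z * u) by (apply Rmult_le_compat_l; lra).
  lra.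
Qed.

(** One factor [x] is divided out at a time. [k] vanishes at 0 by continuity, as [core] is bounded
    on the real line, and the smooth quotient satisfies the same identity with [m] lowered, until
    [core] itself is left. *)
Lemma pow_core_not_smooth (m : nat) (k : R -> C) (z : C) :
  (forall n, CB n k) -> (forall x : R, x <> 0 -> k x = (z * (x ^ m * core x))%C) -> z = 0.
Proof.
  revert k; induction m; intros k Hk HE.
  - apply (core_not_Lipschitz k); [apply Hk |]; intros x Hx; rewrite HE by easy; simpl; ring.
  - assert (Hcore : forall x : R, Cmod (core x) <= 1).
    { intros x; eapply Rle_trans; [apply Cmod_core; unfold Im; simpl; lra |].
      rewrite <- exp_0; apply exp_le; unfold Im, Re; simpl; nra. }
    destruct (CB_Lipschitz k (Hk 1%nat)) as [M [HM0 HM]].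
    assert (H0 : k 0 = 0).
    { apply Cmod_eq_0, Rle_antisym; [| apply Cmod_ge_0]; apply Rnot_lt_le; intros h.
      (* At the point [x] chosen below, [|k 0| <= (|z| + M) x < A x <= |k 0| / 2], a
         contradiction. *)
      set (A := Cmod z + M + 1); assert (HA : 1 <= A) by (unfold A; generalize (Cmod_ge_0 z); lra).
      set (x := Rmin 1 (Cmod (k 0) / (2 * A))).
      assert (Hx1 : x <= 1) by apply Rmin_l.
      assert (Hx0 : 0 < x) by (apply Rmin_pos; [lra | apply Rdiv_lt_0_compat; lra]).
      assert (Hx2 : x * (2 * A) <= Cmod (k 0)) by (apply Rle_div_r; [lra | apply Rmin_r]).
      assert (Hk1 : Cmod (k x) <= Cmod z * x).
      { rewrite HE, !Cmod_mult, Cmod_pow, Cmod_R, Rabs_pos_eq by lra.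
        apply Rmult_le_compat_l; [apply Cmod_ge_0 |].
        apply Rle_trans with (x ^ 1 * 1); [| simpl; lra].
        apply Rmult_le_compat; auto using Cmod_ge_0; [apply pow_le; lra |].
        assert (x ^ m <= 1) by (rewrite <- (pow1 m); apply pow_incr; lra).
        simpl; nra. }
      assert (Hk2 : Cmod (k 0) <= Cmod (k x) + M * x).
      { replace (k 0) with (k x + (k 0 - k x))%C by ring.
        eapply Rle_trans; [apply Cmod_triangle |]; apply Rplus_le_compat_l.
        eapply Rle_trans; [apply HM |]; rewrite Rminus_0_l, Rabs_Ropp, Rabs_pos_eq; lra. }
      unfold A in *; nra. }
    destruct (smooth_division k Hk H0) as [k1 [Hk1 E1]].
    apply (IHm k1 Hk1); intros x Hx.
    assert (Hx' : RtoC x <> 0) by (intros E; apply Hx; now injection E).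
    transitivity (/ x * k x)%C; [rewrite E1; field; easy |].
    rewrite HE by easy; simpl; field; easy.
Qed.

(** [L U = (A' + q A) mono 8 0 + A (Z' + c) mono' 8 0]: the second term vanishes and the first stays
    away from the singularity, so it is Schwartz. On the line [t = t0], [U] is [A t0] times
    [x^8 core x]. The exponent is [8 = 0 + 2 * 4], the price of four derivatives. *)
Lemma singular_solution c q A Z A' Z' d t0 :
  smT c -> smT q -> smT Z -> vanishing Z 0 A -> smT A' -> smT Z' ->
  (forall t, isD A t (A' t)) -> (forall t, isD Z t (Z' t)) ->
  0 < d -> vanishing Z d (fun t => A' t + q t * A t)%C ->
  (forall t, (A t * (Z' t + c t))%C = 0) -> Z t0 = 0 -> A t0 <> 0 -> ~ Schwartz_GH c q.
Proof.
  intros Hc Hq HZ HA HA' HZ' HDA HDZ Hd HR HAZ HZ0 HA0.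
  assert (H8 : (0 + 2 <= 8)%nat) by lia.
  set (U := wedge Z A 8 0).
  assert (HU : Reg decaying2 4 U) by (apply (Reg_wedge Z HZ 4 0); [lra | easy | right; lia]).
  apply (not_GH_of_nonsmooth_solution c q U Hc Hq).
  - now apply Reg_decaying_bounded.
  - replace (LL c q U) with (wedge Z (fun t => A' t + q t * A t)%C 8 0).
    + intros n; apply (Reg_wedge Z HZ n d); [lra | easy | now left].
    + apply funext2; intros t x; unfold LL, U.
      rewrite (is_dt_cdt _ _ (wedge_is_dt Z Z' 0 A A' 8 0 HZ HZ' HDZ (Rle_refl 0) HA HA' HDA (or_intror H8))).
      rewrite (is_dx_cdx _ _ (wedge_is_dx Z 0 A 8 0 (Rle_refl 0) HA (or_intror H8))).
      unfold wedge, wedge'; set (m := mono 8 0 _); set (m' := mono' 8 0 _).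
      transitivity ((A' t + q t * A t) * m + A t * (Z' t + c t) * m')%C; [rewrite HAZ; ring | ring].
  - intros HS; apply HA0.
    apply (pow_core_not_smooth 8 (U t0)); [intros n; apply Reg_CB, Sch_Mul, HS |].
    intros x _; unfold U, wedge, mono; rewrite HZ0; replace (x + 0)%C with (RtoC x) by ring; simpl; ring.
Qed.

(** * Sign change of the imaginary part *)

Lemma smT_primitive a : smT a -> primitive a (2 * PI) = 0 -> smT (primitive a).
Proof.
  intros Ha H0.
  assert (Ca := smT_continuous a Ha).
  assert (HB : bounded2 (fun t _ => primitive a t)).
  { assert (Pp : forall t, primitive a (t + 2 * PI) = primitive a t).
    { intros t; rewrite primitive_period, H0; [ring | easy | now apply smT_periodic]. }
    split; [intros t x; apply Pp |].
    destruct (Cperiodic_continuous_bounded (primitive a) Pp) as [M HM]; [| now exists M].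
    apply (isD_Ccontinuous _ a); intros t; now apply isD_primitive. }
  intros n; destruct n; [easy |].
  apply Reg_intro with (fun t _ => a t) (fun _ _ => 0); [easy | | | apply Ha | apply (Mul_const 0)].
  - intros t x; now apply isD_primitive.
  - intros t x; apply isD_const.
Qed.

Lemma smT_cexp a : smT a -> smT (fun t => cexp (a t)).
Proof.
  intros Ha; destruct (smT_deriv a Ha) as [a' [Ha' HD]].
  assert (HB : bounded2 (fun t _ => cexp (a t))).
  { split; [intros t x; now rewrite (smT_periodic a Ha) |].
    destruct (smT_bounded a Ha) as [M HM]; exists (exp M); intros t _.
    rewrite Cmod_cexp; apply exp_le; eapply Rle_trans; [apply RRle_abs |].
    eapply Rle_trans; [apply re_le_Cmod | apply HM]. }
  intros n; induction n; [easy |].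
  apply Reg_intro with (fun t _ => a' t * cexp (a t))%C (fun _ _ => 0); [easy | | | | apply (Mul_const 0)].
  - intros t x; now apply isD_cexp.
  - intros t x; apply isD_const.
  - apply (Reg_mult bounded2 bounded2 bounded2_plus bounded2_mult n (fun t _ => a' t)); [apply Ha' | easy].
Qed.

Lemma primitive_RtoC (f : R -> R) t : primitive (fun s => RtoC (f s)) t = RtoC (RInt f 0 t).
Proof.
  apply C_ext; unfold primitive, CRI; simpl; [easy |].
  rewrite RInt_const; unfold scal; simpl; unfold mult; simpl; ring.
Qed.

Lemma primitive_diff_zero a s t :
  Ccontinuous a -> (forall u, Rmin s t <= u <= Rmax s t -> a u = 0) -> primitive a t = primitive a s.
Proof.
  intros Ca H.
  assert (E : Cmod (primitive a t - primitive a s) <= 2 * 0 * Rabs (t - s)).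
  { apply (isD_Lipschitz (primitive a) a); [intros; now apply isD_primitive |].
    intros x Hx; rewrite H, Cmod_0 by easy; lra. }
  assert (E0 : (primitive a t - primitive a s)%C = 0).
  { apply Cmod_eq_0; generalize (Cmod_ge_0 (primitive a t - primitive a s)); lra. }
  transitivity ((primitive a t - primitive a s) + primitive a s)%C; [ring | rewrite E0; ring].
Qed.

Lemma primitive_lin (z w : C) a b t :
  Ccontinuous a -> Ccontinuous b ->
  primitive (fun s => z * a s + w * b s)%C t = (z * primitive a t + w * primitive b t)%C.
Proof.
  intros Ha Hb; unfold primitive; rewrite CRI_plus, !CRI_scal; auto;
    apply Ccontinuous_mult; auto using Ccontinuous_const.
Qed.

Lemma tbump_zero m r n t (j : Z) :
  0 < r < PI -> m + IZR j * (2 * PI) + r <= t <= m + IZR j * (2 * PI) + 2 * PI - r -> tbump m r n t = 0.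
Proof.
  intros Hr Ht; apply NNPP; intros H.
  destruct (tbump_support m r n t Hr H) as [k Hk]; apply Rabs_def2 in Hk.
  assert (HP := two_PI_pos).
  destruct (Z_le_gt_dec 0 (k + j)) as [h | h].
  - apply IZR_le in h; rewrite plus_IZR in h; nra.
  - assert (h' : (k + j <= -1)%Z) by lia; apply IZR_le in h'; rewrite plus_IZR in h'; nra.
Qed.

Lemma tbump_continuous m r n t : continuous (tbump m r n) t.
Proof. exact (proj1 (smT_continuous _ (smT_tbump m r n) t)). Qed.

Lemma tbump_integral_pos m r n : 0 < r < PI -> 0 < RInt (tbump m r n) 0 (2 * PI).
Proof.
  intros Hr; destruct (period_representative m 0 (2 * PI) two_PI_pos) as [k Hk]; rewrite Rplus_0_l in Hk.
  apply RInt_pos_of_point with (m + IZR k * (2 * PI)); auto using tbump_continuous.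
  - intros t; apply flat_nonneg.
  - rewrite (periodic_IZR (tbump m r n) (2 * PI)); [now apply tbump_pos |].
    intros t; unfold tbump; replace (t + 2 * PI + - m) with (t + - m + 2 * PI) by ring; now rewrite cos_add_2PI.
Qed.

Lemma increases_right (f df : R -> R) (s e : R) :
  (forall x, is_derive f x (df x)) -> (forall x, continuous df x) -> 0 < df s -> 0 < e ->
  exists h, 0 < h < e /\ f s < f (s + h).
Proof.
  intros HD HC Hs He.
  destruct (HC s (fun y => 0 < y) (open_gt 0 (df s) Hs)) as [d Hd].
  assert (H0 : 0 < Rmin e d) by (apply Rmin_pos; [easy | apply cond_pos]).
  assert (H1 : Rmin e d <= e) by apply Rmin_l; assert (H2 : Rmin e d <= d) by apply Rmin_r.
  exists (Rmin e d / 2); split; [lra |].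
  destruct (MVT_gen f s (s + Rmin e d / 2) df) as [x [Hx E]].
  - intros; apply HD.
  - intros; apply continuity_pt_filterlim; exact (is_derive_continuous _ _ _ (HD x)).
  - rewrite Rmin_left, Rmax_right in Hx by lra.
    assert (0 < df x).
    { apply Hd; change (Rabs (x - s) < d); rewrite Rabs_pos_eq; lra. }
    nra.
Qed.

Lemma continuous_below (f : R -> R) (s v : R) :
  continuous f s -> f s < v -> exists r, 0 < r /\ forall t, Rabs (t - s) <= r -> f t < v.
Proof.
  intros HC Hv; destruct (HC (fun y => y < v) (open_lt v (f s) Hv)) as [d Hd].
  exists (d / 2); split; [generalize (cond_pos d); lra |].
  intros t Ht; apply Hd; change (Rabs (t - s) < d); generalize (cond_pos d); lra.
Qed.

(** Take [s1] with [b s1 > 0] and translate a point with [b < 0] to [s2] within the period after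
    [s1]; the maximum of [B] over [[s1, s2]] then exceeds both end values. [B] is not periodic in
    general, so the peak is relative to this arc. The arc from [s2] to [s1 + 2 PI] keeps length at
    least [4 r], room for a correcting bump. *)
Lemma peak_of_sign_change (B b : R -> R) :
  (forall t, is_derive B t (b t)) -> (forall t, continuous b t) -> (forall t, b (t + 2 * PI) = b t) ->
  ~ (forall t, 0 <= b t) -> ~ (forall t, b t <= 0) ->
  exists s1 s2 t0 r d, 0 < r < PI /\ 0 < d /\ s1 + r <= t0 <= s2 - r /\ s2 + 4 * r <= s1 + 2 * PI /\
    (forall t, s1 <= t <= s2 -> B t <= B t0) /\
    (forall t, Rabs (t - s1) <= r -> B t < B t0 - d) /\ (forall t, Rabs (t - s2) <= r -> B t < B t0 - d).
Proof.
  intros HD HC HP Hn1 Hn2.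
  apply not_all_ex_not in Hn1; destruct Hn1 as [s2' H2']; apply Rnot_le_lt in H2'.
  apply not_all_ex_not in Hn2; destruct Hn2 as [s1 H1]; apply Rnot_le_lt in H1.
  destruct (period_representative s2' s1 (2 * PI) two_PI_pos) as [k Hk].
  set (s2 := s2' + IZR k * (2 * PI)) in *.
  assert (H2 : b s2 < 0) by (unfold s2; rewrite (periodic_IZR b (2 * PI) HP); easy).
  assert (Hlt : s1 < s2) by (destruct Hk as [[h | h] _]; [easy | rewrite <- h in H2; lra]).
  assert (HBc : forall t, continuous B t) by (intros t; exact (is_derive_continuous _ _ _ (HD t))).
  destruct (continuity_ab_maj B s1 s2 (Rlt_le _ _ Hlt)) as [t0 [Hmax Ht0]].
  { intros t _; apply continuity_pt_filterlim, HBc. }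
  assert (HB1 : B s1 < B t0).
  { destruct (increases_right B b s1 (s2 - s1) HD HC H1) as [h [Hh Hlt1]]; [lra |].
    eapply Rlt_le_trans; [exact Hlt1 | apply Hmax; lra]. }
  assert (HB2 : B s2 < B t0).
  { destruct (increases_right (fun u => B (- u)) (fun u => - b (- u)) (- s2) (s2 - s1)) as [h [Hh Hlt2]]; try lra.
    - intros u; eapply is_derive_val; [apply (is_derive_Rcomp B Ropp u _ _ (HD (- u)) (is_derive_Ropp _ _ _ (is_derive_id u))) |].
      unfold one; simpl; ring.
    - intros u; apply (continuous_opp (fun u => b (- u))).
      apply (continuous_comp Ropp b); [| apply HC]. apply (continuous_opp (fun x : R => x)), continuous_id.
    - rewrite Ropp_involutive; lra.
    - rewrite Ropp_involutive in Hlt2; eapply Rlt_le_trans; [exact Hlt2 | apply Hmax; lra]. }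
  (* Half the smaller drop, so that strict inequality survives on neighbourhoods of [s1] and
     [s2]. *)
  set (d := Rmin (B t0 - B s1) (B t0 - B s2) / 2).
  assert (Hm1 : Rmin (B t0 - B s1) (B t0 - B s2) <= B t0 - B s1) by apply Rmin_l.
  assert (Hm2 : Rmin (B t0 - B s1) (B t0 - B s2) <= B t0 - B s2) by apply Rmin_r.
  assert (Hm0 : 0 < Rmin (B t0 - B s1) (B t0 - B s2)) by (apply Rmin_pos; lra).
  destruct (continuous_below B s1 (B t0 - d) (HBc s1)) as [r1 [Hr1 HB1']]; [unfold d; lra |].
  destruct (continuous_below B s2 (B t0 - d) (HBc s2)) as [r2 [Hr2 HB2']]; [unfold d; lra |].
  set (r := Rmin (Rmin r1 r2) (Rmin 1 ((s1 + 2 * PI - s2) / 4))).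
  assert (Ra : r <= r1) by (eapply Rle_trans; [apply Rmin_l | apply Rmin_l]).
  assert (Rb : r <= r2) by (eapply Rle_trans; [apply Rmin_l | apply Rmin_r]).
  assert (Rc : r <= 1) by (eapply Rle_trans; [apply Rmin_r | apply Rmin_l]).
  assert (Rd : r <= (s1 + 2 * PI - s2) / 4) by (eapply Rle_trans; [apply Rmin_r | apply Rmin_r]).
  assert (R0 : 0 < r) by (repeat apply Rmin_pos; lra).
  assert (HPI := PI2_1).
  assert (G1 : forall t, Rabs (t - s1) <= r -> B t < B t0 - d) by (intros; apply HB1'; lra).
  assert (G2 : forall t, Rabs (t - s2) <= r -> B t < B t0 - d) by (intros; apply HB2'; lra).
  assert (Hd : 0 < d) by (unfold d; lra).
  exists s1, s2, t0, r, d; repeat split; auto; try lra.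
  - apply Rnot_lt_le; intros h; assert (B t0 < B t0 - d); [| lra].
    apply G1; rewrite Rabs_pos_eq; lra.
  - apply Rnot_lt_le; intros h; assert (B t0 < B t0 - d); [| lra].
    apply G2; rewrite Rabs_left1; lra.
Qed.

(** [chi] rises near [s1] and falls near [s2], both places where [Im Z > d]; between them
    [Im Z >= 0], with [Z] measured from the peak. Hence the amplitude [E chi] may touch the
    singularity, while the amplitude [E chi'] left in [L U] stays away from it. *)
Lemma not_GH_of_sign_change c q :
  smT c -> smT q -> ~ (forall t, 0 <= Im (c t)) -> ~ (forall t, Im (c t) <= 0) -> ~ Schwartz_GH c q.
Proof.
  intros Sc Sq Hn1 Hn2.
  assert (Cc := smT_continuous c Sc); assert (Cq := smT_continuous q Sq).
  destruct (peak_of_sign_change (fun t => Im (primitive c t)) (fun t => Im (c t)))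
    as [s1 [s2 [t0 [r [d [Hr [Hd [Ht0 [Hs [Hmax [HB1 HB2]]]]]]]]]]]; auto.
  { intros t; exact (proj2 (isD_primitive c t Cc)). }
  { exact (fun t => proj2 (Cc t)). }
  { intros t; now rewrite (smT_periodic c Sc). }
  (* [s3] is the midpoint of the free arc from [s2] to [s1 + 2 PI], and [[w, s3]] is the period on
     which supports are examined. *)
  set (s3 := (s1 + s2) / 2 + PI); set (w := (s1 + s2) / 2 - PI).
  assert (Hs3 : s3 = w + 2 * PI) by (unfold s3, w; ring).
  assert (Hw1 : w + r <= s1) by (unfold w; lra).
  assert (Hw2 : s1 + r <= s3) by (unfold s3; lra).
  assert (Hw3 : s2 + 2 * r <= s3) by (unfold s3; lra).
  assert (Hw4 : s3 <= s1 + 2 * PI - 2 * r) by (unfold s3; lra).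
  set (e1 := fun t => RtoC (tbump s1 r 0 t)); set (e2 := fun t => RtoC (tbump s2 r 0 t)); set (e3 := fun t => RtoC (tbump s3 r 0 t)).
  assert (S1 : smT e1) by apply smT_tbump; assert (S2 : smT e2) by apply smT_tbump; assert (S3 : smT e3) by apply smT_tbump.
  assert (C1 := smT_continuous e1 S1); assert (C2 := smT_continuous e2 S2); assert (C3 := smT_continuous e3 S3).
  assert (HN : forall m, primitive (fun t => RtoC (tbump m r 0 t)) (2 * PI) <> 0).
  { intros m; rewrite primitive_RtoC; intros E; injection E; generalize (tbump_integral_pos m r 0 Hr); lra. }
  set (N1 := primitive e1 (2 * PI)); set (N2 := primitive e2 (2 * PI)); set (N3 := primitive e3 (2 * PI)).
  assert (HN2 : N2 <> 0) by apply HN; assert (HN3 : N3 <> 0) by apply HN.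
  assert (Z1 : forall t, w <= t <= s3 -> (t <= s1 - r \/ s1 + r <= t) -> e1 t = 0).
  { intros t Ht Hor; unfold e1; f_equal; destruct Hor.
    - apply (tbump_zero s1 r 0 t (-1) Hr); lra.
    - apply (tbump_zero s1 r 0 t 0 Hr); lra. }
  assert (Z2 : forall t, w <= t <= s3 -> (t <= s2 - r \/ s2 + r <= t) -> e2 t = 0).
  { intros t Ht Hor; unfold e2; f_equal; destruct Hor.
    - apply (tbump_zero s2 r 0 t (-1) Hr); lra.
    - apply (tbump_zero s2 r 0 t 0 Hr); lra. }
  assert (Z3 : forall t, s1 - r <= t <= s2 + r -> e3 t = 0).
  { intros t Ht; unfold e3; f_equal; apply (tbump_zero s3 r 0 t (-1) Hr); lra. }
  (* Subtracting bumps supported away from [s1 - r, s2 + r] gives [c] and [q] mean zero, hence periodic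
     primitives, without changing them where [chi] lives. *)
  set (ct := fun t => (1 * c t + - (primitive c (2 * PI) / N3) * e3 t)%C).
  set (qt := fun t => (1 * q t + - (primitive q (2 * PI) / N3) * e3 t)%C).
  assert (Sct : smT ct) by (apply smT_plus; now apply smT_scal).
  assert (Sqt : smT qt) by (apply smT_plus; now apply smT_scal).
  assert (Cct := smT_continuous ct Sct); assert (Cqt := smT_continuous qt Sqt).
  assert (SPc : smT (primitive ct)).
  { apply smT_primitive; [easy |]; unfold ct; rewrite primitive_lin by easy; fold N3; field; easy. }
  assert (SPq : smT (primitive qt)).
  { apply smT_primitive; [easy |]; unfold qt; rewrite primitive_lin by easy; fold N3; field; easy. }
  (* The weights [N2] and [- N1] give [e] mean zero, so that its primitive [chi] is periodic. *)
  set (e := fun t => (N2 * e1 t + - N1 * e2 t)%C).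
  assert (Se : smT e) by (apply smT_plus; now apply smT_scal).
  assert (Ce := smT_continuous e Se).
  assert (He0 : primitive e (2 * PI) = 0) by (unfold e; rewrite primitive_lin by easy; fold N1 N2; ring).
  assert (SPe : smT (primitive e)) by now apply smT_primitive.
  set (chi := fun t => (primitive e t - primitive e w)%C).
  assert (Schi : smT chi).
  { exact (smT_plus _ _ SPe (smT_const (- primitive e w))). }
  assert (Dchi : forall t, isD chi t (e t)).
  { intros t; eapply isD_val; [apply isD_minus; [now apply isD_primitive | apply isD_const] | ring]. }
  assert (Hchi : forall t, w <= t <= s3 -> (t <= s1 - r \/ s2 + r <= t) -> chi t = 0).
  { intros t Ht [h | h]; unfold chi.
    - rewrite (primitive_diff_zero e w t Ce); [ring |].
      intros u Hu; rewrite Rmin_left, Rmax_right in Hu by lra.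
      unfold e; rewrite Z1, Z2 by lra; ring.
    - assert (E : primitive e s3 = primitive e w).
      { rewrite Hs3, primitive_period, He0; [ring | easy | now apply smT_periodic]. }
      rewrite <- E, (primitive_diff_zero e s3 t Ce); [ring |].
      intros u Hu; rewrite Rmin_right, Rmax_left in Hu by lra.
      unfold e; rewrite Z1, Z2 by lra; ring. }
  (* Zero at the peak, with derivative [- ct], and periodic because [ct] has mean zero. *)
  set (zt := fun t => (primitive ct t0 + - (1) * primitive ct t)%C).
  assert (SZ : smT zt) by exact (smT_plus _ _ (smT_const _) (smT_scal _ _ SPc)).
  assert (HZ : forall t, s1 - r <= t <= s2 + r -> Im (zt t) = Im (primitive c t0) - Im (primitive c t)).
  { intros t Ht; unfold zt, ct; rewrite !primitive_lin by easy.
    rewrite (primitive_diff_zero e3 t0 t C3).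
    - set (p := primitive c (2 * PI)); set (x := primitive c t0); set (y := primitive c t); set (z := primitive e3 t0).
      transitivity (Im (x - y)%C); [f_equal; ring | unfold Im; simpl; ring].
    - intros u Hu; apply Z3; split.
      + eapply Rle_trans; [| apply Hu]; apply Rmin_glb; lra.
      + eapply Rle_trans; [apply Hu |]; apply Rmax_lub; lra. }
  (* Integrating factor: with [A = E chi], only [E chi'] remains of [A' + qt A]. *)
  set (E := fun t => cexp (- (1) * primitive qt t)).
  assert (SE : smT E) by (apply smT_cexp, smT_scal; easy).
  assert (DE : forall t, isD E t (- qt t * E t)%C).
  { intros t; eapply isD_val; [apply isD_cexp, isD_scal; now apply isD_primitive | unfold E; ring]. }
  assert (Hwin : forall (P : R -> Prop), (forall t (k : Z), P (t + IZR k * (2 * PI)) -> P t) -> (forall t, w <= t <= s3 -> P t) -> forall t, P t).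
  { intros P HP HPw t; destruct (period_representative t w (2 * PI) two_PI_pos) as [k Hk].
    apply (HP t k), HPw; lra. }
  assert (Per : forall a, smT a -> forall (k : Z) t, a (t + IZR k * (2 * PI)) = a t).
  { intros a Ha; apply (periodic_IZR a (2 * PI) (smT_periodic a Ha)). }
  (* The corrections of [c] and [q] are multiples of [e3], so they disappear wherever [chi]
     multiplies them. *)
  assert (Hchi3 : forall t, (chi t * e3 t)%C = 0).
  { apply Hwin.
    - intros t k; now rewrite (Per chi Schi), (Per e3 S3).
    - intros t Ht; destruct (Rle_dec t (s1 - r)) as [h | h]; [rewrite Hchi by (auto; lra); ring |].
      destruct (Rle_dec (s2 + r) t) as [h' | h']; [rewrite Hchi by (auto; lra); ring |].
      rewrite Z3 by lra; ring. }
  apply (singular_solution c q (fun t => E t * chi t)%C zt (fun t => - qt t * E t * chi t + E t * e t)%C (fun t => - (1) * ct t)%C d t0); auto.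
  - split; [now apply smT_mult |].
    apply (Hwin (fun t => Im (zt t) < 0 -> (E t * chi t)%C = 0)).
    + intros t k; now rewrite (Per zt SZ), (Per E SE), (Per chi Schi).
    + intros t Ht HIm.
      destruct (Rle_dec t (s1 - r)) as [h | h]; [rewrite Hchi by (auto; lra); ring |].
      destruct (Rle_dec (s2 + r) t) as [h' | h']; [rewrite Hchi by (auto; lra); ring |].
      exfalso; rewrite HZ in HIm by lra.
      destruct (Rle_dec (Rabs (t - s1)) r) as [g | g]; [specialize (HB1 t g); lra |].
      destruct (Rle_dec (Rabs (t - s2)) r) as [g' | g']; [specialize (HB2 t g'); lra |].
      assert (s1 <= t) by (apply Rnot_lt_le; intros i; apply g; rewrite Rabs_left1; lra).
      assert (t <= s2) by (apply Rnot_lt_le; intros i; apply g'; rewrite Rabs_pos_eq; lra).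
      specialize (Hmax t (conj H H0)); lra.
  - apply (smT_plus (fun t => - qt t * E t * chi t)%C (fun t => E t * e t)%C); [| now apply smT_mult].
    apply (smT_mult (fun t => - qt t * E t)%C chi); [| easy].
    apply (smT_mult (fun t => - qt t)%C E); [| easy].
    replace (fun t => - qt t)%C with (fun t => - (1) * qt t)%C by (apply functional_extensionality; intros; ring).
    now apply smT_scal.
  - now apply smT_scal.
  - intros t; eapply isD_val; [apply isD_mult; [apply DE | apply Dchi] | cbv beta; ring].
  - intros t; unfold zt; eapply isD_val; [apply isD_plus; [apply isD_const | apply isD_scal; now apply isD_primitive] | ring].
  - replace (fun t => - qt t * E t * chi t + E t * e t + q t * (E t * chi t))%C with (fun t => E t * e t)%C.
    + split; [now apply smT_mult |].
      apply (Hwin (fun t => Im (zt t) < d -> (E t * e t)%C = 0)).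
      * intros t k; now rewrite (Per zt SZ), (Per E SE), (Per e Se).
      * intros t Ht HIm; unfold e.
        (* Contrapositive of the drop: within [r] of [s1] or [s2] one has [Im Z > d], so below the
           level [d] both bumps vanish. *)
        assert (Far : forall s, s1 <= s <= s2 -> (forall t, Rabs (t - s) <= r -> Im (primitive c t) < Im (primitive c t0) - d) ->
          t <= s - r \/ s + r <= t).
        { intros s Hs' HB; destruct (Rle_dec (Rabs (t - s)) r) as [g | g].
          - exfalso; assert (g' := g); apply Rabs_le_between in g'; rewrite HZ in HIm by lra; specialize (HB t g); lra.
          - destruct (Rle_dec t s) as [i | i]; [left; rewrite Rabs_left1 in g | right; rewrite Rabs_pos_eq in g]; lra. }
        rewrite Z1 by (try apply Far; auto; lra); rewrite Z2 by (try apply Far; auto; lra); ring.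
    + apply functional_extensionality; intros t.
      transitivity (E t * e t + (primitive q (2 * PI) / N3) * E t * (chi t * e3 t))%C; [rewrite Hchi3; ring | unfold qt; ring].
  - intros t; transitivity (primitive c (2 * PI) / N3 * E t * (chi t * e3 t))%C; [unfold ct; ring | rewrite Hchi3; ring].
  - unfold zt; ring.
  (* [chi t0] is [N2] times the integral of [e1] over [[w, t0]], an interval that contains [s1] and
     ends before the bump at [s2] begins; hence it is nonzero. *)
  - intros H0; assert (Hne : chi t0 = 0).
    { transitivity (cexp (- (- (1) * primitive qt t0)) * (E t0 * chi t0))%C; [| rewrite H0; ring].
      rewrite Cmult_assoc; unfold E; rewrite (Cmult_comm (cexp (- _))), cexp_opp; ring. }
    unfold chi, e in Hne; rewrite !primitive_lin in Hne by easy.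
    rewrite (primitive_diff_zero e2 w t0 C2) in Hne.
    2: { intros u Hu; rewrite Rmin_left, Rmax_right in Hu by lra; apply Z2; [lra | left; lra]. }
    assert (HI : 0 < RInt (tbump s1 r 0) w t0).
    { apply RInt_pos_of_point with s1; auto using tbump_continuous; [intros; apply flat_nonneg | lra | now apply tbump_pos]. }
    unfold e1 in Hne; rewrite !primitive_RtoC in Hne; fold e2 in Hne.
    rewrite (RInt_split (tbump s1 r 0) 0 w t0) in Hne by apply tbump_continuous.
    assert (E0 : (N2 * RtoC (RInt (tbump s1 r 0) w t0))%C = 0).
    { rewrite <- Hne, RtoC_plus; ring. }
    apply (f_equal Cmod) in E0; rewrite Cmod_mult, Cmod_R, Cmod_0, Rabs_pos_eq in E0 by lra.
    assert (0 < Cmod N2) by now apply Cmod_gt_0.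
    generalize (Rmult_lt_0_compat _ _ H HI); lra.
Qed.

Theorem theorem1p1 (c q : R -> C) (hc : smooth_T1 c) (hq : smooth_T1 q) :
  Schwartz_GH c q <->
  ((forall p : Z * R, ~ Z_L0 c q p) /\
   ((forall t, 0 <= Im (c t)) \/ (forall t, Im (c t) <= 0))).
Proof.
  assert (Sc := smooth_T1_smT c hc); assert (Sq := smooth_T1_smT q hq).
  split.
  - intros HGH; split.
    + intros p Hp; exact (not_GH_of_Z c q p Sc Sq Hp HGH).
    + apply NNPP; intros H; apply not_or_and in H; destruct H as [H1 H2].
      exact (not_GH_of_sign_change c q Sc Sq H1 H2 HGH).
  - intros [HZ Hb]; now apply sufficiency.
Qed.
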